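(* Let $f\in\mathcal{D}(\mathcal{A}_L)\cap\mathcal{D}(\mathcal{B}_L)$ (these domains do not depend on $L\ne 0$), $\|f\|_2=1$, and suppose that for all $k=1,\dots,d$ $$|f(x_1,\dots,x_k,\dots,x_d)|=|f(x_1,\dots,-x_k,\dots,x_d)|,\qquad |\widehat f(x_1,\dots,x_k,\dots,x_d)|=|\widehat f(x_1,\dots,-x_k,\dots,x_d)|.$$ Denote $$M_k=(2\pi)^2\int_{\mathbb{R}^d}x_k^2|f(x)|^2\,\mathrm{d}x,\qquad \widehat M_k=\int_{\mathbb{R}^d}x_k^2|\widehat f(x)|^2\,\mathrm{d}x.$$ Let $A$ be the $d\times d$ matrix with elements $(M_k\widehat M_j+M_j\widehat M_k)/2$, $j,k=1,\dots,d$. For $q=0,1,\dots,d-1$ and distinct indices $j_1,\dots,j_q$, let $A_{j_1,\dots,j_q}$ be the submatrix obtained from $A$ by removing its $j_1$-th, $\dots$, $j_q$-th rows and $j_1$-th, $\dots$, $j_q$-th columns (for $q=0$ this is $A$ itself). Let $\mathbf{A}$ be the set of all those matrices $A_{j_1,\dots,j_q}$ whose determinant is not equal to zero and for which all coordinates of the vector $A_{j_1,\dots,j_q}^{-1}E$ are nonnegative, where $E=(1,\dots,1)\in\mathbb{R}^{d-q}$. Then $$\min_{\|L\|=1}\mathrm{UP}_L(f)=\min_{L\in\mathcal{L}}\mathrm{UP}_L(f)\qquad\text{and}\qquad \max_{\|L\|=1}\mathrm{UP}_L(f)=\max_{L\in\mathcal{L}}\mathrm{UP}_L(f),$$ where $\mathcal{L}$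 is the set of all vectors $L\in\mathbb{R}^d$ with $\|L\|=1$ such that, for some $B=A_{j_1,\dots,j_q}\in\mathbf{A}$, the vector $v:=(L_1^2,\dots,L_d^2)$ has zero coordinates at the positions $j_1,\dots,j_q$ and its remaining coordinates, in order, form the vector $B^{-1}E/\|B^{-1}E\|_1$, with $\|\cdot\|_1$ the $l_1$-norm.
   Context: Notation: $d\in\mathbb{N}$; $\langle x,y\rangle$ and $\|x\|$ are the Euclidean inner product and norm on $\mathbb{R}^d$; functions are complex-valued; $\|f\|_2$ and $\langle f,g\rangle=\int_{\mathbb{R}^d}f\overline g$ are the norm and inner product of $L_2(\mathbb{R}^d)$. The Fourier transform is $\widehat f(\xi)=\int_{\mathbb{R}^d}f(x)\mathrm{e}^{-2\pi\mathrm{i}\langle x,\xi\rangle}\,\mathrm{d}x$, extended to $L_2(\mathbb{R}^d)$. For $L\in\mathbb{R}^d\setminus\{0\}$, $\frac{\partial f}{\partial L}=\sum_{j=1}^dL_j\frac{\partial f}{\partial x_j}$ and $$\mathcal{A}_Lf(x)=2\pi\langle L,x\rangle f(x),\qquad \mathcal{B}_Lf(x)=\frac{\mathrm{i}}{2\pi}\frac{\partial f}{\partial L}(x),$$ with $\mathcal{D}(\mathcal{A}_L)=\{f\in L_2(\mathbb{R}^d):\int\|x\|^2|f(x)|^2\mathrm{d}x<\infty\}$ and $\mathcal{D}(\mathcal{B}_L)=H^1(\mathbb{R}^d)$ (functions in $L_2(\mathbb{R}^d)$ whose first-order derivatives are in $L_2(\mathbb{R}^d)$). $\Delta(\mathcal{A},f)=\|\mathcal{A}f\|_2^2-\frac{|\langle\mathcal{A}f,f\rangle|^2}{\|f\|_2^2}$,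 and $$\mathrm{UP}_L(f)=\frac{\Delta(\mathcal{A}_L,f)\Delta(\mathcal{B}_L,f)}{\|L\|^4\|f\|_2^4}.$$ *)

(* Defs.v *)
From HB Require Import structures.
From mathcomp Require Import all_boot all_order all_algebra.
From mathcomp Require Import all_classical all_reals all_analysis.
From mathcomp Require Import complex.

Set Implicit Arguments.
Unset Strict Implicit.
Unset Printing Implicit Defensive.

Import Order.TTheory GRing.Theory Num.Theory.
Import numFieldNormedType.Exports.
Import ComplexField.

Local Open Scope classical_set_scope.
Local Open Scope ring_scope.

(* The Borel sigma-algebra of R^n, generated by the coordinates. *)
Section measurable_rV.
Context {R : realType} (n : nat).

Let coors : 'I_n -> 'rV[R]_n -> measurableTypeR R := fun i x => x 0 i.

Let rV_set0 : g_sigma_preimage coors set0.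
Proof. exact: sigma_algebra0. Qed.

Let rV_setC A : g_sigma_preimage coors A -> g_sigma_preimage coors (~` A).
Proof. exact: sigma_algebraC. Qed.

Let rV_bigcup (F : (set 'rV[R]_n)^nat) :
  (forall i, g_sigma_preimage coors (F i)) ->
  g_sigma_preimage coors (\bigcup_i (F i)).
Proof. exact: sigma_algebra_bigcup. Qed.

HB.instance Definition _ := @isMeasurable.Build default_measure_display
  'rV[R]_n (g_sigma_preimage coors) rV_set0 rV_setC rV_bigcup.

Lemma measurable_coor (i : 'I_n) :
  measurable_fun setT (fun x : 'rV[R]_n => x 0 i : measurableTypeR R).
Proof.
move=> _ Y mY; rewrite setTI; apply: sub_sigma_algebra => /=.
rewrite -bigcup_seq/=; exists i => /=; first by rewrite mem_index_enum.
by exists Y => //; rewrite setTI.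
Qed.

Lemma measurable_fun_rVP d (T : measurableType d) (f : T -> 'rV[R]_n) :
  (forall i, measurable_fun setT (fun x => f x 0 i : measurableTypeR R)) ->
  measurable_fun setT f.
Proof.
move=> mf.
suff : g_sigma_preimage (fun i => coors i \o f) `<=` measurable.
  by rewrite g_sigma_preimage_comp => h _ A mA; apply: h; exists A.
apply: smallest_sub; first exact: sigma_algebra_measurable.
rewrite -bigcup_seq => A [i _] [B mB <-].
exact: mf.
Qed.

End measurable_rV.

(* Lebesgue measure on R^n, as the iterated product of the one-dimensional
   Lebesgue measure, transported along R * R^n ~ R^n.+1. *)
Section lebesgue_rV.
Context {R : realType}.

Definition cons_rV n (p : measurableTypeR R * 'rV[R]_n) : 'rV[R]_n.+1 :=
  \row_i (if unlift ord0 i is Some j then p.2 0 j else p.1).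

Definition behead_rV n (x : 'rV[R]_n.+1) : 'rV[R]_n := \row_j x 0 (lift ord0 j).

Lemma cons_rV_head n p : @cons_rV n p 0 ord0 = p.1.
Proof. by rewrite mxE unlift_none. Qed.

Lemma cons_rV_tail n p j : @cons_rV n p 0 (lift ord0 j) = p.2 0 j.
Proof. by rewrite mxE liftK. Qed.

Lemma measurable_cons_rV n : measurable_fun setT (@cons_rV n).
Proof.
apply: measurable_fun_rVP => i; case: (unliftP ord0 i) => [j ->|->].
  under eq_fun do rewrite cons_rV_tail.
  exact: (measurableT_comp (measurable_coor j)).
under eq_fun do rewrite cons_rV_head.
exact: measurable_fst.
Qed.

Lemma measurable_uncons_rV n :
  measurable_fun setT
    (fun x : 'rV[R]_n.+1 => (x 0 ord0 : measurableTypeR R, behead_rV x)).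
Proof.
apply: measurable_fun_pair; first exact: measurable_coor.
apply: measurable_fun_rVP => j.
by under eq_fun do rewrite mxE; exact: measurable_coor.
Qed.

Section succ.
Context (n : nat) (mu : {sigma_finite_measure set 'rV[R]_n -> \bar R}).

Definition lebesgue_rV_succ : set 'rV[R]_n.+1 -> \bar R :=
  pushforward (lebesgue_measure \x mu)%E (@cons_rV n).

Let mcons := @measurable_cons_rV n.

Let succ0 : lebesgue_rV_succ set0 = 0%E. Proof. exact: measure0. Qed.

Let succ_ge0 A : (0 <= lebesgue_rV_succ A)%E. Proof. exact: measure_ge0. Qed.

Let succ_sigma_additive : semi_sigma_additive lebesgue_rV_succ.
Proof. exact: measure_semi_sigma_additive. Qed.

HB.instance Definition _ := isMeasure.Build _ _ _ lebesgue_rV_succ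
  succ0 succ_ge0 succ_sigma_additive.

Lemma lebesgue_rV_succ_sigma_finite : sigma_finite setT lebesgue_rV_succ.
Proof.
have /sigma_finiteP[F [FT ndF Foo]] := sigma_finiteT (@lebesgue_measure R).
have /sigma_finiteP[G [GT ndG Goo]] := sigma_finiteT mu.
pose u (x : 'rV[R]_n.+1) := (x 0 ord0 : measurableTypeR R, behead_rV x).
have uK p : u (cons_rV p) = p.
  rewrite [RHS]surjective_pairing /u cons_rV_head; congr (_, _).
  by apply/rowP => j; rewrite mxE cons_rV_tail.
exists (fun i => u @^-1` (F i `*` G i)).
  apply/seteqP; split=> // x _.
  have [i _ Fi] : (\bigcup_k F k) (x 0 ord0) by rewrite -FT.
  have [j _ Gj] : (\bigcup_k G k) (behead_rV x) by rewrite -GT.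
  exists (maxn i j) => //; split => /=.
  - by move: Fi; exact/subsetPset/ndF/leq_maxl.
  - by move: Gj; exact/subsetPset/ndG/leq_maxr.
move=> i; have [mF Fi] := Foo i; have [mG Gi] := Goo i.
have mFG : measurable (F i `*` G i) by exact: measurableX.
split; first by rewrite -[X in measurable X]setTI; exact: measurable_uncons_rV.
rewrite /lebesgue_rV_succ /pushforward (_ : _ @^-1` _ = F i `*` G i).
  by rewrite product_measure1E// lte_mul_pinfty// ge0_fin_numE.
by rewrite -comp_preimage (_ : u \o _ = id)//; exact/funext.
Qed.

HB.instance Definition _ := Measure_isSigmaFinite.Build _ _ _
  lebesgue_rV_succ lebesgue_rV_succ_sigma_finite.

End succ.

Fixpoint lebesgue_rV (n : nat) :
    {sigma_finite_measure set 'rV[R]_n -> \bar R} :=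
  match n with
  | 0 => @dirac _ 'rV[R]_0 0 R
  | n.+1 => lebesgue_rV_succ (lebesgue_rV n)
  end.

End lebesgue_rV.

Section complex_functions.
Context {R : realType} {d : nat}.
Local Notation E := 'rV[R]_d.
Local Notation C := R[i].
Local Notation mu := (@lebesgue_rV R d).
Implicit Types (f g h : E -> C) (L x y xi : E) (k : 'I_d).

(* [normc] is the modulus as an element of R; `|z| on R[i] lives in R[i]. *)
Definition cmeasurable f :=
  measurable_fun setT (fun x => complex.Re (f x)) /\
  measurable_fun setT (fun x => complex.Im (f x)).

Definition cintegral f : C :=
  Complex (Rintegral mu setT (fun x => complex.Re (f x)))
          (Rintegral mu setT (fun x => complex.Im (f x))).

Definition L1 f :=
  cmeasurable f /\ (\int[mu]_x (Normc.normc (f x))%:E < +oo)%E.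

(* The squared L_2 norm, possibly infinite. *)
Definition sqnormL2 f : \bar R := (\int[mu]_x (Normc.normc (f x) ^+ 2)%:E)%E.

Definition L2 f := cmeasurable f /\ (sqnormL2 f < +oo)%E.

Definition normL2 f : R := Num.sqrt (fine (sqnormL2 f)).

Definition innerL2 f g : C := cintegral (fun x => f x * (g x)^*%C).

Definition dotE x y : R := \sum_(k < d) x 0 k * y 0 k.

(* The library norm of 'rV[R]_d is the sup norm. *)
Definition normE x : R := Num.sqrt (dotE x x).

Definition fourierL1 f xi : C :=
  cintegral (fun x => f x * Complex (cos (- (2 * pi * dotE x xi)))
                                    (sin (- (2 * pi * dotE x xi)))).

(* [g] is (a representative of) the L_2 Fourier transform of [f]: the value at
   [f] of the extension by continuity of [fourierL1] from L_1 /\ L_2 to L_2. *)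
Definition is_fourierL2 f g :=
  L2 g /\
  forall h_ : nat -> E -> C,
    (forall n, L1 (h_ n) /\ L2 (h_ n)) ->
    sqnormL2 (h_ n \- f) @[n --> \oo] --> 0%E ->
    sqnormL2 (fourierL1 (h_ n) \- g) @[n --> \oo] --> 0%E.

Definition basis_vec k : E := delta_mx 0 k.

Fixpoint Ck (n : nat) (phi : E -> R) : Prop :=
  continuous phi /\
  if n is m.+1 then
    forall k, (forall x, derivable phi x (basis_vec k)) /\
              Ck m (fun x => 'D_(basis_vec k) phi x)
  else True.

Definition test_function (phi : E -> R) :=
  (forall n, Ck n phi) /\ compact (closure [set x | phi x != 0]).

(* With real-valued test functions; the identity extends to complex-valued ones
   by linearity. *)
Definition is_weak_partial k f g :=
  forall phi, test_function phi ->
    cintegral (fun x => f x * ('D_(basis_vec k) phi x)%:C%C) =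
    - cintegral (fun x => g x * (phi x)%:C%C).

(* The weak partial derivative in L_2, arbitrary if there is none. *)
Definition weak_partial k f : E -> C :=
  xget (fun=> 0) [set g | L2 g /\ is_weak_partial k f g].

Definition H1 f := L2 f /\ forall k, exists g, L2 g /\ is_weak_partial k f g.

Definition domA f :=
  L2 f /\ (\int[mu]_x (normE x ^+ 2 * Normc.normc (f x) ^+ 2)%:E < +oo)%E.

Definition domB := H1.

Definition opA L f : E -> C := fun x => (2 * pi * dotE L x)%:C%C * f x.

Definition dir_deriv L f : E -> C :=
  fun x => \sum_(k < d) (L 0 k)%:C%C * weak_partial k f x.

Definition opB L f : E -> C :=
  fun x => Complex 0 (2 * pi)^-1 * dir_deriv L f x.

Definition Delta (T : (E -> C) -> (E -> C)) f : R :=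
  normL2 (T f) ^+ 2 - Normc.normc (innerL2 (T f) f) ^+ 2 / normL2 f ^+ 2.

Definition UP L f : R :=
  Delta (opA L) f * Delta (opB L) f / (normE L ^+ 4 * normL2 f ^+ 4).

Definition reflect_coord k x : E :=
  \row_j (if j == k then - x 0 j else x 0 j).

Definition modulus_even f k :=
  {ae mu, forall x, Normc.normc (f x) = Normc.normc (f (reflect_coord k x))}.

Definition moment2 f k : R :=
  Rintegral mu setT (fun x => x 0 k ^+ 2 * Normc.normc (f x) ^+ 2).

End complex_functions.

Section principal_submatrices.
Context {R : realType} {d : nat}.

(* A with the rows and columns in [J] removed; [enum_val] lists the remaining
   indices in increasing order. *)
Definition remove_rc (A : 'M[R]_d) (J : {set 'I_d}) : 'M[R]_#|~: J| :=
  mxsub enum_val enum_val A.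

Definition invE n (B : 'M[R]_n) : 'cV[R]_n := invmx B *m const_mx 1.

Definition norm_l1 n (v : 'cV[R]_n) : R := \sum_i `|v i 0|.

Definition admissible (A : 'M[R]_d) (J : {set 'I_d}) :=
  [/\ (#|J| < d)%N, \det (remove_rc A J) != 0 &
      forall i, 0 <= invE (remove_rc A J) i 0].

Definition candidates (A : 'M[R]_d) : set 'rV[R]_d :=
  [set L | normE L = 1 /\
    exists J : {set 'I_d},
      [/\ admissible A J,
          forall j, j \in J -> L 0 j ^+ 2 = 0 &
          forall i : 'I_#|~: J|, L 0 (enum_val i) ^+ 2 =
            invE (remove_rc A J) i 0 / norm_l1 (invE (remove_rc A J))]].

End principal_submatrices.

Definition is_min {R : realType} (S : set R) (m : R) := S m /\ lbound S m.
Definition is_max {R : realType} (S : set R) (m : R) := S m /\ ubound S m.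

(* Main.v *)
Require Import Defs.
From mathcomp Require Import all_boot all_order all_algebra.
From mathcomp Require Import all_classical all_reals all_analysis.
From mathcomp Require Import complex ring lra measurable_realfun.

Set Implicit Arguments.
Unset Strict Implicit.
Unset Printing Implicit Defensive.

Import Order.TTheory GRing.Theory Num.Theory.
Import numFieldNormedType.Exports.

Local Open Scope classical_set_scope.
Local Open Scope ring_scope.

(** Why the theorem holds. With |L| = 1 the uncertainty product equals
    (sum_k L_k^2 M_k) * (sum_k L_k^2 Mhat_k), where all M_k and Mhat_k are
    positive; in the variables v_k = L_k^2 one has to optimise a product of two
    positive linear forms over the standard simplex. [UP_moments] gives the
    formula, [product_form_min] and [product_form_max] solve the optimisation.

    The formula. The density |f|^2 is invariant under the reflections of the
    coordinates, so that its first moments and mixed second moments vanish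
    ([Rintegral_dot], [Rintegral_dot2]); this gives the position factor. For the
    momentum factor the same facts are used for |fhat|^2, together with
    Plancherel's identity for the operators f |-> df/dL + z f, whose Fourier
    symbol is 2 pi i <L, xi> + z ([plancherel_H1]): z = 0 gives the norm of
    df/dL, and comparing z = 0 with z = 1 and z = i gives, by polarisation,
    <df/dL, f> = 0. To prove [plancherel_H1], the weak derivative of f is tested
    against a smooth cutoff chi_n times a plane wave. The transform of
    chi_n (df/dL + z f) + f (d chi_n/dL) is then exactly the symbol times the
    transform of chi_n f, and n goes to infinity by means of Plancherel's identity
    on L_1 /\ L_2 ([plancherel_fourier], [fourier_multiplier]). Plancherel's identity is proved on the line with the
    Poisson kernel and the continuity of translations in L_2
    ([plancherel1_real]), and carried to R^d by Fubini ([plancherel_prod]).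

    The optimisation. At a vertex e_j of the simplex the product is M_j Mhat_j,
    and by the inequality of arithmetic and geometric means the smallest of these
    values is the minimum over the whole simplex. For the maximum, a point with
    at least three nonzero coordinates can be moved, keeping the first form fixed
    and not decreasing the second, until a coordinate vanishes
    ([product_form_reduce]); hence the maximum is attained on an edge. On an edge
    the product is a quadratic polynomial, whose maximum is at an end or at its
    critical point ([edge_max]). A vertex and an interior critical point v of an
    edge both satisfy A_K v_K = lambda (1, ..., 1) with A_K invertible, K being
    the support of v, which is what membership in [candidates] asks for
    ([candidate_critical]). *)

(** * Lebesgue measure under affine maps *)

Section affine.
Context {R : realType}.
Local Notation mu := (@lebesgue_measure R).
Local Notation RT := (measurableTypeR R).

Lemma measurable_affine (r y : R) :
  measurable_fun setT (fun x : RT => r * x + y : RT).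
Proof.
apply: continuous_measurable_fun => x.
by apply: cvgD; [apply: cvgMl_tmp; exact: cvg_id | exact: cvg_cst].
Qed.

(** The left-hand side is a measure in [A] which agrees with Lebesgue measure on
    half-open intervals. *)
Lemma lebesgue_affine (r y : R) (A : set RT) : 0 < r -> measurable A ->
  (mu ((fun x : RT => (r * x + y)%R : RT) @^-1` A) * r%:E = mu A)%E.
Proof.
move=> r0 mA.
pose r' : {nonneg R} := NngNum (ltW r0).
pose phi := fun x : RT => r * x + y : RT.
have mphi : measurable_fun setT phi by exact: measurable_affine.
pose nu : {measure set RT -> \bar R} := pushforward mu phi.
pose nu' : {measure set RT -> \bar R} := mscale r' (nu mphi).
have := @lebesgue_measure_unique R nu'.
rewrite muleC => h; apply/esym; apply: (h) => // {h}.
move=> _ [[a b] _ <-]; rewrite /=.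
have -> : nu' `]a, b]%classic = (r%:E * mu (phi @^-1` `]a, b]%classic))%E by [].
rewrite [phi @^-1` _](_ : _ = `]((a - y) / r), ((b - y) / r)]%classic); last first.
  apply/seteqP; split => x /=; rewrite /phi !in_itv/=.
    by rewrite ltr_pdivrMr// ler_pdivlMr// ltrBlDr lerBrDr mulrC.
  by rewrite ltr_pdivrMr// ler_pdivlMr// ltrBlDr lerBrDr mulrC.
rewrite !lebesgue_measure_itv/= !lte_fin ltr_pM2r ?invr_gt0// ltrD2r.
case: ifPn => ab; last by rewrite mule0.
by rewrite -!EFinB -EFinM; congr EFin; field; rewrite gt_eqF.
Qed.

Lemma measurable_opp : measurable_fun setT (fun x : RT => - x : RT).
Proof. by apply: continuous_measurable_fun => x; apply: cvgN; exact: cvg_id. Qed.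

Lemma lebesgue_opp (A : set RT) : measurable A ->
  mu ((fun x : RT => - x : RT) @^-1` A) = mu A.
Proof.
move=> mA.
have mphi := measurable_opp.
pose nu : {measure set RT -> \bar R} := pushforward mu (fun x : RT => - x : RT).
apply/esym; apply: (@lebesgue_measure_unique R (nu mphi)) => //.
move=> _ [[a b] _ <-]; rewrite /nu/= /pushforward/=.
rewrite [_ @^-1` _](_ : _ = `[(- b), (- a)[%classic); last first.
  by apply/seteqP; split => x /=; rewrite !in_itv/= lerNl ltrNr andbC.
rewrite !lebesgue_measure_itv/= !lte_fin ltrN2.
by case: ifPn => // ab; rewrite -!EFinB opprK addrC.
Qed.

Lemma ge0_integral_affine (r y : R) (f : RT -> \bar R) : 0 < r ->
  measurable_fun setT f -> (forall x, 0 <= f x)%E ->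
  (\int[mu]_x f (r * x + y)%R * r%:E = \int[mu]_x f x)%E.
Proof.
move=> r0 mf f0.
pose r' : {nonneg R} := NngNum (ltW r0).
pose phi := fun x : RT => (r * x + y)%R : RT.
have mphi : measurable_fun setT phi by exact: measurable_affine.
pose nu : {measure set RT -> \bar R} := pushforward mu phi.
rewrite [RHS](eq_measure_integral (mscale r' (nu mphi))).
  rewrite ge0_integral_mscale// muleC; congr (_ * _)%E.
  rewrite ge0_integral_pushforward//.
by move=> A mA _; rewrite /= /mscale/= muleC -(lebesgue_affine y r0 mA).
Qed.

Lemma ge0_integral_opp (f : RT -> \bar R) :
  measurable_fun setT f -> (forall x, 0 <= f x)%E ->
  (\int[mu]_x f (- x)%R = \int[mu]_x f x)%E.
Proof.
move=> mf f0.
have mphi := measurable_opp.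
pose nu : {measure set RT -> \bar R} := pushforward mu (fun x : RT => - x : RT).
rewrite [RHS](eq_measure_integral (nu mphi)).
  rewrite ge0_integral_pushforward//.
by move=> A mA _; rewrite /= /nu /pushforward (lebesgue_opp mA).
Qed.

End affine.

(** * Real-valued integrals *)

Section real_integrals.
Context {R : realType} d (T : measurableType d) (m : {measure set T -> \bar R}).
Implicit Types f g : T -> R.
Local Notation int f := (m.-integrable setT (EFin \o f)).

Lemma EFin_Rintegral f : int f ->
  (Rintegral m setT f)%:E = (\int[m]_x (f x)%:E)%E.
Proof. by move=> fi; rewrite /Rintegral fineK// integrable_fin_num. Qed.

Lemma int_measurable f : int f -> measurable_fun setT f.
Proof. by move=> /measurable_int /measurable_EFinP. Qed.

Lemma measurable_sqr f : measurable_fun setT f ->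
  measurable_fun setT (fun x => (f x ^+ 2)%:E).
Proof. by move=> mf; apply/measurable_EFinP; exact: measurable_funX. Qed.

Lemma measurable_sqrD f g : measurable_fun setT f -> measurable_fun setT g ->
  measurable_fun setT (fun x => (f x ^+ 2 + g x ^+ 2)%:E).
Proof.
by move=> mf mg; apply/measurable_EFinP; apply: measurable_funD; exact: measurable_funX.
Qed.

Lemma int_le f g : measurable_fun setT f -> (forall x, `|f x| <= g x) ->
  int g -> int f.
Proof.
move=> mf fg; apply: le_integrable => //; first exact/measurable_EFinP.
by move=> x _ /=; rewrite lee_fin (le_trans (fg x))// ler_norm.
Qed.

Lemma ge0_intP f : measurable_fun setT f -> (forall x, 0 <= f x) ->
  int f <-> (\int[m]_x (f x)%:E < +oo)%E.
Proof.
move=> mf f0; split.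
  move=> /integrableP[_]; rewrite (eq_integral (EFin \o f))// => x _ /=.
  by rewrite ger0_norm.
move=> foo; apply/integrableP; split; first exact/measurable_EFinP.
by rewrite (eq_integral (EFin \o f))// => x _ /=; rewrite ger0_norm.
Qed.

Lemma intD f g : int f -> int g -> int (fun x => f x + g x).
Proof. by move=> fi gi; exact: (@integrableD _ _ _ m _ measurableT (EFin \o f) (EFin \o g)). Qed.

Lemma intB f g : int f -> int g -> int (fun x => f x - g x).
Proof. by move=> fi gi; exact: (@integrableB _ _ _ m _ measurableT (EFin \o f) (EFin \o g)). Qed.

Lemma intZ (r : R) f : int f -> int (fun x => r * f x).
Proof. by move=> fi; exact: (@integrableZl _ _ _ m _ measurableT r (EFin \o f)). Qed.

Lemma int_abs f : int f -> int (fun x => `|f x|).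
Proof.
by move=> fi; exact: (@integrable_abse _ _ _ m _ (EFin \o f)).
Qed.

Lemma int_mulb f (c : T -> R) (M : R) : int f -> measurable_fun setT c ->
  (forall x, `|c x| <= M) -> int (fun x => f x * c x).
Proof.
move=> fi mc cM; apply: (@int_le _ (fun x => M * `|f x|)).
- by apply: measurable_funM => //; exact: int_measurable.
- by move=> x; rewrite normrM mulrC ler_wpM2r.
- exact/intZ/int_abs.
Qed.

(** If [f] is not integrable then the right-hand side is infinite. *)
Lemma Rintegral_le_abs f : measurable_fun setT f ->
  (`|Rintegral m setT f|%:E <= \int[m]_x `|f x|%:E)%E.
Proof.
move=> mf.
have [fi|nfi] := pselect (int f).
  apply: (@le_trans _ _ (Rintegral m setT (fun x => `|f x|))%:E).
    by rewrite lee_fin; exact: le_normr_Rintegral.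
  by rewrite EFin_Rintegral//; exact: int_abs.
rewrite (_ : (\int[m]_x _)%E = +oo%E) ?leey//.
apply/eqP; rewrite -leye_eq leNgt; apply/negP => foo; apply: nfi.
by apply/integrableP; split; [exact/measurable_EFinP|].
Qed.

Lemma le_Rintegral_abs f g : measurable_fun setT f -> int g ->
  (forall x, `|f x| <= g x) -> `|Rintegral m setT f| <= Rintegral m setT g.
Proof.
move=> mf gi fg; have fi : int f by exact: int_le gi.
apply: le_trans (le_normr_Rintegral _ fi) _ => //.
by apply: le_Rintegral => //; exact: int_abs.
Qed.

End real_integrals.

Section product_integrals.
Context {R : realType} d1 d2 (T1 : measurableType d1) (T2 : measurableType d2).
Context (m1 : {sigma_finite_measure set T1 -> \bar R})
        (m2 : {sigma_finite_measure set T2 -> \bar R}).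

Lemma measurable_section1 d3 (T3 : measurableType d3) (F : T1 * T2 -> T3) x :
  measurable_fun setT F -> measurable_fun setT (fun y => F (x, y)).
Proof. by move=> mF; apply: measurableT_comp mF _; exact: measurable_pair1. Qed.

Lemma measurable_section2 d3 (T3 : measurableType d3) (F : T1 * T2 -> T3) y :
  measurable_fun setT F -> measurable_fun setT (fun x => F (x, y)).
Proof. by move=> mF; apply: measurableT_comp mF _; exact: measurable_pair2. Qed.

Lemma measurable_Rintegral (F : T1 * T2 -> R) : measurable_fun setT F ->
  measurable_fun setT (fun x => Rintegral m2 setT (fun y => F (x, y))).
Proof.
move=> mF; have mE : measurable_fun setT (EFin \o F) by exact/measurable_EFinP.
apply: measurableT_comp => //.
rewrite (_ : (fun _ => _) = (fun x => \int[m2]_y (EFin \o F)^\+ (x, y))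
    \- (fun x => \int[m2]_y (EFin \o F)^\- (x, y)))%E.
  apply: emeasurable_funB.
    apply: (@measurable_fun_fubini_tonelli_F _ _ _ _ _ m2 ((EFin \o F)^\+%E)) => //.
    exact: measurable_funepos.
  apply: (@measurable_fun_fubini_tonelli_F _ _ _ _ _ m2 ((EFin \o F)^\-%E)) => //.
  exact: measurable_funeneg.
apply/funext => x /=; rewrite integralE.
by congr (adde _ (oppe _)); apply: eq_integral => y _;
  rewrite ?funeposE ?funenegE.
Qed.

Lemma integrable_prod_le (F : T1 * T2 -> R) (g : T1 -> R) (h : T2 -> R) :
  measurable_fun setT F -> (forall x y, `|F (x, y)| <= g x * h y) ->
  m1.-integrable setT (EFin \o g) -> m2.-integrable setT (EFin \o h) ->
  (m1 \x m2)%E.-integrable setT (EFin \o F).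
Proof.
move=> mF Fgh gi hi; apply/integrable12ltyP; first exact/measurable_EFinP.
have mh := int_measurable hi; have mg := int_measurable gi.
apply: (@le_lt_trans _ _ (\int[m1]_x (`|g x|%:E * \int[m2]_y `|h y|%:E))%E).
  apply: ge0_le_integral => //.
  - by move=> x _; apply: integral_ge0.
  - apply: (@measurable_fun_fubini_tonelli_F _ _ _ _ _ m2 (abse \o (EFin \o F))).
      by apply: measurableT_comp => //; exact/measurable_EFinP.
    by move=> x; exact: abse_ge0.
  - apply: emeasurable_funM => //; apply/measurable_EFinP.
    exact: measurableT_comp.
  - move=> x _; rewrite -ge0_integralZl//; last first.
      by apply/measurable_EFinP; exact: measurableT_comp.
    apply: ge0_le_integral => //=.
    + apply/measurable_EFinP; apply: measurableT_comp => //.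
      exact: measurable_section1.
    + apply: measurable_funeM; apply/measurable_EFinP; exact: measurableT_comp.
    + move=> y _; rewrite -EFinM lee_fin (le_trans (Fgh x y))// -normrM.
      exact: ler_norm.
rewrite ge0_integralZr//; last 2 first.
  by apply/measurable_EFinP; exact: measurableT_comp.
  exact: integral_ge0.
move/integrableP : gi => [_ goo]; move/integrableP : hi => [_ hoo].
by rewrite lte_mul_pinfty ?integral_ge0// ge0_fin_numE ?integral_ge0.
Qed.

(** [Rintegral] reads an infinite or undefined inner integral as a number; by
    Fubini's theorem this concerns only a null set of outer variables. *)
Lemma Fubini_Rintegral (F : T1 * T2 -> R) :
  (m1 \x m2)%E.-integrable setT (EFin \o F) ->
  Rintegral m1 setT (fun x => Rintegral m2 setT (fun y => F (x, y))) =
  Rintegral m2 setT (fun y => Rintegral m1 setT (fun x => F (x, y))).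
Proof.
move=> Fi; have mF := int_measurable Fi.
rewrite /Rintegral; congr fine.
have E1 : (\int[m1]_x \int[m2]_y (EFin \o F) (x, y) =
    \int[m1]_x (fine (\int[m2]_y (EFin \o F) (x, y)))%:E)%E.
  apply: ae_eq_integral => //.
  - exact: (measurable_fubini_F Fi).
  - by apply/measurable_EFinP; exact: (@measurable_Rintegral F).
  - have := ae_integrable1 Fi; apply: filterS => x xi _.
    by rewrite fineK// integrable_fin_num.
have E2 : (\int[m2]_y \int[m1]_x (EFin \o F) (x, y) =
    \int[m2]_y (fine (\int[m1]_x (EFin \o F) (x, y)))%:E)%E.
  apply: ae_eq_integral => //.
  - exact: (measurable_fubini_G Fi).
  - apply: measurableT_comp => //; apply: measurableT_comp => //.
    exact: (measurable_fubini_G Fi).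
  - have := ae_integrable2 Fi; apply: filterS => x xi _.
    by rewrite fineK// integrable_fin_num.
by rewrite -E1 -E2; exact: Fubini.
Qed.

Lemma integrable_Rintegral (F : T1 * T2 -> R) :
  (m1 \x m2)%E.-integrable setT (EFin \o F) ->
  m1.-integrable setT
    (EFin \o (fun x => Rintegral m2 setT (fun y => F (x, y)))).
Proof.
move=> Fi; have mF := int_measurable Fi.
apply/integrableP; split.
  by apply/measurable_EFinP; exact: (@measurable_Rintegral F).
have mE : measurable_fun setT (EFin \o F) by exact/measurable_EFinP.
have := (integrable12ltyP m1 m2 mE).1 Fi.
apply: le_lt_trans.
apply: ge0_le_integral => //=.
- by apply/measurable_EFinP; apply: measurableT_comp => //; exact: (@measurable_Rintegral F).
- apply: (@measurable_fun_fubini_tonelli_F _ _ _ _ _ m2 (abse \o (EFin \o F))).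
    by apply: measurableT_comp => //; exact/measurable_EFinP.
  by move=> x; exact: abse_ge0.
- by move=> x _; exact/Rintegral_le_abs/measurable_section1.
Qed.

End product_integrals.

(** * The Fourier transform of the two-sided exponential *)

Section poisson.
Context {R : realType}.
Local Notation mu := (@lebesgue_measure R).
Local Notation RT := (measurableTypeR R).

Let dexp (e x : R) :
  is_derive x 1 (fun x : R => expR (- (e * x))) (- e * expR (- (e * x))).
Proof.
have -> : - e * expR (- (e * x)) = expR (- (e * x)) * - e by rewrite mulrC.
apply: (@is_derive1_comp _ expR (fun x => - (e * x))).
apply: is_derive_eq.
by rewrite /GRing.scale/= mulr1.
Qed.

Let dcos (c x : R) :
  is_derive x 1 (fun x : R => cos (c * x)) (- (c * sin (c * x))).
Proof.
have -> : - (c * sin (c * x)) = - sin (c * x) * c by ring.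
apply: (@is_derive1_comp _ cos (fun x => c * x)).
apply: is_derive_eq.
by rewrite /GRing.scale/= mulr1.
Qed.

Let dsin (c x : R) : is_derive x 1 (fun x : R => sin (c * x)) (c * cos (c * x)).
Proof.
have -> : c * cos (c * x) = cos (c * x) * c by ring.
apply: (@is_derive1_comp _ sin (fun x => c * x)).
apply: is_derive_eq.
by rewrite /GRing.scale/= mulr1.
Qed.

Let cexp (e : R) : continuous (fun x : R => expR (- (e * x))).
Proof.
move=> x; apply: differentiable_continuous; apply/derivable1_diffP.
exact: (@ex_derive _ _ _ _ _ _ _ (dexp e x)).
Qed.

Let ccos (c : R) : continuous (fun x : R => cos (c * x)).
Proof.
move=> x; apply: differentiable_continuous; apply/derivable1_diffP.
exact: (@ex_derive _ _ _ _ _ _ _ (dcos c x)).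
Qed.

(** Adding 1 to the cosine makes the integrand nonnegative, so that the
    fundamental theorem of calculus for nonnegative functions on a half-line
    applies; the case c = 0 is subtracted later. *)
Lemma integral0y_exp_cos (e c : R) : 0 < e ->
  (\int[mu]_(x in `[0%R, +oo[) (expR (- (e * x)) * (1 + cos (c * x)))%:E
   = (e^-1 + e / (e ^+ 2 + c ^+ 2))%:E)%E.
Proof.
move=> e0.
have d0 : e ^+ 2 + c ^+ 2 != 0 by rewrite gt_eqF// ltr_wpDr ?sqr_ge0// exprn_gt0.
pose F (x : R) := expR (- (e * x)) *
  (- e^-1 + (e ^+ 2 + c ^+ 2)^-1 * (c * sin (c * x) - e * cos (c * x))).
have dF (x : R) : is_derive x 1 F (expR (- (e * x)) * (1 + cos (c * x))).
  have := dexp e x; have := dcos c x; have := dsin c x => h1 h2 h3.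
  apply: is_derive_eq; rewrite /GRing.scale/=; field.
  by rewrite d0 gt_eqF.
have cF : continuous F.
  move=> x; apply: differentiable_continuous; apply/derivable1_diffP.
  exact: (@ex_derive _ _ _ _ _ _ _ (dF x)).
pose K := e^-1 + (e ^+ 2 + c ^+ 2)^-1 * (`|c| + e).
have FK x : `|F x| <= K * expR (- (e * x)).
  rewrite /F normrM (ger0_norm (expR_ge0 _)) mulrC ler_wpM2r ?expR_ge0//.
  rewrite (le_trans (ler_normD _ _))// lerD//.
    by rewrite normrN ger0_norm// invr_ge0 ltW.
  rewrite normrM ger0_norm ?invr_ge0 ?addr_ge0 ?sqr_ge0// ler_wpM2l//.
    by rewrite invr_ge0 ?addr_ge0 ?sqr_ge0.
  rewrite (le_trans (ler_normB _ _))// lerD//.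
    by rewrite normrM ler_piMr// ler_norml sin_geN1 sin_le1.
  by rewrite normrM (gtr0_norm e0) ler_piMr ?(ltW e0)// ler_norml cos_geN1 cos_le1.
have Ey : K * expR (- (e * x)) @[x --> +oo%R] --> (0 : R).
  rewrite -[X in _ --> X](mulr0 K); apply: cvgMr.
  have : e * x @[x --> +oo%R] --> +oo%R.
    apply/cvgryPge => A; near=> x.
    by rewrite mulrC -ler_pdivrMr//; near: x; exact: nbhs_pinfty_ge.
  by move=> /(cvg_comp _ _) /(_ (@cvgr_expR R)).
have Fy : F x @[x --> +oo%R] --> (0 : R).
  apply: (@squeeze_cvgr _ _ _ _ (fun x => - (K * expR (- (e * x))))
     (fun x => K * expR (- (e * x)))) => //.
    by near=> x; rewrite -ler_norml.
  by rewrite -[X in _ --> X]oppr0; exact: cvgN.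
rewrite (@ge0_continuous_FTC2y _ _ F 0 0) //.
- by rewrite /F mulr0 oppr0 expR0 mulr0 sin0 cos0 -EFinB; congr EFin; ring.
- apply: continuous_subspaceT => x; apply: cvgM.
    exact: cexp.
  by apply: cvgD; [exact: cvg_cst | exact: ccos].
- by apply: cvg_at_right_filter; exact: cF.
- by move=> x _; rewrite derive1E; exact: (@derive_val _ _ _ _ _ _ _ (dF x)).
Unshelve. all: by end_near. Qed.

Lemma integral_exp_cos (e c : R) : 0 < e ->
  (\int[mu]_x (expR (- (e * `|x|)) * (1 + cos (c * x)))%:E
   = (2 * (e^-1 + e / (e ^+ 2 + c ^+ 2)))%:E)%E.
Proof.
move=> e0; rewrite ge0_symfun_integralT.
- rewrite -set_itvcy EFinM -(integral0y_exp_cos c e0); congr (_ * _)%E.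
  apply: eq_integral => x; rewrite inE/= in_itv/= andbT => x0.
  by rewrite ger0_norm.
- by move=> x; rewrite mulr_ge0 ?expR_ge0// addrC -lerBlDr sub0r cos_geN1.
- move=> x; apply: cvgM.
    apply: (@continuous_comp _ _ _ (fun x => - (e * `|x|)) expR).
      by apply: cvgN; apply: cvgMl_tmp; exact: norm_continuous.
    exact: continuous_expR.
  by apply: cvgD; [exact: cvg_cst | exact: ccos].
- by move=> x /=; rewrite normrN mulrN cosN.
Qed.

Lemma measurable_exp_abs (e : R) :
  measurable_fun setT (fun x : RT => expR (- (e * `|x|))).
Proof.
apply: continuous_measurable_fun => x.
apply: (@continuous_comp _ _ _ (fun x => - (e * `|x|)) expR).
  by apply: cvgN; apply: cvgMl_tmp; exact: norm_continuous.
exact: continuous_expR.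
Qed.

Lemma measurable_cosM (c : R) : measurable_fun setT (fun x : RT => cos (c * x)).
Proof.
apply: continuous_measurable_fun; exact: ccos.
Qed.

Lemma integral_exp_abs (e : R) : 0 < e ->
  (\int[mu]_x (expR (- (e * `|x|)))%:E = (2 / e)%:E)%E.
Proof.
move=> e0; have := integral_exp_cos 0 e0.
under eq_integral do rewrite mul0r cos0 mulrC EFinM.
rewrite ge0_integralZl//; last first.
  by apply/measurable_EFinP; exact: measurable_exp_abs.
have -> : 2 * (e^-1 + e / (e ^+ 2 + 0 ^+ 2)) = (1 + 1) * (2 / e).
  by field; rewrite gt_eqF//= expr0n/= addr0 expf_neq0// gt_eqF.
rewrite EFinM => h.
have h2 : ((1 + 1 : R)%:E \is a fin_num) && ((1 + 1 : R)%:E != 0)%E.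
  by rewrite /= -[X in _ != X]/(0%:E) eqe gt_eqF.
have := congr1 (fun z => ((1 + 1)^-1%R%:E * z)%E) h.
by rewrite !muleA -EFinM mulVf ?gt_eqF// !mul1e.
Qed.

Lemma integrable_exp_abs (e : R) : 0 < e ->
  mu.-integrable setT (EFin \o (fun x : RT => expR (- (e * `|x|)))).
Proof.
move=> e0; apply/ge0_intP.
- exact: measurable_exp_abs.
- by move=> x; exact: expR_ge0.
- by rewrite integral_exp_abs// ltry.
Qed.

Lemma Rintegral_exp_cos (e c : R) : 0 < e ->
  Rintegral mu setT (fun x => expR (- (e * `|x|)) * cos (c * x)) =
  2 * e / (e ^+ 2 + c ^+ 2).
Proof.
move=> e0.
have cb (x : R) : `|cos (c * x)| <= 1 by rewrite ler_norml cos_geN1 cos_le1.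
have i1 := integrable_exp_abs e0.
have i2 := int_mulb i1 (measurable_cosM c) cb.
have := RintegralD measurableT i1 i2.
have -> : Rintegral mu setT (fun x => expR (- (e * `|x|))) = 2 / e.
  by rewrite /Rintegral integral_exp_abs.
have -> : Rintegral mu setT
   (fun x => expR (- (e * `|x|)) + expR (- (e * `|x|)) * cos (c * x)) =
   2 * (e^-1 + e / (e ^+ 2 + c ^+ 2)).
  rewrite /Rintegral -[RHS]/(fine (_%:E)) -integral_exp_cos//; congr fine.
  by apply: eq_integral => x _; rewrite mulrDr mulr1.
move=> h; have -> : 2 * e / (e ^+ 2 + c ^+ 2) =
  2 * (e^-1 + e / (e ^+ 2 + c ^+ 2)) - 2 / e by ring.
by rewrite h addrC addKr.
Qed.

(** Without the normalising factor 1 / pi. *)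
Definition cauchy_density (u : R) := (1 + u ^+ 2)^-1.

Lemma continuous_cauchy : continuous cauchy_density.
Proof. exact: continuous_oneDsqrV. Qed.

Lemma cauchy_ge0 u : 0 <= cauchy_density u.
Proof. by rewrite invr_ge0 addr_ge0// sqr_ge0. Qed.

Lemma measurable_cauchy : measurable_fun setT (cauchy_density : RT -> RT).
Proof. by apply: continuous_measurable_fun; exact: continuous_cauchy. Qed.

Lemma integral_cauchy : (\int[mu]_u (cauchy_density u)%:E = pi%:E)%E.
Proof.
rewrite ge0_symfun_integralT.
- rewrite -set_itvcy integral0y_oneDsqr -EFinM; congr EFin; field.
- by [].
- exact: cauchy_ge0.
- exact: continuous_cauchy.
- by move=> u /=; rewrite /cauchy_density sqrrN.
Qed.

End poisson.

(** * Continuity of translations in L_2 *)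

Section ereal_cvg0.
Context {R : realType}.

Lemma cvge0_le (u : nat -> \bar R) : (forall n, (0 <= u n)%E) ->
  u n @[n --> \oo] --> 0%E <->
  (forall e : R, 0 < e -> \forall n \near \oo, (u n <= e%:E)%E).
Proof.
move=> u0; split => [/fine_cvgP[ufin /cvgr0Pnorm_le ul] e e0|h].
  have := ul e e0 => {}ul; near=> n.
  have ufn : u n \is a fin_num by near: n.
  rewrite -(fineK ufn) lee_fin (le_trans (ler_norm _))//.
  by near: n.
apply/fine_cvgP; split.
  near=> n; rewrite ge0_fin_numE//; apply: (@le_lt_trans _ _ 1%E); last exact: ltry.
  by near: n; exact: h.
apply/cvgr0Pnorm_le => e e0; near=> n.
rewrite ger0_norm ?fine_ge0//.
have un : (u n <= e%:E)%E by near: n; exact: h.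
rewrite -lee_fin fineK// ge0_fin_numE//; exact: le_lt_trans un (ltry _).
Unshelve. all: by end_near. Qed.

End ereal_cvg0.

Section translation.
Context {R : realType}.
Local Notation mu := (@lebesgue_measure R).
Local Notation RT := (measurableTypeR R).
Implicit Types a g h : RT -> R.

Definition translation_defect (a : RT -> R) (z : R) : \bar R :=
  (\int[mu]_y ((a (y + z)%R - a y) ^+ 2)%:E)%E.

Lemma translation_defect_ge0 a z : (0 <= translation_defect a z)%E.
Proof. by apply: integral_ge0 => y _; rewrite lee_fin sqr_ge0. Qed.

Lemma measurable_translate a z : measurable_fun setT a ->
  measurable_fun setT (fun y : RT => a (y + z)).
Proof.
move=> ma; apply: measurableT_comp => //.
rewrite [X in measurable_fun _ X](_ : _ = (fun x : RT => 1 * x + z : RT)); last first.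
  by apply/funext => x; rewrite mul1r.
exact: measurable_affine.
Qed.

Lemma ge0_integral_translate (f : RT -> \bar R) z :
  measurable_fun setT f -> (forall x, 0 <= f x)%E ->
  (\int[mu]_x f (x + z)%R = \int[mu]_x f x)%E.
Proof.
move=> mf f0; rewrite -(ge0_integral_affine z ltr01 mf f0) mule1.
by under [RHS]eq_integral do rewrite mul1r.
Qed.

Variable z_ : nat -> R.
Hypothesis z0 : z_ n @[n --> \oo] --> (0 : R).
Variable B : R.
Hypothesis zB : forall n, `|z_ n| <= B.

Definition translation_continuous a :=
  translation_defect a (z_ n) @[n --> \oo] --> 0%E.

(** Replacing [a] by [g] changes both [a] and its translate by the same amount,
    and (p + q + r)^2 <= 3 (p^2 + q^2 + r^2); hence the bound e / 9. *)
Lemma translation_continuous_close a : measurable_fun setT a ->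
  (forall e : R, 0 < e -> exists g, [/\ measurable_fun setT g,
     translation_continuous g &
     (\int[mu]_y ((a y - g y) ^+ 2)%:E <= e%:E)%E]) ->
  translation_continuous a.
Proof.
move=> ma close; apply/cvge0_le => [n|e e0]; first exact: translation_defect_ge0.
have e9 : 0 < e / 9 by rewrite divr_gt0.
have [g [mg tg ag]] := close _ e9.
move/cvge0_le : tg => /(_ (fun n => translation_defect_ge0 g (z_ n)))/(_ _ e9).
apply: filterS => n tg.
have mab : measurable_fun setT (fun y => a y - g y) by exact: measurable_funB.
have mgz := measurable_translate (z_ n) mg.
have maz := measurable_translate (z_ n) ma.
have m1 : measurable_fun setT (fun y : RT => a (y + z_ n) - g (y + z_ n)).
  exact: measurable_funB.
have m2 : measurable_fun setT (fun y : RT => g (y + z_ n) - g y).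
  exact: measurable_funB.
have ge0 (x : R) : (0 <= (x ^+ 2)%:E)%E by rewrite lee_fin sqr_ge0.
apply: (@le_trans _ _ (\int[mu]_y (3%:E * (((a (y + z_ n) - g (y + z_ n)) ^+ 2)%:E
   + ((g (y + z_ n) - g y) ^+ 2)%:E + ((a y - g y) ^+ 2)%:E)))%E).
  apply: ge0_le_integral => //.
  - by apply: measurable_sqr; exact: measurable_funB.
  - apply: measurable_funeM; apply: emeasurable_funD; last exact: measurable_sqr.
    by apply: emeasurable_funD; exact: measurable_sqr.
  - move=> y _; rewrite -!EFinD -EFinM lee_fin.
    set p := a (y + _); set q := g (y + _); set r := g y; set s := a y.
    have : 0 <= (p - q - (q - r)) ^+ 2 + (q - r - (r - s)) ^+ 2 +
       (p - q - (r - s)) ^+ 2 by rewrite !addr_ge0 ?sqr_ge0.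
    rewrite -subr_ge0; congr (_ <= _); ring.
rewrite ge0_integralZl//; last 2 first.
  apply: emeasurable_funD; last exact: measurable_sqr.
  by apply: emeasurable_funD; exact: measurable_sqr.
  by move=> y _; rewrite !adde_ge0.
rewrite ge0_integralD//; last 3 first.
- by move=> y _; rewrite adde_ge0.
- by apply: emeasurable_funD; exact: measurable_sqr.
- exact: measurable_sqr.
rewrite ge0_integralD//; [|exact: measurable_sqr|exact: measurable_sqr].
rewrite (ge0_integral_translate (f := fun y => ((a y - g y) ^+ 2)%:E))//; last exact: measurable_sqr.
have -> : e = 3 * (e / 9 + e / 9 + e / 9) by field.
rewrite EFinM lee_pmul2l//.
by rewrite !EFinD; apply: leeD => //; apply: leeD.
Qed.

(** Dominated convergence: the translates by at most [B] vanish outside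
    [-(K + B), K + B]. *)
Lemma translation_continuous_compact (g : RT -> R) (M K : R) :
  continuous (g : R -> R) ->
  (forall x, `|g x| <= M) -> (forall x, K < `|x| -> g x = 0) ->
  translation_continuous g.
Proof.
move=> cg gM gK.
have mg : measurable_fun setT g by exact: continuous_measurable_fun.
have M0 : 0 <= M by rewrite (le_trans _ (gM 0)).
rewrite /translation_continuous.
have -> : 0%E = (\int[mu]_y (cst 0%E y) : \bar R)%E by rewrite integral0.
pose E : set RT := `[(- (K + B)), (K + B)]%classic.
have mE : measurable E by exact: measurable_itv.
apply: (@dominated_cvg _ _ _ mu setT measurableT
  (fun n y => ((g (y + z_ n) - g y) ^+ 2)%:E) (cst 0%E)
  (fun y => ((2 * M) ^+ 2 * \1_E y)%:E)).
- move=> n; apply: measurable_sqr; apply: measurable_funB => //.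
  exact: measurable_translate.
- move=> y _; rewrite /cst; apply: cvg_EFin; first exact: nearW.
  rewrite (_ : _ \o _ = fun n => (g (y + z_ n) - g y) ^+ 2)//.
  have h : g (y + z_ n) - g y @[n --> \oo] --> (0 : R).
    rewrite -[X in _ --> X](subrr (g y)).
    apply: cvgB; last exact: cvg_cst.
    apply: (@cvg_comp _ _ _ (fun n => y + z_ n) g); last exact: cg.
    have : y + z_ n @[n --> \oo] --> y + 0 by apply: cvgD => //; exact: cvg_cst.
    by rewrite addr0.
  have := @cvg_comp _ _ _ _ (fun x : R => x ^+ 2) _ _ _ h (@exprn_continuous R 2 0).
  by rewrite expr0n.
- by [].
- apply: (@intZ _ _ _ _ _ (\1_E : RT -> R)).
  apply/ge0_intP => //.
  have Efin : (mu E < +oo)%E.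
    by rewrite /E lebesgue_measure_itv/=; case: ifP; rewrite ?ltry// -EFinB ltry.
  by rewrite integral_indic// setIT; exact: Efin.
- move=> n y _ /=; rewrite lee_fin ger0_norm ?sqr_ge0//.
  rewrite indicE; case: (boolP (y \in E)) => yE /=.
    rewrite mulr1 -[leLHS]ger0_norm ?sqr_ge0// normrX ler_sqr ?nnegrE ?mulr_ge0//.
    by rewrite (le_trans (ler_normB _ _))// mulr_natl mulr2n lerD.
  have Ky : K + B < `|y|.
    rewrite ltNge; apply/negP => h; move/negP: yE; apply; rewrite inE /E/= in_itv/=.
    by rewrite -ler_norml.
  have B0 : 0 <= B by rewrite (le_trans _ (zB 0)).
  rewrite gK ?gK ?subrr ?expr0n/= ?mulr0//.
    by rewrite (le_lt_trans _ Ky)// lerDl.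
  have : `|y| <= `|y + z_ n| + `|z_ n|.
    by rewrite -[X in `|X| <= _](addrK (z_ n)) ler_normB.
  have := zB n; move: Ky; lra.
Qed.

(** Functions bounded by N are at most 2 N apart, so that on them closeness in
    L_1, where continuous functions are dense, implies closeness in L_2. The
    continuous approximation is clamped to [-N, N] and multiplied by a tent
    function to make its support compact; neither increases the distance to a
    function bounded by N and supported in [-N, N]. *)
Lemma L2_translation_continuous a : measurable_fun setT a ->
  mu.-integrable setT (EFin \o (fun x => a x ^+ 2)) -> translation_continuous a.
Proof.
move=> ma a2.
(* truncation reduces to bounded functions with bounded support *)
pose A n (x : RT) : R := a x * \1_[set x | `|x| <= n%:R /\ `|a x| <= n%:R] x.
have mS n : measurable [set x : RT | `|x| <= n%:R /\ `|a x| <= n%:R].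
  apply: measurableI.
    rewrite -[X in measurable X]setTI.
    apply: (@measurable_fun_le _ RT R setT (fun x : RT => `|x|) (cst n%:R)) => //.
    by apply: continuous_measurable_fun; exact: norm_continuous.
  rewrite -[X in measurable X]setTI.
  apply: (@measurable_fun_le _ RT R setT (fun x : RT => `|a x|) (cst n%:R)) => //.
  exact: measurableT_comp.
have mA n : measurable_fun setT (A n) by apply: measurable_funM.
have A0 : (\int[mu]_y ((a y - A n y) ^+ 2)%:E)%E @[n --> \oo] --> 0%E.
  have -> : 0%E = (\int[mu]_y (cst 0%E y) : \bar R)%E by rewrite integral0.
  apply: (@dominated_cvg _ _ _ mu setT measurableT
    (fun n y => ((a y - A n y) ^+ 2)%:E) (cst 0%E) (fun y => (a y ^+ 2)%:E)) => //.
  - by move=> n; apply: measurable_sqr; apply: measurable_funB.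
  - move=> y _; apply: cvg_near_cst.
    near=> n; rewrite /A indicE mem_set ?mulr1 ?subrr ?expr0n//=.
    by split; near: n; exact: nbhs_infty_ger.
  - move=> n y _ /=; rewrite lee_fin ger0_norm ?sqr_ge0// /A indicE.
    by case: (_ \in _); rewrite ?mulr1 ?mulr0 ?subr0 ?subrr ?expr0n/= ?sqr_ge0.
apply: translation_continuous_close => // e e0.
move/cvge0_le : A0 => /(_ _)/(_ _ e0) A0.
have [N [NA AN]] : exists N, (0 < N)%N /\
    (\int[mu]_y ((a y - A N y) ^+ 2)%:E <= e%:E)%E.
  have {}A0 : \forall n \near \oo, (\int[mu]_y ((a y - A n y) ^+ 2)%:E <= e%:E)%E.
    by apply: A0 => n; apply: integral_ge0 => y _; rewrite lee_fin sqr_ge0.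
  by near \oo => n; exists n; split; near: n => //; exact: nbhs_infty_gt.
exists (A N); split => //.
(* a bounded function supported in [-N, N] is close to a continuous one *)
have N0 : 0 < N%:R :> R by rewrite ltr0n.
pose E : set RT := `[(- (N%:R + 1)), (N%:R + 1)]%classic.
have mE : measurable E by exact: measurable_itv.
have Efin : (mu E < +oo)%E.
  by rewrite /E lebesgue_measure_itv/=; case: ifP; rewrite ?ltry// -EFinB ltry.
have AN' x : `|A N x| <= N%:R.
  rewrite /A indicE; case: (boolP (x \in _)) => [|_] /=; last by rewrite mulr0 normr0 ltW.
  by rewrite inE /= mulr1 => -[].
have AE : mu.-integrable E (EFin \o A N).
  apply: measurable_bounded_integrable => //; first exact: measurable_funTS.
  exists N%:R; split; first exact: num_real.
  by move=> M NM x _ /=; rewrite (le_trans (AN' x))// ltW.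
have [h_ [ch _ hA]] := approximation_continuous_integrable mE Efin AE.
apply: translation_continuous_close => // d d0.
have dN : 0 < d / (2 * N%:R) by rewrite divr_gt0// mulr_gt0.
move/cvge0_le : hA => /(_ _)/(_ _ dN) hA.
have {hA}[k hk] : exists k,
    (\int[mu]_(x in E) `|(A N x - h_ k x)%:E| <= (d / (2 * N%:R))%:E)%E.
  have {}hA : \forall n \near \oo,
      (\int[mu]_(x in E) `|(A N x - h_ n x)%:E| <= (d / (2 * N%:R))%:E)%E.
    by apply: hA => n; exact: integral_ge0.
  by near \oo => n; exists n; near: n.
pose tent (x : R) : R := Num.max 0 (Num.min 1 (N%:R + 1 - `|x|)).
pose clamp (x : R) : R := Num.max (- N%:R) (Num.min N%:R (h_ k x)).
have ctent : continuous tent.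
  move=> x; apply: (@continuous_max R R (cst (0 : R))
    (fun y : R => Num.min 1 (N%:R + 1 - `|y|))); first exact: cvg_cst.
  apply: (@continuous_min R R (cst (1 : R)) (fun y : R => N%:R + 1 - `|y|)).
    exact: cvg_cst.
  by apply: cvgB; [exact: cvg_cst | exact: norm_continuous].
have cclamp : continuous clamp.
  move=> x; apply: (@continuous_max R R (cst (- N%:R : R))
    (fun y : R => Num.min N%:R (h_ k y))); first exact: cvg_cst.
  apply: (@continuous_min R R (cst (N%:R : R)) (h_ k)); first exact: cvg_cst.
  exact: ch.
pose g (x : RT) : R := clamp x * tent x.
have tent01 x : 0 <= tent x <= 1.
  by rewrite /tent le_max lexx/= ge_max ler01 ge_min lexx.
have clampN x : `|clamp x| <= N%:R.
  by rewrite ler_norml /clamp le_max lexx/= ge_max ge_min lexx/= andbT; move: N0; lra.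
have cg : continuous (g : R -> R).
  by move=> x; apply: cvgM; [exact: cclamp | exact: ctent].
have mg : measurable_fun setT g by exact: continuous_measurable_fun.
have gE x : ~ E x -> g x = 0.
  move=> xE; rewrite /g /tent max_l ?mulr0// ge_min; apply/orP; right.
  rewrite subr_le0 leNgt; apply/negP => h; apply: xE.
  by rewrite /E/= in_itv/= -ler_norml ltW.
exists g; split => //.
  apply: (@translation_continuous_compact g N%:R (N%:R + 1)) => //.
    move=> x; rewrite normrM; have /andP[t0 t1] := tent01 x.
    by rewrite (ger0_norm t0) (le_trans _ (clampN x))// ler_piMr.
  move=> x h; apply: gE; rewrite /E/= in_itv/= -ler_norml => h'.
  by move: h; rewrite ltNge h'.
have AT x : A N x = A N x * tent x.
  rewrite /A indicE; case: (boolP (x \in _)) => [|_] /=; last by rewrite !(mulr0, mul0r).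
  rewrite inE /= mulr1 => -[xN _].
  by rewrite /tent min_l ?max_r ?mulr1//; move: xN; lra.
have le2 x : (A N x - g x) ^+ 2 <= 2 * N%:R * `|A N x - h_ k x|.
  have /andP[t0 t1] := tent01 x.
  have /ler_normlP[A1 A2] := AN' x.
  have E1 : `|A N x - g x| <= `|A N x - h_ k x|.
    rewrite {1}AT /g -mulrBl normrM (ger0_norm t0).
    apply: (@le_trans _ _ `|A N x - clamp x|); first by rewrite ler_piMr.
    move: A1 A2; rewrite /clamp; case: (leP N%:R (h_ k x)) => h1 A1 A2.
      rewrite max_r; last by move: N0; lra.
      by rewrite !ler0_norm; move: A1 A2 h1; lra.
    case: (leP (- N%:R) (h_ k x)) => h2 //.
    by rewrite !ger0_norm; move: A1 A2 h1 h2; lra.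
  have E2 : `|A N x - g x| <= 2 * N%:R.
    rewrite (le_trans (ler_normB _ _))// mulr_natl mulr2n lerD//.
    by rewrite /g normrM (ger0_norm t0) (le_trans _ (clampN x))// ler_piMr.
  by rewrite -[leLHS]ger0_norm ?sqr_ge0// normrX expr2 ler_pM.
have m1 : measurable_fun setT (fun x => A N x - g x) by exact: measurable_funB.
have m2 : measurable_fun setT (fun x => A N x - h_ k x).
  by apply: measurable_funB => //; exact: continuous_measurable_fun.
rewrite -(setUv E) ge0_integral_setU//; last 4 first.
- exact: measurableC.
- by rewrite setUv; exact: measurable_sqr.
- by move=> x _; rewrite lee_fin sqr_ge0.
- by rewrite disj_set2E setICr.
rewrite [X in (_ + X)%E](_ : _ = 0%E) ?adde0; last first.
  rewrite -[RHS](@integral0 _ _ _ mu (~` E)); apply: eq_integral => x.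
  rewrite inE => xE; rewrite AT /tent; have := gE x xE.
  rewrite /g /tent max_l ?mulr0 => [->|]; first by rewrite subrr expr0n.
  rewrite ge_min; apply/orP; right.
  rewrite subr_le0 leNgt; apply/negP => h; apply: xE.
  by rewrite /E/= in_itv/= -ler_norml ltW.
apply: (@le_trans _ _ (\int[mu]_(x in E) ((2 * N%:R)%:E * `|(A N x - h_ k x)%:E|))%E).
  apply: ge0_le_integral => //.
  - by move=> x _; rewrite lee_fin sqr_ge0.
  - by apply: measurable_funTS; exact: measurable_sqr.
  - apply: measurable_funTS; apply: measurable_funeM; apply: measurableT_comp => //.
    exact/measurable_EFinP.
  - by move=> x _; rewrite -EFinM lee_fin.
rewrite ge0_integralZl//; last first.
  by apply: measurable_funTS; apply: measurableT_comp => //; exact/measurable_EFinP.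
apply: (@le_trans _ _ ((2 * N%:R)%:E * (d / (2 * N%:R))%:E)%E).
  by rewrite lee_pmul2l// lte_fin mulr_gt0.
by rewrite -EFinM lee_fin mulrC divfK// gt_eqF// mulr_gt0.
Unshelve. all: by end_near. Qed.

End translation.

(** * Plancherel's identity on the line *)

Section plancherel_def.
Context {R : realType} d (T : measurableType d) (m : {measure set T -> \bar R}).
Variables (c s : T -> T -> R).

Definition transform (k : T -> T -> R) (a : T -> R) (xi : T) : R :=
  Rintegral m setT (fun x => a x * k x xi).

(** Plancherel's identity for the function a + i b and the kernel c - i s, in
    real and imaginary parts: its transform is (Ca + Sb) + i (Cb - Sa). *)
Definition plancherel := forall a b : T -> R,
  m.-integrable setT (EFin \o a) -> m.-integrable setT (EFin \o b) ->
  m.-integrable setT (EFin \o (fun x => a x ^+ 2)) ->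
  m.-integrable setT (EFin \o (fun x => b x ^+ 2)) ->
  (\int[m]_xi ((transform c a xi + transform s b xi) ^+ 2 +
               (transform c b xi - transform s a xi) ^+ 2)%:E
   = \int[m]_x (a x ^+ 2 + b x ^+ 2)%:E)%E.

End plancherel_def.

Lemma measurable_transform {R : realType} d (T : measurableType d)
    (m : {sigma_finite_measure set T -> \bar R}) (k : T -> T -> R) (a : T -> R) :
  measurable_fun setT (fun p : T * T => k p.1 p.2) -> measurable_fun setT a ->
  measurable_fun setT (transform m k a).
Proof.
move=> mk ma; apply: (measurable_Rintegral m (F := fun p : T * T => a p.2 * k p.2 p.1)).
apply: measurable_funM; first exact: (measurableT_comp ma).
apply: (measurableT_comp mk (g := fun p : T * T => (p.2, p.1))).
exact: measurable_fun_pair.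
Qed.

Section plancherel1.
Context {R : realType}.
Local Notation mu := (@lebesgue_measure R).
Local Notation RT := (measurableTypeR R).
Local Notation int f := (mu.-integrable setT (EFin \o f)).

Definition cos1 (x xi : RT) : R := cos (2 * pi * (x * xi)).
Definition sin1 (x xi : RT) : R := sin (2 * pi * (x * xi)).
Local Notation C := (transform mu cos1).
Local Notation S := (transform mu sin1).

Lemma measurable_cos : measurable_fun setT (cos : RT -> RT).
Proof. by apply: continuous_measurable_fun; exact: continuous_cos. Qed.
Lemma measurable_sin : measurable_fun setT (sin : RT -> RT).
Proof. by apply: continuous_measurable_fun; exact: continuous_sin. Qed.

Lemma measurable_mul2 : measurable_fun setT (fun p : RT * RT => p.1 * p.2 : R).
Proof. by apply: measurable_funM. Qed.

Lemma measurable_cos1 : measurable_fun setT (fun p : RT * RT => cos1 p.1 p.2).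
Proof.
rewrite /cos1; apply: (measurableT_comp (f := cos : RT -> RT)).
  exact: measurable_cos.
by apply: measurable_funM => //; exact: measurable_mul2.
Qed.

Lemma measurable_sin1 : measurable_fun setT (fun p : RT * RT => sin1 p.1 p.2).
Proof.
rewrite /sin1; apply: (measurableT_comp (f := sin : RT -> RT)).
  exact: measurable_sin.
by apply: measurable_funM => //; exact: measurable_mul2.
Qed.

Lemma cos1_le1 x y : `|cos1 x y| <= 1.
Proof. by rewrite ler_norml cos_geN1 cos_le1. Qed.
Lemma sin1_le1 x y : `|sin1 x y| <= 1.
Proof. by rewrite ler_norml sin_geN1 sin_le1. Qed.

Lemma cos1B x y xi :
  cos1 (x - y) xi = cos1 x xi * cos1 y xi + sin1 x xi * sin1 y xi.
Proof. by rewrite /cos1 /sin1 mulrBl mulrBr cosB. Qed.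

(** The Fourier transform of exp (- e |xi|), an approximate identity of total
    mass 1 as [e] tends to 0. *)
Definition poisson (e z : R) : R := 2 * e / (e ^+ 2 + (2 * pi * z) ^+ 2).

(** Here p stands for pi: the Poisson kernel is the normalised Cauchy density at
    the scale e / (2 pi). *)
Lemma poisson_scale (p e u : R) : p != 0 -> e != 0 ->
  e / (2 * p) * (2 * e / (e ^+ 2 + (2 * p * (e / (2 * p) * u)) ^+ 2)) =
  (1 + u ^+ 2)^-1 / p.
Proof.
move=> p0 e0; have u0 : 1 + u ^+ 2 != 0 by rewrite gt_eqF// ltr_wpDr ?sqr_ge0.
have -> : 2 * p * (e / (2 * p) * u) = e * u by field.
have -> : e ^+ 2 + (e * u) ^+ 2 = e ^+ 2 * (1 + u ^+ 2) by ring.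
by field; rewrite p0 u0 e0.
Qed.

Section fixed_function.
Variable a : RT -> R.
Hypotheses (ai : int a) (a2i : int (fun x => a x ^+ 2)).

Let ma : measurable_fun setT a. Proof. exact: int_measurable ai. Qed.
Let A := Rintegral mu setT (fun x => `|a x|).

Let mcos1r xi : measurable_fun setT (fun x => cos1 x xi).
Proof. exact: (measurable_section2 xi measurable_cos1). Qed.
Let msin1r xi : measurable_fun setT (fun x => sin1 x xi).
Proof. exact: (measurable_section2 xi measurable_sin1). Qed.

Let iac xi : int (fun x => a x * cos1 x xi).
Proof. by apply: (int_mulb ai (mcos1r xi)) => x; exact: cos1_le1. Qed.
Let ias xi : int (fun x => a x * sin1 x xi).
Proof. by apply: (int_mulb ai (msin1r xi)) => x; exact: sin1_le1. Qed.

(* G x xi is the real part of exp (2 pi i x xi) times the transform of a at xi,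
   so that the energy at xi is the integral of a against G. *)
Let G (x xi : RT) : R := Rintegral mu setT (fun y => a y * cos1 (x - y) xi).

Let GE x xi : G x xi = cos1 x xi * C a xi + sin1 x xi * S a xi.
Proof.
rewrite /C /S /transform -!RintegralZl// -RintegralD//; last 2 first.
  exact: (intZ (cos1 x xi) (iac xi)).
  exact: (intZ (sin1 x xi) (ias xi)).
by apply: eq_Rintegral => y _; rewrite cos1B; ring.
Qed.

Let CSE xi : C a xi ^+ 2 + S a xi ^+ 2 = Rintegral mu setT (fun x => a x * G x xi).
Proof.
under eq_Rintegral do rewrite GE.
rewrite [RHS](_ : _ = Rintegral mu setT
  (fun x => C a xi * (a x * cos1 x xi) + S a xi * (a x * sin1 x xi))); last first.
  by apply: eq_Rintegral => x _; ring.
rewrite RintegralD//; last 2 first.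
  exact: (intZ (C a xi) (iac xi)).
  exact: (intZ (S a xi) (ias xi)).
by rewrite !RintegralZl// !expr2.
Qed.

Let mG : measurable_fun setT (fun p : RT * RT => G p.1 p.2).
Proof.
apply: (measurable_Rintegral mu (F := fun q : (RT * RT) * RT =>
  a q.2 * cos1 (q.1.1 - q.2) q.1.2)).
apply: measurable_funM; first exact: measurableT_comp.
apply: (measurableT_comp measurable_cos1 (g := fun q : (RT * RT) * RT =>
  (q.1.1 - q.2 : RT, q.1.2))).
apply: measurable_fun_pair.
  apply: measurable_funB => //.
  by apply: measurableT_comp => //; exact: measurable_fst.
by apply: measurableT_comp => //.
Qed.

Let GA x xi : `|G x xi| <= A.
Proof.
apply: le_Rintegral_abs => //; last 2 first.
- exact: int_abs.
- by move=> y; rewrite normrM ler_piMr// cos1_le1.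
apply: measurable_funM => //.
apply: (measurableT_comp (mcos1r xi) (g := fun y : RT => x - y : RT)).
exact: measurable_funB.
Qed.

Let w (e xi : R) := expR (- (e * `|xi|)).

(** The weight makes the triple integral over x, y, xi absolutely convergent, so
    that xi may be integrated first, which produces the Poisson kernel. *)
Lemma integral_weighted_energy (e : R) : 0 < e ->
  Rintegral mu setT (fun xi => w e xi * (C a xi ^+ 2 + S a xi ^+ 2)) =
  Rintegral mu setT (fun x => a x *
    Rintegral mu setT (fun y => poisson e (x - y) * a y)).
Proof.
move=> e0; have wi := integrable_exp_abs e0.
have mw := @measurable_exp_abs R e.
transitivity (Rintegral mu setT (fun xi => Rintegral mu setT (fun x =>
    w e xi * (a x * G x xi)))).
  apply: eq_Rintegral => xi _; rewrite CSE RintegralZl//.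
  apply: (int_mulb ai (M := A)) => //.
  exact: (measurable_section2 xi mG).
rewrite (Fubini_Rintegral (F := fun p : RT * RT => w e p.1 * (a p.2 * G p.2 p.1))); last first.
  apply: (integrable_prod_le (g := fun xi : RT => w e xi) (h := fun x : RT => A * `|a x|)) => //.
  - apply: measurable_funM; first exact: (measurableT_comp mw).
    apply: measurable_funM; first exact: (measurableT_comp ma).
    apply: (measurableT_comp mG (g := fun p : RT * RT => (p.2, p.1))).
    exact: measurable_fun_pair.
  - move=> xi x; rewrite normrM (ger0_norm (expR_ge0 _)) ler_wpM2l ?expR_ge0//.
    by rewrite normrM mulrC ler_wpM2r.
  - exact/intZ/int_abs.
apply: eq_Rintegral => x _.
transitivity (a x * Rintegral mu setT (fun xi => w e xi * G x xi)).
  rewrite -RintegralZl//; first by apply: eq_Rintegral => xi _; ring.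
  by apply: (int_mulb wi (M := A)) => //; exact: (measurable_section1 x mG).
congr (_ * _).
transitivity (Rintegral mu setT (fun xi => Rintegral mu setT (fun y =>
    w e xi * (a y * cos1 (x - y) xi)))).
  apply: eq_Rintegral => xi _; rewrite RintegralZl//.
  apply: (int_mulb ai (M := 1)) => [|y]; last exact: cos1_le1.
  apply: (measurableT_comp (mcos1r xi) (g := fun y : RT => x - y : RT)).
  exact: measurable_funB.
rewrite (Fubini_Rintegral (F := fun p : RT * RT =>
    w e p.1 * (a p.2 * cos1 (x - p.2) p.1))); last first.
  apply: (integrable_prod_le (g := fun xi : RT => w e xi) (h := fun x : RT => `|a x|)) => //.
  - apply: measurable_funM; first exact: (measurableT_comp mw).
    apply: measurable_funM; first exact: (measurableT_comp ma).
    apply: (measurableT_comp measurable_cos1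
      (g := fun p : RT * RT => (x - p.2 : RT, p.1))).
    by apply: measurable_fun_pair => //; exact: measurable_funB.
  - move=> xi y; rewrite normrM (ger0_norm (expR_ge0 _)) ler_wpM2l ?expR_ge0//.
    by rewrite normrM ler_piMr// cos1_le1.
  - exact: int_abs.
apply: eq_Rintegral => y _.
rewrite /poisson -(Rintegral_exp_cos (2 * pi * (x - y)) e0) mulrC.
rewrite -RintegralZl//; last first.
  apply: (int_mulb wi (M := 1)); last by move=> xi; rewrite ler_norml cos_geN1 cos_le1.
  exact: measurable_cosM.
by apply: eq_Rintegral => xi _ /=; rewrite /w /cos1 mulrCA (mulrA _ (x - y)).
Qed.

Let A2 := Rintegral mu setT (fun x => a x ^+ 2).

Let poisson_ge0 (e z : R) : 0 < e -> 0 <= poisson e z.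
Proof.
by move=> e0; rewrite /poisson divr_ge0 ?mulr_ge0 ?addr_ge0 ?sqr_ge0// ltW.
Qed.

Let poisson_le (e z : R) : 0 < e -> poisson e z <= 2 / e.
Proof.
move=> e0; rewrite /poisson ler_pdivrMr ?ltr_wpDr ?sqr_ge0 ?exprn_gt0//.
rewrite mulrDr (_ : 2 / e * e ^+ 2 = 2 * e); last by field; rewrite gt_eqF.
by rewrite lerDl mulr_ge0 ?sqr_ge0// divr_ge0// ltW.
Qed.

Let continuous_poisson (e : R) : 0 < e -> continuous (poisson e).
Proof.
move=> e0 z; apply: cvgM; first exact: cvg_cst.
apply: cvgV; first by rewrite gt_eqF// ltr_wpDr ?sqr_ge0 ?exprn_gt0.
apply: cvgD; first exact: cvg_cst.
apply: (@continuous_comp _ _ _ (fun z => 2 * pi * z) (fun y : R => y ^+ 2)).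
  by apply: cvgMl_tmp; exact: cvg_id.
exact: exprn_continuous.
Qed.

Let poissonN (e z : R) : poisson e (- z) = poisson e z.
Proof. by rewrite /poisson mulrN sqrrN. Qed.

Let mpoisson (e : R) : 0 < e -> measurable_fun setT (poisson e : RT -> RT).
Proof. by move=> e0; apply: continuous_measurable_fun; exact: continuous_poisson. Qed.

Let mpoissonB (e : R) : 0 < e ->
  measurable_fun setT (fun p : RT * RT => poisson e (p.1 - p.2)).
Proof.
move=> e0; apply: (measurableT_comp (mpoisson e0) (g := fun p : RT * RT => p.1 - p.2 : RT)).
exact: measurable_funB.
Qed.

(* the substitution y = x + delta u, delta = e / (2 pi) *)
Let poisson_affine (e x : R) (f : RT -> \bar R) : 0 < e ->
  measurable_fun setT f -> (forall y, 0 <= f y)%E ->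
  (\int[mu]_y ((poisson e (x - y))%:E * f y) =
   \int[mu]_u ((cauchy_density u / pi)%:E * f (e / (2 * pi) * u + x)%R))%E.
Proof.
move=> e0 mf f0.
have d0 : 0 < e / (2 * pi) by rewrite divr_gt0// mulr_gt0// pi_gt0.
have m1 : measurable_fun setT (fun y : RT => (poisson e (x - y))%:E * f y)%E.
  apply: emeasurable_funM => //; apply/measurable_EFinP.
  exact: (measurable_section1 x (mpoissonB e0)).
rewrite -(ge0_integral_affine x d0 m1); last first.
  by move=> y; rewrite mule_ge0// lee_fin poisson_ge0.
rewrite muleC -ge0_integralZl//; last 3 first.
- exact: (measurableT_comp m1 (@measurable_affine R (e / (2 * pi)) x)).
- by move=> u _; rewrite mule_ge0// lee_fin poisson_ge0.
- by rewrite lee_fin ltW.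
apply: eq_integral => u _; rewrite muleA -EFinM; congr (_%:E * _)%E.
rewrite opprD addrCA subrr addr0 poissonN /poisson /cauchy_density.
by rewrite poisson_scale ?gt_eqF// pi_gt0.
Qed.

Let integral_poisson (e x : R) : 0 < e ->
  (\int[mu]_y (poisson e (x - y))%:E = 1)%E.
Proof.
move=> e0.
transitivity (\int[mu]_y ((poisson e (x - y))%:E * (cst 1%E y)))%E.
  by apply: eq_integral => y _; rewrite mule1.
rewrite (poisson_affine x e0)//.
transitivity (\int[mu]_u ((pi^-1)%:E * (cauchy_density u)%:E))%E.
  by apply: eq_integral => u _; rewrite mule1 mulrC EFinM.
rewrite ge0_integralZl//; last 3 first.
- apply/measurable_EFinP; exact: measurable_cauchy.
- by move=> u _; rewrite lee_fin cauchy_ge0.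
- by rewrite lee_fin invr_ge0 pi_ge0.
by rewrite integral_cauchy -EFinM mulVf// gt_eqF// pi_gt0.
Qed.

Let mpois1 (e x : R) : 0 < e ->
  measurable_fun setT (fun y : RT => poisson e (x - y)).
Proof. by move=> e0; exact: (measurable_section1 x (mpoissonB e0)). Qed.

Let ip (e x : R) : 0 < e -> int (fun y => poisson e (x - y)).
Proof.
move=> e0; apply/ge0_intP.
- exact: mpois1.
- by move=> y; exact: poisson_ge0.
- by rewrite integral_poisson// ltry.
Qed.

Let pbound (e z : R) : 0 < e -> `|poisson e z| <= 2 / e.
Proof. by move=> e0; rewrite ger0_norm ?poisson_ge0// poisson_le. Qed.

Let ipf (e x : R) (f : RT -> R) : 0 < e -> int f ->
  int (fun y => poisson e (x - y) * f y).
Proof.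
move=> e0 fi; have := int_mulb fi (mpois1 x e0) (fun y => pbound (x - y) e0).
by apply: eq_integrable => // y _ /=; rewrite mulrC.
Qed.

(* Expanding the square expresses the quadratic form of the Poisson kernel
   through the squared norm and the averages j of squared differences. *)
Let j (e x : R) := Rintegral mu setT (fun y => poisson e (x - y) * (a x - a y) ^+ 2).
Let h (e x : R) := Rintegral mu setT (fun y => poisson e (x - y) * a y).
Let k (e x : R) := Rintegral mu setT (fun y => poisson e (x - y) * a y ^+ 2).

Let jE (e x : R) : 0 < e -> j e x = a x ^+ 2 - 2 * (a x * h e x) + k e x.
Proof.
move=> e0; rewrite /j /h /k.
have i1 := intZ (a x ^+ 2) (ip x e0).
have i2 := intZ (2 * a x) (ipf x e0 ai).
have i3 := ipf x e0 a2i.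
transitivity (Rintegral mu setT (fun y => a x ^+ 2 * poisson e (x - y) -
   2 * a x * (poisson e (x - y) * a y) + poisson e (x - y) * a y ^+ 2)).
  by apply: eq_Rintegral => y _; ring.
rewrite RintegralD//; last exact: (intB i1 i2).
rewrite RintegralB//.
rewrite (@RintegralZl _ _ _ mu setT _ (a x ^+ 2) measurableT (ip x e0)).
rewrite (@RintegralZl _ _ _ mu setT _ (2 * a x) measurableT (ipf x e0 ai)).
have -> : Rintegral mu setT (fun y => poisson e (x - y)) = 1.
  by rewrite /Rintegral integral_poisson.
by rewrite mulr1 mulrA.
Qed.

Let mk e : 0 < e -> measurable_fun setT (k e).
Proof.
move=> e0; apply: (measurable_Rintegral mu
  (F := fun p : RT * RT => poisson e (p.1 - p.2) * a p.2 ^+ 2)).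
apply: measurable_funM; first exact: mpoissonB.
by apply: measurable_funX; exact: (measurableT_comp ma).
Qed.

Let mh e : 0 < e -> measurable_fun setT (h e).
Proof.
move=> e0; apply: (measurable_Rintegral mu
  (F := fun p : RT * RT => poisson e (p.1 - p.2) * a p.2)).
apply: measurable_funM; first exact: mpoissonB.
exact: (measurableT_comp ma).
Qed.

Let integral_k e : 0 < e -> (\int[mu]_x (k e x)%:E = A2%:E)%E.
Proof.
move=> e0; rewrite EFin_Rintegral//.
transitivity (\int[mu]_x \int[mu]_y (poisson e (x - y) * a y ^+ 2)%:E)%E.
  by apply: eq_integral => x _; rewrite EFin_Rintegral//; exact: ipf.
rewrite (fubini_tonelli (fun p : RT * RT => (poisson e (p.1 - p.2) * a p.2 ^+ 2)%:E)); last 2 first.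
- apply/measurable_EFinP; apply: measurable_funM; first exact: mpoissonB.
  by apply: measurable_funX; exact: (measurableT_comp ma).
- by move=> p; rewrite lee_fin mulr_ge0 ?sqr_ge0// poisson_ge0.
apply: eq_integral => y _ /=.
transitivity ((a y ^+ 2)%:E * \int[mu]_x (poisson e (y - x))%:E)%E; last first.
  by rewrite integral_poisson// mule1.
rewrite -ge0_integralZl//; last 3 first.
- by apply/measurable_EFinP; exact: mpois1.
- by move=> x _; rewrite lee_fin poisson_ge0.
- by rewrite lee_fin sqr_ge0.
by apply: eq_integral => x _; rewrite -EFinM mulrC -(poissonN e (y - x)) opprB.
Qed.

Let ik e : 0 < e -> int (k e).
Proof.
move=> e0; apply/ge0_intP; first exact: mk.
  by move=> x; apply: Rintegral_ge0 => // y _; rewrite mulr_ge0 ?sqr_ge0// poisson_ge0.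
by rewrite integral_k// ltry.
Qed.

Let iah e : 0 < e -> int (fun x => a x * h e x).
Proof.
move=> e0; apply: (int_mulb ai (M := 2 / e * A)); first exact: mh.
move=> x; rewrite /A -RintegralZl//; last exact: int_abs.
apply: le_Rintegral_abs => //; last 2 first.
- exact/intZ/int_abs.
- by move=> y; rewrite normrM ler_wpM2r// pbound.
by apply: measurable_funM => //; exact: mpois1.
Qed.

Let ij e : 0 < e -> int (j e).
Proof.
move=> e0.
have := intD (intB a2i (intZ 2 (iah e0))) (ik e0).
by apply: eq_integrable => // x _ /=; rewrite jE.
Qed.

Lemma weighted_energyE e : 0 < e ->
  Rintegral mu setT (fun xi => w e xi * (C a xi ^+ 2 + S a xi ^+ 2)) =
  A2 - Rintegral mu setT (j e) / 2.
Proof.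
move=> e0; rewrite integral_weighted_energy// -/(h e _).
have -> : Rintegral mu setT (j e) =
    A2 - 2 * Rintegral mu setT (fun x => a x * h e x) + A2.
  rewrite [LHS](_ : _ = Rintegral mu setT
    (fun x => a x ^+ 2 - 2 * (a x * h e x) + k e x)); last first.
    by apply: eq_Rintegral => x _; exact: (jE x e0).
  rewrite RintegralD//; [|exact: (intB a2i (intZ 2 (iah e0)))|exact: ik].
  rewrite RintegralB//; last exact: (intZ 2 (iah e0)).
  rewrite RintegralZl//; last exact: iah.
  by congr (_ + _); rewrite /Rintegral integral_k.
by rewrite /h; field.
Qed.

Let md : measurable_fun setT (fun z => translation_defect a z).
Proof.
apply: (measurable_fun_fubini_tonelli_F (m2 := mu)
  (fun p : RT * RT => ((a (p.2 + p.1)%R - a p.2) ^+ 2)%:E)).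
  apply/measurable_EFinP; apply: measurable_funX; apply: measurable_funB.
    apply: (measurableT_comp ma (g := fun p : RT * RT => p.2 + p.1 : RT)).
    exact: measurable_funD.
  exact: (measurableT_comp ma).
by move=> p; rewrite lee_fin sqr_ge0.
Qed.

(** Substituting y = x + (e / (2 pi)) u and integrating in x first turns the
    average of squared differences into an average of translation defects at
    scale e. *)
Lemma integral_j e : 0 < e ->
  ((Rintegral mu setT (j e))%:E =
   \int[mu]_u ((cauchy_density u / pi)%:E * translation_defect a (e / (2 * pi) * u)%R))%E.
Proof.
move=> e0; rewrite EFin_Rintegral//; last exact: ij.
transitivity (\int[mu]_x \int[mu]_u ((cauchy_density u / pi)%:E *
    ((a (x + e / (2 * pi) * u)%R - a x) ^+ 2)%:E))%E.
  apply: eq_integral => x _; rewrite EFin_Rintegral//; last first.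
    have := intD (intB (intZ (a x ^+ 2) (ip x e0)) (intZ (2 * a x) (ipf x e0 ai)))
      (ipf x e0 a2i).
    by apply: eq_integrable => // y _ /=; congr EFin; ring.
  under eq_integral do rewrite EFinM.
  rewrite (poisson_affine x e0 (f := fun y => ((a x - a y) ^+ 2)%:E)).
  - by apply: eq_integral => u _; rewrite (addrC x) -sqrrN opprB.
  - by apply/measurable_EFinP; apply: measurable_funX; apply: measurable_funB.
  - by move=> y; rewrite lee_fin sqr_ge0.
have cp0 (u : R) : 0 <= cauchy_density u / pi.
  by rewrite divr_ge0 ?pi_ge0// cauchy_ge0.
rewrite (fubini_tonelli (fun p : RT * RT => (cauchy_density p.2 / pi)%:E *
    ((a (p.1 + e / (2 * pi) * p.2)%R - a p.1) ^+ 2)%:E)%E); last 2 first.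
- apply/measurable_EFinP; apply: measurable_funM.
    apply: measurable_funM => //.
    exact: (measurableT_comp measurable_cauchy).
  apply: measurable_funX; apply: measurable_funB; last exact: (measurableT_comp ma).
  apply: (measurableT_comp ma (g := fun p : RT * RT => p.1 + e / (2 * pi) * p.2 : RT)).
  by apply: measurable_funD => //; apply: measurable_funM.
- by move=> p; rewrite -EFinM lee_fin mulr_ge0 ?sqr_ge0.
apply: eq_integral => u _ /=; rewrite ge0_integralZl//.
- apply/measurable_EFinP; apply: measurable_funX; apply: measurable_funB => //.
  exact: measurable_translate.
- by move=> x _; rewrite lee_fin sqr_ge0.
- by rewrite lee_fin.
Qed.

Let defect_le z : (translation_defect a z <= (4 * A2)%:E)%E.
Proof.
have m1 : measurable_fun setT (fun x : RT => (a (x + z)%R ^+ 2)%:E).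
  by apply/measurable_EFinP; apply: measurable_funX; exact: measurable_translate.
have m2 : measurable_fun setT (fun x : RT => (a x ^+ 2)%:E).
  exact: measurable_sqr.
apply: (@le_trans _ _ (\int[mu]_x (2%:E * ((a (x + z)%R ^+ 2)%:E + (a x ^+ 2)%:E)))%E).
  apply: ge0_le_integral => //.
  - by move=> x _; rewrite lee_fin sqr_ge0.
  - apply/measurable_EFinP; apply: measurable_funX; apply: measurable_funB => //.
    exact: measurable_translate.
  - by apply: measurable_funeM; apply: emeasurable_funD.
  - move=> x _; rewrite -EFinD -EFinM lee_fin -subr_ge0.
    have := sqr_ge0 (a (x + z) + a x); congr (_ <= _); ring.
have p0 (f : RT -> R) x : (0 <= (f x ^+ 2)%:E)%E by rewrite lee_fin sqr_ge0.
rewrite ge0_integralZl//; [|exact: emeasurable_funD|]; last first.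
  by move=> x _; rewrite adde_ge0// lee_fin sqr_ge0.
rewrite ge0_integralD//.
rewrite (ge0_integral_translate (f := fun x => (a x ^+ 2)%:E))//.
rewrite -EFin_Rintegral// -/A2 -EFinD -EFinM lee_fin; lra.
Qed.

(** By [weighted_energyE] the weighted energy is the squared norm minus half an
    average of translation defects. As e tends to 0 the weights increase to 1 and
    the defects tend to 0. *)
Lemma plancherel1_real :
  (\int[mu]_xi (C a xi ^+ 2 + S a xi ^+ 2)%:E = \int[mu]_x (a x ^+ 2)%:E)%E.
Proof.
pose e_ n : R := 2 * pi / n.+1%:R.
have e0 n : 0 < e_ n by rewrite divr_gt0// mulr_gt0// pi_gt0.
have p0 : pi != 0 :> R by rewrite gt_eqF// pi_gt0.
have E_ n : e_ n / (2 * pi) = n.+1%:R^-1.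
  by rewrite /e_ mulrAC mulfV ?mul1r// mulf_neq0.
have mC : measurable_fun setT (C a) := measurable_transform mu measurable_cos1 ma.
have mS : measurable_fun setT (S a) := measurable_transform mu measurable_sin1 ma.
have mE : measurable_fun setT (fun xi => C a xi ^+ 2 + S a xi ^+ 2).
  by apply: measurable_funD; apply: measurable_funX.
have mw n : measurable_fun setT (fun xi => w (e_ n) xi * (C a xi ^+ 2 + S a xi ^+ 2)).
  by apply: measurable_funM => //; exact: measurable_exp_abs.
have E0 xi : 0 <= C a xi ^+ 2 + S a xi ^+ 2 by rewrite addr_ge0 ?sqr_ge0.
have Cb xi : `|C a xi| <= A.
  apply: le_Rintegral_abs; [exact: int_measurable (iac xi)|exact: int_abs|].
  by move=> x; rewrite normrM ler_piMr// cos1_le1.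
have Sb xi : `|S a xi| <= A.
  apply: le_Rintegral_abs; [exact: int_measurable (ias xi)|exact: int_abs|].
  by move=> x; rewrite normrM ler_piMr// sin1_le1.
have iw n : int (fun xi => w (e_ n) xi * (C a xi ^+ 2 + S a xi ^+ 2)).
  apply: (int_mulb (integrable_exp_abs (e0 n)) (M := A ^+ 2 + A ^+ 2)) => // xi.
  rewrite ger0_norm// lerD//.
    by rewrite -[leLHS]ger0_norm ?sqr_ge0// normrX ler_sqr ?nnegrE// (le_trans _ (Cb xi)).
  by rewrite -[leLHS]ger0_norm ?sqr_ge0// normrX ler_sqr ?nnegrE// (le_trans _ (Sb xi)).
(* the weights increase to 1 *)
have L : (\int[mu]_xi (w (e_ n) xi * (C a xi ^+ 2 + S a xi ^+ 2))%:E)%E @[n --> \oo]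
   --> (\int[mu]_xi (C a xi ^+ 2 + S a xi ^+ 2)%:E)%E.
  have -> : (\int[mu]_xi (C a xi ^+ 2 + S a xi ^+ 2)%:E =
      \int[mu]_xi limn (fun n => (w (e_ n) xi * (C a xi ^+ 2 + S a xi ^+ 2))%:E))%E.
    apply: eq_integral => xi _; apply/esym/cvg_lim => //.
    apply: cvg_EFin; first exact: nearW.
    rewrite -[X in _ --> X]mul1r; apply: cvgMr_tmp.
    rewrite -expR0 -oppr0 -(mul0r `|xi|).
    apply: (@cvg_comp _ _ _ (fun n => - (e_ n * `|xi|)) expR); last exact: continuous_expR.
    apply: cvgN; apply: cvgMr_tmp.
    rewrite -(mulr0 (2 * pi)); apply: cvgMl_tmp; exact: cvg_harmonic.
  apply: cvg_monotone_convergence => //.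
  - by move=> n; apply/measurable_EFinP; exact: mw.
  - by move=> n xi _; rewrite lee_fin mulr_ge0// expR_ge0.
  - move=> xi _ n m nm; rewrite lee_fin ler_wpM2r// ler_expR lerN2 ler_wpM2r//.
    rewrite /e_ ler_wpM2l//; first by rewrite mulr_ge0// pi_ge0.
    by rewrite lef_pV2 ?posrE ?ltr0n// ler_nat.
(* the Poisson averages of the translation defect vanish *)
have J : (Rintegral mu setT (j (e_ n)))%:E @[n --> \oo] --> 0%E.
  rewrite (_ : (fun n => _) = fun n => (\int[mu]_u ((cauchy_density u / pi)%:E *
     translation_defect a (n.+1%:R^-1 * u)%R))%E); last first.
    by apply/funext => n; rewrite (integral_j (e0 n)); apply: eq_integral => u _; rewrite E_.
  have -> : 0%E = (\int[mu]_y (cst 0%E y) : \bar R)%E by rewrite integral0.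
  have cp0 (u : R) : 0 <= cauchy_density u / pi.
    by rewrite divr_ge0 ?pi_ge0// cauchy_ge0.
  have mcp : measurable_fun setT (fun u : RT => cauchy_density u / pi).
    by apply: measurable_funM => //; exact: measurable_cauchy.
  apply: (@dominated_cvg _ _ _ mu setT measurableT _ _
     (fun u => (4 * A2 * (cauchy_density u / pi))%:E)) => //.
  - move=> n; apply: emeasurable_funM; first exact/measurable_EFinP.
    apply: (measurableT_comp md (g := fun u : RT => n.+1%:R^-1 * u : RT)).
    exact: measurable_funM.
  - move=> u _; rewrite /cst -(mule0 (cauchy_density u / pi)%:E).
    apply: cvgeZl => //.
    apply: (@L2_translation_continuous _ _ _ `|u|) => //.
      by rewrite -(mul0r u); apply: cvgMr_tmp; exact: cvg_harmonic.
    move=> n; rewrite normrM ler_piMl// ger0_norm ?invr_ge0//.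
    by rewrite invf_le1// ler1n.
  - apply: (@intZ _ _ _ _ _ (fun u : RT => cauchy_density u / pi)).
    apply/ge0_intP => //.
    under eq_integral do rewrite EFinM muleC.
    rewrite ge0_integralZl//; last 3 first.
    + apply/measurable_EFinP; exact: measurable_cauchy.
    + by move=> u _; rewrite lee_fin cauchy_ge0.
    + by rewrite lee_fin invr_ge0 pi_ge0.
    by rewrite integral_cauchy -EFinM ltry.
  - move=> n u _ /=; rewrite gee0_abs; last first.
      by rewrite mule_ge0 ?lee_fin// translation_defect_ge0.
    by rewrite [X in (_ <= X)%E]EFinM muleC lee_pmul ?translation_defect_ge0// lee_fin.
apply: (@cvg_unique _ (@ereal_hausdorff R) _ _ _ _ L).
rewrite (_ : (fun n => _) = fun n => (A2%:E - (2^-1)%:E *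
    (Rintegral mu setT (j (e_ n)))%:E)%E); last first.
  apply/funext => n; rewrite -EFin_Rintegral// weighted_energyE//.
  by rewrite -EFinM -EFinB mulrC.
rewrite -EFin_Rintegral// -/A2.
suff : (A2%:E - (2^-1)%:E * (Rintegral mu setT (j (e_ n)))%:E)%E @[n --> \oo]
    --> (A2%:E - (2^-1)%:E * 0)%E by rewrite mule0 sube0.
by apply: cvgeB => //; [exact: cvg_cst | exact: cvgeZl].
Qed.

End fixed_function.
End plancherel1.

Section plancherel1_complex.
Context {R : realType}.
Local Notation mu := (@lebesgue_measure R).
Local Notation RT := (measurableTypeR R).

Lemma double_ereal_inj (x : \bar R) (r : R) :
  (0 <= x)%E -> (x + x = (r + r)%:E)%E -> x = r%:E.
Proof.
by case: x => [x| |] //= _ [xr]; congr EFin; move: xr; lra.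
Qed.

Lemma transformD d (T : measurableType d) (m : {measure set T -> \bar R})
    (k : T -> T -> R) (a b : T -> R) xi :
  measurable_fun setT (fun x => k x xi) -> (forall x, `|k x xi| <= 1) ->
  m.-integrable setT (EFin \o a) -> m.-integrable setT (EFin \o b) ->
  transform m k (fun x => a x + b x) xi = transform m k a xi + transform m k b xi.
Proof.
move=> mk kb ai bi; rewrite /transform -RintegralD//; [|exact: (int_mulb ai mk kb)|exact: (int_mulb bi mk kb)].
by apply: eq_Rintegral => x _; rewrite mulrDl.
Qed.

Lemma transformZ d (T : measurableType d) (m : {measure set T -> \bar R})
    (k : T -> T -> R) (r : R) (a : T -> R) xi :
  measurable_fun setT (fun x => k x xi) -> (forall x, `|k x xi| <= 1) ->
  m.-integrable setT (EFin \o a) ->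
  transform m k (fun x => r * a x) xi = r * transform m k a xi.
Proof.
move=> mk kb ai; rewrite /transform -RintegralZl//; last exact: (int_mulb ai mk kb).
by apply: eq_Rintegral => x _; rewrite mulrA.
Qed.

Lemma transformB d (T : measurableType d) (m : {measure set T -> \bar R})
    (k : T -> T -> R) (a b : T -> R) xi :
  measurable_fun setT (fun x => k x xi) -> (forall x, `|k x xi| <= 1) ->
  m.-integrable setT (EFin \o a) -> m.-integrable setT (EFin \o b) ->
  transform m k (fun x => a x - b x) xi = transform m k a xi - transform m k b xi.
Proof.
move=> mk kb ai bi; have := transformD mk kb ai (intZ (-1) bi).
by rewrite transformZ// mulN1r; under [X in transform _ _ X]eq_fun do rewrite mulN1r.
Qed.

(** Reduction to real functions: the cosine transform is even and the sine
    transform is odd, so that adding the energies at xi and - xi cancels the mixed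
    terms of [a] and [b]. *)
Lemma plancherel1 : plancherel mu (@cos1 R) (@sin1 R).
Proof.
move=> a b ai bi a2i b2i.
have ma := int_measurable ai; have mb := int_measurable bi.
have mca := measurable_transform mu measurable_cos1 ma.
have msa := measurable_transform mu measurable_sin1 ma.
have mcb := measurable_transform mu measurable_cos1 mb.
have msb := measurable_transform mu measurable_sin1 mb.
set Ca := transform mu cos1 a in mca *; set Sa := transform mu sin1 a in msa *.
set Cb := transform mu cos1 b in mcb *; set Sb := transform mu sin1 b in msb *.
pose F (xi : RT) := (Ca xi + Sb xi) ^+ 2 + (Cb xi - Sa xi) ^+ 2.
have mF : measurable_fun setT F.
  apply: measurable_funD; apply: measurable_funX; first exact: measurable_funD.
  exact: measurable_funB.
have F0 xi : (0 <= (F xi)%:E)%E by rewrite lee_fin addr_ge0 ?sqr_ge0.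
have q0 (f : RT -> R) xi : (0 <= (f xi ^+ 2)%:E)%E by rewrite lee_fin sqr_ge0.
have CN (f : RT -> R) xi : transform mu cos1 f (- xi) = transform mu cos1 f xi.
  by apply: eq_Rintegral => x _; rewrite /cos1 !mulrN cosN.
have SN (f : RT -> R) xi : mu.-integrable setT (EFin \o f) ->
    transform mu sin1 f (- xi) = - transform mu sin1 f xi.
  move=> fi; rewrite -[RHS]mulN1r /transform -RintegralZl//.
    by apply: eq_Rintegral => x _; rewrite /sin1 !mulrN sinN; ring.
  apply: (int_mulb fi (M := 1)) => [|x]; last exact: sin1_le1.
  exact: (measurable_section2 xi measurable_sin1).
rewrite [RHS](_ : _ = (Rintegral mu setT (fun x => a x ^+ 2) +
    Rintegral mu setT (fun x => b x ^+ 2))%:E); last first.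
  under eq_integral do rewrite EFinD.
  rewrite ge0_integralD//; [|exact: measurable_sqr|exact: measurable_sqr].
  by rewrite EFinD !EFin_Rintegral.
rewrite -[LHS]/(\int[mu]_xi (F xi)%:E)%E.
apply: double_ereal_inj; first by apply: integral_ge0 => xi _; exact: F0.
rewrite -[X in (_ + X)%E = _]ge0_integral_opp//; last exact/measurable_EFinP.
rewrite -ge0_integralD//; last 2 first.
- exact/measurable_EFinP.
- apply/measurable_EFinP; apply: (measurableT_comp mF (g := fun x : RT => - x : RT)).
  exact: measurable_opp.
transitivity (\int[mu]_xi (2%:E * ((Ca xi ^+ 2 + Sa xi ^+ 2)%:E +
    (Cb xi ^+ 2 + Sb xi ^+ 2)%:E)))%E.
  apply: eq_integral => xi _; rewrite -!EFinD -EFinM; congr EFin.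
  by rewrite /F /Ca /Sa /Cb /Sb !CN !SN//; ring.
have e0 (f g : RT -> R) xi : (0 <= (f xi ^+ 2 + g xi ^+ 2)%:E)%E.
  by rewrite lee_fin addr_ge0 ?sqr_ge0.
rewrite ge0_integralZl//; last 2 first.
- by apply: emeasurable_funD; exact: measurable_sqrD.
- by move=> xi _; rewrite adde_ge0.
rewrite ge0_integralD//; [|exact: measurable_sqrD|exact: measurable_sqrD].
rewrite !plancherel1_real// -!EFin_Rintegral// -EFinD -EFinM; congr EFin; ring.
Qed.

End plancherel1_complex.

(** * Plancherel's identity on R^d *)

Section plancherel_product.
Context {R : realType} d1 d2 (T1 : measurableType d1) (T2 : measurableType d2).
Context (m1 : {sigma_finite_measure set T1 -> \bar R})
        (m2 : {sigma_finite_measure set T2 -> \bar R}).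
Local Notation mkern k := (measurable_fun setT (fun p => k p.1 p.2)).
Variables (c1 s1 : T1 -> T1 -> R) (c2 s2 : T2 -> T2 -> R).
Hypotheses (mc1 : mkern c1)
  (ms1 : mkern s1)
  (mc2 : mkern c2)
  (ms2 : mkern s2)
  (c1b : forall x y, `|c1 x y| <= 1) (s1b : forall x y, `|s1 x y| <= 1)
  (c2b : forall x y, `|c2 x y| <= 1) (s2b : forall x y, `|s2 x y| <= 1)
  (P1 : plancherel m1 c1 s1) (P2 : plancherel m2 c2 s2).
Local Notation m := (m1 \x m2)%E.
Local Notation T := (T1 * T2)%type.
Local Notation int f := (m.-integrable setT (EFin \o f)).
Local Notation int1 f := (m1.-integrable setT (EFin \o f)).

(** Real and imaginary part of the product of the characters c1 + i s1 and
    c2 + i s2. *)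
Definition prod_cos (x xi : T) := c1 x.1 xi.1 * c2 x.2 xi.2 - s1 x.1 xi.1 * s2 x.2 xi.2.
Definition prod_sin (x xi : T) := s1 x.1 xi.1 * c2 x.2 xi.2 + c1 x.1 xi.1 * s2 x.2 xi.2.

Lemma Rintegral_prod (F : T -> R) : int (F) ->
  Rintegral m setT F = Rintegral m1 setT (fun x => Rintegral m2 setT (fun y => F (x, y))).
Proof.
move=> Fi; have mF := int_measurable Fi.
rewrite /Rintegral -(integral12_prod_meas1 Fi); congr fine.
apply: ae_eq_integral => //.
- exact: (measurable_fubini_F Fi).
- by apply/measurable_EFinP; exact: (measurable_Rintegral m2 mF).
- have := ae_integrable1 Fi; apply: filterS => x xi _.
  by rewrite /fubini_F fineK// integrable_fin_num.
Qed.

Let transform2 (k : T2 -> T2 -> R) (a : T -> R) (p : T1 * T2) : R :=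
  transform m2 k (fun y => a (p.1, y)) p.2.

Let mpart k a : mkern k ->
  measurable_fun setT a -> measurable_fun setT (transform2 k a).
Proof.
move=> mk ma; apply: (measurable_Rintegral m2
  (F := fun q : (T1 * T2) * T2 => a (q.1.1, q.2) * k q.2 q.1.2)).
apply: measurable_funM.
  apply: (measurableT_comp ma (g := fun q : (T1 * T2) * T2 => (q.1.1, q.2))).
  apply: measurable_fun_pair => //.
  by apply: measurableT_comp => //; exact: measurable_fst.
apply: (measurableT_comp mk (g := fun q : (T1 * T2) * T2 => (q.2, q.1.2))).
apply: measurable_fun_pair => //.
by apply: measurableT_comp => //; exact: measurable_snd.
Qed.

Let ipk (k : T2 -> T2 -> R) (a : T -> R) (xi2 : T2) : mkern k ->
  (forall x y, `|k x y| <= 1) -> int a ->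
  int (fun x : T => a x * k x.2 xi2).
Proof.
move=> mk kb ai; apply: (int_mulb ai (M := 1)) => //.
exact: (measurableT_comp (measurable_section2 xi2 mk)).
Qed.

Let ipart (k : T2 -> T2 -> R) (a : T -> R) (xi2 : T2) : mkern k ->
  (forall x y, `|k x y| <= 1) -> int a ->
  int1 (fun x => transform2 k a (x, xi2)).
Proof. by move=> mk kb ai; exact: (integrable_Rintegral (ipk xi2 mk kb ai)). Qed.

Let split (k : T1 -> T1 -> R) (l : T2 -> T2 -> R) a (xi : T) :
  mkern k ->
  mkern l ->
  (forall x y, `|k x y| <= 1) -> (forall x y, `|l x y| <= 1) ->
  int a ->
  int (fun x : T => a x * (k x.1 xi.1 * l x.2 xi.2)) /\
  Rintegral m setT (fun x => a x * (k x.1 xi.1 * l x.2 xi.2)) =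
  transform m1 k (fun x => transform2 l a (x, xi.2)) xi.1.
Proof.
move=> mk ml kb lb ai.
have i1 : int (fun x : T => a x * (k x.1 xi.1 * l x.2 xi.2)).
  apply: (int_mulb ai (M := 1)).
    apply: measurable_funM.
      exact: (measurableT_comp (measurable_section2 xi.1 mk)).
    exact: (measurableT_comp (measurable_section2 xi.2 ml)).
  by move=> x; rewrite normrM mulr_ile1.
split=> //; rewrite Rintegral_prod//.
have mx (x : T1) : measurable_fun setT (fun y => a (x, y) * l y xi.2).
  have := int_measurable (ipk xi.2 ml lb ai).
  by move=> /(measurable_section1 x).
rewrite /Rintegral; congr fine; apply: ae_eq_integral => //.
- apply/measurable_EFinP.
  exact: (measurable_Rintegral m2 (int_measurable i1)).
- apply/measurable_EFinP; apply: measurable_funM.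
    exact: (measurable_section2 xi.2 (mpart ml (int_measurable ai))).
  exact: (measurable_section2 xi.1 mk).
- have := ae_integrable1 (ipk xi.2 ml lb ai); apply: filterS => x ix _.
  congr EFin; rewrite -/(Rintegral m2 setT _) /transform2 /transform mulrC -RintegralZl//.
  by apply: eq_Rintegral => y _ /=; ring.
Qed.

(** Plancherel's identity is applied in the second variable for almost every
    value of the first, and then in the first variable to the partial transforms
    p + i q, for almost every frequency xi2. The latter requires these to be
    square integrable in the first variable, which holds for almost every xi2
    because the total energy is finite. *)
Lemma plancherel_prod : plancherel m prod_cos prod_sin.
Proof.
move=> a b ai bi a2i b2i.
have ma := int_measurable ai; have mb := int_measurable bi.
pose p (z : T1 * T2) := transform2 c2 a z + transform2 s2 b z.
pose q (z : T1 * T2) := transform2 c2 b z - transform2 s2 a z.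
have mp : measurable_fun setT p by apply: measurable_funD; exact: mpart.
have mq : measurable_fun setT q by apply: measurable_funB; exact: mpart.
have ip xi2 : int1 (fun x => p (x, xi2)).
  exact: (intD (ipart xi2 mc2 c2b ai) (ipart xi2 ms2 s2b bi)).
have iq xi2 : int1 (fun x => q (x, xi2)).
  exact: (intB (ipart xi2 mc2 c2b bi) (ipart xi2 ms2 s2b ai)).
pose P (xi : T) := transform m1 c1 (fun x => p (x, xi.2)) xi.1 +
  transform m1 s1 (fun x => q (x, xi.2)) xi.1.
pose Q (xi : T) := transform m1 c1 (fun x => q (x, xi.2)) xi.1 -
  transform m1 s1 (fun x => p (x, xi.2)) xi.1.
have cosE (f : T -> R) xi : int f -> transform m prod_cos f xi =
    transform m1 c1 (fun x => transform2 c2 f (x, xi.2)) xi.1 -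
    transform m1 s1 (fun x => transform2 s2 f (x, xi.2)) xi.1.
  move=> fi; have [j1 <-] := split xi mc1 mc2 c1b c2b fi.
  have [j2 <-] := split xi ms1 ms2 s1b s2b fi.
  by rewrite -RintegralB//; apply: eq_Rintegral => x _; rewrite mulrBr.
have sinE (f : T -> R) xi : int f -> transform m prod_sin f xi =
    transform m1 s1 (fun x => transform2 c2 f (x, xi.2)) xi.1 +
    transform m1 c1 (fun x => transform2 s2 f (x, xi.2)) xi.1.
  move=> fi; have [j1 <-] := split xi ms1 mc2 s1b c2b fi.
  have [j2 <-] := split xi mc1 ms2 c1b s2b fi.
  by rewrite -RintegralD//; apply: eq_Rintegral => x _; rewrite mulrDr.
have mk1 (k : T1 -> T1 -> R) xi : mkern k ->
    measurable_fun setT (fun x => k x xi) by exact: measurable_section2.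
transitivity (\int[m]_xi (P xi ^+ 2 + Q xi ^+ 2)%:E)%E.
  apply: eq_integral => xi _; congr EFin; congr (_ ^+ 2 + _ ^+ 2).
    rewrite cosE// sinE// /P transformD//; [|exact: mk1|exact: ipart|exact: ipart].
    by rewrite transformB//; [ring|exact: mk1|exact: ipart|exact: ipart].
  rewrite cosE// sinE// /Q transformB//; [|exact: mk1|exact: ipart|exact: ipart].
  by rewrite transformD//; [ring|exact: mk1|exact: ipart|exact: ipart].
have mtr (k : T1 -> T1 -> R) (f : T -> R) : mkern k ->
    measurable_fun setT f ->
    measurable_fun setT (fun xi : T => transform m1 k (fun x => f (x, xi.2)) xi.1).
  move=> mk mf; apply: (measurable_Rintegral m1
    (F := fun z : (T1 * T2) * T1 => f (z.2, z.1.2) * k z.2 z.1.1)).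
  apply: measurable_funM.
    apply: (measurableT_comp mf (g := fun q : (T1 * T2) * T1 => (q.2, q.1.2))).
    apply: measurable_fun_pair => //.
    by apply: measurableT_comp => //; exact: measurable_snd.
  apply: (measurableT_comp mk (g := fun q : (T1 * T2) * T1 => (q.2, q.1.1))).
  apply: measurable_fun_pair => //.
  by apply: measurableT_comp => //; exact: measurable_fst.
have mP : measurable_fun setT P by apply: measurable_funD; exact: mtr.
have mQ : measurable_fun setT Q by apply: measurable_funB; exact: mtr.
have mpq := measurable_sqrD mp mq; have mPQ := measurable_sqrD mP mQ; have mab := measurable_sqrD ma mb.
have sq0 (x y : R) : (0 <= (x ^+ 2 + y ^+ 2)%:E)%E.
  by rewrite lee_fin addr_ge0 ?sqr_ge0.
rewrite (fubini_tonelli2 (fun xi => (P xi ^+ 2 + Q xi ^+ 2)%:E))//.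
rewrite (fubini_tonelli1 (fun x => (a x ^+ 2 + b x ^+ 2)%:E))//.
rewrite /fubini_F /fubini_G.
have E1 : (\int[m1]_x \int[m2]_y (p (x, y) ^+ 2 + q (x, y) ^+ 2)%:E =
    \int[m1]_x \int[m2]_y (a (x, y) ^+ 2 + b (x, y) ^+ 2)%:E)%E.
  apply: ae_eq_integral => //.
  - exact: (measurable_fun_fubini_tonelli_F _ mpq).
  - exact: (measurable_fun_fubini_tonelli_F _ mab).
  - have h1 := ae_integrable1 ai; have h2 := ae_integrable1 bi.
    have h3 := ae_integrable1 a2i; have h4 := ae_integrable1 b2i.
    apply: filterS (filterI (filterI h1 h2) (filterI h3 h4)) => x [[j1 j2] [j3 j4]] _.
    exact: (P2 j1 j2 j3 j4).
have E2 := fubini_tonelli (m1 := m1) (m2 := m2)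
  (fun z => (p z ^+ 2 + q z ^+ 2)%:E) mpq (fun z => sq0 _ _).
rewrite -E1 E2; apply: ae_eq_integral; first by [].
- exact: (measurable_fun_fubini_tonelli_G _ mPQ).
- exact: (measurable_fun_fubini_tonelli_G _ mpq).
have fin : (\int[m2]_y \int[m1]_x (p (x, y) ^+ 2 + q (x, y) ^+ 2)%:E < +oo)%E.
  rewrite -E2 E1 -(fubini_tonelli1 (fun x => (a x ^+ 2 + b x ^+ 2)%:E))//.
  have := intD a2i b2i; move=> /ge0_intP; apply.
    by apply: measurable_funD; exact: measurable_funX.
  by move=> x; rewrite addr_ge0 ?sqr_ge0.
have : m2.-integrable setT (fun y => \int[m1]_x (p (x, y) ^+ 2 + q (x, y) ^+ 2)%:E)%E.
  apply/integrableP; split.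
    exact: (measurable_fun_fubini_tonelli_G _ mpq).
  under eq_integral do rewrite gee0_abs ?integral_ge0//.
  exact: fin.
move=> /(integrable_ae measurableT); apply: filterS => xi2 /(_ I) fin2 _.
have mp2 : measurable_fun setT (fun x => p (x, xi2)) by exact: measurable_section2.
have mq2 : measurable_fun setT (fun x => q (x, xi2)) by exact: measurable_section2.
have i2 (f g : T1 -> R) : measurable_fun setT f -> measurable_fun setT g ->
    (\int[m1]_x (f x ^+ 2 + g x ^+ 2)%:E)%E \is a fin_num ->
    int1 (fun x => f x ^+ 2).
  move=> mf mg fg; apply: (@int_le _ _ _ _ _ (fun x => f x ^+ 2 + g x ^+ 2)).
  - exact: measurable_funX.
  - by move=> x; rewrite ger0_norm ?sqr_ge0// lerDl sqr_ge0.
  - apply/ge0_intP.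
    + by apply: measurable_funD; exact: measurable_funX.
    + by move=> x; rewrite addr_ge0 ?sqr_ge0.
    + by rewrite -ge0_fin_numE ?integral_ge0.
apply: (P1 (ip xi2) (iq xi2)).
- exact: i2 mp2 mq2 fin2.
- by apply: i2 mq2 mp2 _; under eq_integral do rewrite addrC.
Qed.

End plancherel_product.

Section image_measure.
Context {R : realType} d1 d2 (X : measurableType d1) (Y : measurableType d2).
Context (m : {measure set X -> \bar R}) (m' : {sigma_finite_measure set Y -> \bar R}).
Variable phi : X -> Y.
Hypotheses (mphi : measurable_fun setT phi)
  (mE : forall A, measurable A -> m' A = pushforward m phi A).

Lemma ge0_integral_image (f : Y -> \bar R) : measurable_fun setT f ->
  (forall y, 0 <= f y)%E -> (\int[m']_y f y = \int[m]_x f (phi x))%E.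
Proof.
move=> mf f0.
pose nu : {measure set Y -> \bar R} := pushforward m phi.
rewrite (eq_measure_integral (nu mphi)).
  by rewrite ge0_integral_pushforward.
by move=> A mA _; exact: mE.
Qed.

Lemma integrable_image (f : Y -> R) : m'.-integrable setT (EFin \o f) ->
  m.-integrable setT (EFin \o (f \o phi)).
Proof.
move=> fi; have mf := int_measurable fi.
apply/integrableP; split; first by apply/measurable_EFinP; exact: measurableT_comp.
have /integrableP[_] := fi.
rewrite ge0_integral_image//.
by apply/measurable_EFinP; exact: measurableT_comp.
Qed.

Lemma Rintegral_image (f : Y -> R) : m'.-integrable setT (EFin \o f) ->
  Rintegral m' setT f = Rintegral m setT (f \o phi).
Proof.
move=> fi; rewrite /Rintegral; congr fine.
pose nu : {measure set Y -> \bar R} := pushforward m phi.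
rewrite (eq_measure_integral (nu mphi)).
  rewrite integral_pushforward//.
    by apply/measurable_EFinP; exact: int_measurable fi.
  exact: integrable_image.
by move=> A mA _; exact: mE.
Qed.

Lemma plancherel_image (c s : X -> X -> R) (c' s' : Y -> Y -> R) :
  measurable_fun setT (fun p : Y * Y => c' p.1 p.2) ->
  measurable_fun setT (fun p : Y * Y => s' p.1 p.2) ->
  (forall x y, `|c' x y| <= 1) -> (forall x y, `|s' x y| <= 1) ->
  (forall x xi, c' (phi x) (phi xi) = c x xi) ->
  (forall x xi, s' (phi x) (phi xi) = s x xi) ->
  plancherel m c s -> plancherel m' c' s'.
Proof.
move=> mc ms cb sb cE sE P a b ai bi a2i b2i.
have ma := int_measurable ai; have mb := int_measurable bi.
have tE k' k (f : Y -> R) x : measurable_fun setT (fun p : Y * Y => k' p.1 p.2) ->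
    (forall x y, `|k' x y : R| <= 1) -> (forall x xi, k' (phi x) (phi xi) = k x xi) ->
    m'.-integrable setT (EFin \o f) ->
    transform m' k' f (phi x) = transform m k (f \o phi) x.
  move=> mk kb kE fi; rewrite /transform Rintegral_image.
    by apply: eq_Rintegral => y _ /=; rewrite kE.
  by apply: (int_mulb fi (M := 1)) => //; exact: measurable_section2 mk.
rewrite ge0_integral_image; last 2 first.
- apply/measurable_EFinP; apply: measurable_funD; apply: measurable_funX.
    by apply: measurable_funD; exact: measurable_transform.
  by apply: measurable_funB; exact: measurable_transform.
- by move=> y; rewrite lee_fin addr_ge0 ?sqr_ge0.
rewrite ge0_integral_image; last 2 first.
- by apply/measurable_EFinP; apply: measurable_funD; exact: measurable_funX.
- by move=> y; rewrite lee_fin addr_ge0 ?sqr_ge0.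
rewrite -(P (a \o phi) (b \o phi)).
- by apply: eq_integral => x _; rewrite !(tE c' c)// !(tE s' s).
- exact: integrable_image.
- exact: integrable_image.
- exact: (integrable_image a2i).
- exact: (integrable_image b2i).
Qed.

End image_measure.

Section euclidean.
Context {R : realType}.
Local Notation RT := (measurableTypeR R).
Local Notation E n := ('rV[R]_n).
Local Notation mu := (@lebesgue_measure R).

Lemma measurable_cons n : measurable_fun setT (@cons_rV R n).
Proof. exact: measurable_cons_rV. Qed.

Lemma lebesgue_rVS n (A : set (E n.+1)) : measurable A ->
  lebesgue_rV n.+1 A =
  pushforward (mu \x @lebesgue_rV R n)%E (@cons_rV R n) A.
Proof. by []. Qed.

Lemma dotE_cons n (p q : RT * E n) :
  dotE (cons_rV p) (cons_rV q) = p.1 * q.1 + dotE p.2 q.2.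
Proof.
rewrite /dotE big_ord_recl !cons_rV_head; congr (_ + _).
by apply: eq_bigr => i _; rewrite !cons_rV_tail.
Qed.

Lemma measurable_dotE n : measurable_fun setT (fun p : E n * E n => dotE p.1 p.2).
Proof.
apply: measurable_sum => k; apply: measurable_funM.
  exact: (measurableT_comp (measurable_coor k)).
exact: (measurableT_comp (measurable_coor k)).
Qed.

Definition cosd n (x xi : E n) : R := cos (2 * pi * dotE x xi).
Definition sind n (x xi : E n) : R := sin (2 * pi * dotE x xi).

Lemma measurable_cosd n : measurable_fun setT (fun p : E n * E n => cosd p.1 p.2).
Proof.
apply: (measurableT_comp (f := cos : RT -> RT)); first exact: measurable_cos.
by apply: measurable_funM => //; exact: measurable_dotE.
Qed.

Lemma measurable_sind n : measurable_fun setT (fun p : E n * E n => sind p.1 p.2).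
Proof.
apply: (measurableT_comp (f := sin : RT -> RT)); first exact: measurable_sin.
by apply: measurable_funM => //; exact: measurable_dotE.
Qed.

Lemma cosd_le1 n (x y : E n) : `|cosd x y| <= 1.
Proof. by rewrite ler_norml cos_geN1 cos_le1. Qed.
Lemma sind_le1 n (x y : E n) : `|sind x y| <= 1.
Proof. by rewrite ler_norml sin_geN1 sin_le1. Qed.

Lemma integral_rV0 (f : E 0 -> \bar R) : measurable_fun setT f ->
  (\int[lebesgue_rV 0]_x f x = f 0%R)%E.
Proof.
move=> mf; rewrite (eq_measure_integral (@dirac _ (E 0) 0 R))//.
by rewrite integral_dirac// diracT mul1e.
Qed.

Lemma plancherel_rV n : plancherel (@lebesgue_rV R n) (@cosd n) (@sind n).
Proof.
elim: n => [|n IH].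
  move=> a b ai bi a2i b2i.
  have ma := int_measurable ai; have mb := int_measurable bi.
  have tC (f : E 0 -> R) xi : measurable_fun setT f ->
      transform (lebesgue_rV 0) (@cosd 0) f xi = f 0.
    move=> mf; rewrite /transform /Rintegral integral_rV0/=.
      by rewrite /cosd /dotE big_ord0 mulr0 cos0 mulr1.
    apply/measurable_EFinP; apply: measurable_funM => //.
    exact: (measurable_section2 xi (@measurable_cosd 0)).
  have tS (f : E 0 -> R) xi : measurable_fun setT f ->
      transform (lebesgue_rV 0) (@sind 0) f xi = 0.
    move=> mf; rewrite /transform /Rintegral integral_rV0/=.
      by rewrite /sind /dotE big_ord0 mulr0 sin0 mulr0.
    apply/measurable_EFinP; apply: measurable_funM => //.
    exact: (measurable_section2 xi (@measurable_sind 0)).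
  under eq_integral do rewrite !tC// !tS// addr0 subr0.
  rewrite !integral_rV0//.
  by apply/measurable_EFinP; apply: measurable_funD; exact: measurable_funX.
apply: (plancherel_image (@measurable_cons n) (@lebesgue_rVS n)
  (c := prod_cos (@cos1 R) (@sin1 R) (@cosd n) (@sind n))
  (s := prod_sin (@cos1 R) (@sin1 R) (@cosd n) (@sind n))).
- exact: measurable_cosd.
- exact: measurable_sind.
- exact: cosd_le1.
- exact: sind_le1.
- by move=> x xi; rewrite /cosd dotE_cons mulrDr cosD.
- by move=> x xi; rewrite /sind dotE_cons mulrDr sinD.
- apply: plancherel_prod => //.
  + exact: measurable_cos1.
  + exact: measurable_sin1.
  + exact: measurable_cosd.
  + exact: measurable_sind.
  + exact: cos1_le1.
  + exact: sin1_le1.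
  + exact: cosd_le1.
  + exact: sind_le1.
  + exact: plancherel1.
Qed.

Lemma measurable_reflect n (k : 'I_n) :
  measurable_fun setT (reflect_coord k : E n -> E n).
Proof.
apply: measurable_fun_rVP => i.
rewrite [X in measurable_fun _ X](_ : _ = fun x : E n =>
  if i == k then - (x 0 i : RT) else x 0 i); last first.
  by apply/funext => x; rewrite mxE.
case: (i == k); last exact: measurable_coor.
apply: (measurableT_comp (f := fun x : RT => - x : RT)); last exact: measurable_coor.
exact: measurable_opp.
Qed.

Lemma ge0_integral_reflect n (k : 'I_n) (f : E n -> \bar R) :
  measurable_fun setT f -> (forall x, 0 <= f x)%E ->
  (\int[lebesgue_rV n]_x f (reflect_coord k x) = \int[lebesgue_rV n]_x f x)%E.
Proof.
elim: n k f => [[]//|n IH] k f mf f0.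
have mfr : measurable_fun setT (fun x => f (reflect_coord k x)).
  exact: (measurableT_comp mf (measurable_reflect k)).
rewrite !(ge0_integral_image (@measurable_cons n) (@lebesgue_rVS n))//.
have mg : measurable_fun setT (fun p : RT * E n => f (cons_rV p)).
  exact: (measurableT_comp mf (@measurable_cons n)).
have mgr : measurable_fun setT (fun p : RT * E n => f (reflect_coord k (cons_rV p))).
  exact: (measurableT_comp mfr (@measurable_cons n)).
case: (unliftP ord0 k) => [j kE|kE].
  have cE x y : reflect_coord k (cons_rV (x, y) : E n.+1) = cons_rV (x, reflect_coord j y).
    apply/rowP => i; rewrite mxE; case: (unliftP ord0 i) => [i' ->|->].
      rewrite !cons_rV_tail mxE kE (inj_eq lift_inj).
      by case: (i' == j).
    by rewrite !cons_rV_head kE (negPf (neq_lift _ _)).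
  rewrite (fubini_tonelli1 (fun p => f (reflect_coord k (cons_rV p))) mgr (fun p => f0 _)).
  rewrite (fubini_tonelli1 (fun p => f (cons_rV p)) mg (fun p => f0 _)).
  apply: eq_integral => x _; rewrite /fubini_F.
  under eq_integral do rewrite cE.
  rewrite (IH j (fun y => f (cons_rV (x, y))))//.
  exact: (measurable_section1 x mg).
have cE x y : reflect_coord k (cons_rV (x, y) : E n.+1) = cons_rV (- x : RT, y).
  apply/rowP => i; rewrite mxE; case: (unliftP ord0 i) => [i' ->|->].
    by rewrite !cons_rV_tail kE eq_sym (negPf (neq_lift _ _)).
  by rewrite !cons_rV_head kE eqxx.
rewrite (fubini_tonelli2 (fun p => f (reflect_coord k (cons_rV p))) mgr (fun p => f0 _)).
rewrite (fubini_tonelli2 (fun p => f (cons_rV p)) mg (fun p => f0 _)).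
apply: eq_integral => y _; rewrite /fubini_G.
under eq_integral do rewrite cE.
rewrite (ge0_integral_opp (f := fun x : RT => f (cons_rV (x, y))))//.
exact: (measurable_section2 y mg).
Qed.

Lemma hyperplane_null n (k : 'I_n) : lebesgue_rV n [set x : E n | x 0 k = 0] = 0%E.
Proof.
have mH m (j : 'I_m) : measurable [set x : E m | x 0 j = 0].
  rewrite -[X in measurable X]setTI.
  exact: (measurable_coor j _ (@measurable_set1 R 0)).
elim: n k => [[]//|n IH] k.
rewrite lebesgue_rVS//.
case: (unliftP ord0 k) => [j kE|kE].
  rewrite /pushforward (_ : _ @^-1` _ = setT `*` [set y : E n | y 0 j = 0]).
    rewrite product_measure1E//; last exact: (mH n j).
    by rewrite [X in (_ * X)%E](IH j) mule0.
  by apply/seteqP; split => p /=; rewrite kE cons_rV_tail; [|case].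
rewrite /pushforward (_ : _ @^-1` _ = [set 0 : RT] `*` setT).
  rewrite product_measure1E//.
  by rewrite [X in (X * _)%E]lebesgue_measure_set1 mul0e.
by apply/seteqP; split => p /=; rewrite kE cons_rV_head; [|case].
Qed.

End euclidean.

(** * Complex-valued square integrable functions *)

Section complex_L2.
Context {R : realType} {d : nat}.
Local Notation E := 'rV[R]_d.
Local Notation C := R[i].
Local Notation mu := (@lebesgue_rV R d).
Local Notation re := complex.Re.
Local Notation im := complex.Im.
Local Notation nr := Normc.normc.
Implicit Types (f g h u : E -> C) (x xi : E) (z : C).

Lemma normc_sqr z : nr z ^+ 2 = re z ^+ 2 + im z ^+ 2.
Proof. by case: z => a b /=; rewrite sqr_sqrtr// addr_ge0 ?sqr_ge0. Qed.

Lemma normc_ge0 z : 0 <= nr z.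
Proof. by case: z => a b; exact: sqrtr_ge0. Qed.

Lemma ReM (z w : C) : re (z * w) = re z * re w - im z * im w.
Proof. by case: z w => a b [c e]. Qed.
Lemma ImM (z w : C) : im (z * w) = re z * im w + im z * re w.
Proof. by case: z w => a b [c e]. Qed.
Lemma ReD (z w : C) : re (z + w) = re z + re w.
Proof. by case: z w => a b [c e]. Qed.
Lemma ImD (z w : C) : im (z + w) = im z + im w.
Proof. by case: z w => a b [c e]. Qed.
Lemma ReN (z : C) : re (- z) = - re z. Proof. by case: z. Qed.
Lemma ImN (z : C) : im (- z) = - im z. Proof. by case: z. Qed.
Definition ReImE := (ReM, ImM, ReD, ImD, ReN, ImN).

Lemma complexE z w : re z = re w -> im z = im w -> z = w.
Proof. by case: z w => a b [c e] /= -> ->. Qed.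

Lemma cmeasurableD f g : cmeasurable f -> cmeasurable g ->
  cmeasurable (fun x => f x + g x).
Proof.
move=> [f1 f2] [g1 g2]; split.
  by under eq_fun do rewrite ReD; exact: measurable_funD.
by under eq_fun do rewrite ImD; exact: measurable_funD.
Qed.

Lemma cmeasurableM f g : cmeasurable f -> cmeasurable g ->
  cmeasurable (fun x => f x * g x).
Proof.
move=> [f1 f2] [g1 g2]; split.
  by under eq_fun do rewrite ReM; apply: measurable_funB; exact: measurable_funM.
by under eq_fun do rewrite ImM; apply: measurable_funD; exact: measurable_funM.
Qed.

Lemma cmeasurable_cst z : cmeasurable (fun _ : E => z).
Proof. by split; exact: measurable_cst. Qed.

Lemma cmeasurableB f g : cmeasurable f -> cmeasurable g ->
  cmeasurable (fun x => f x - g x).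
Proof.
move=> mf mg; have := cmeasurableD mf (cmeasurableM (cmeasurable_cst (-1)) mg).
by under eq_fun do rewrite mulN1r.
Qed.

Lemma cmeasurable_real (c : E -> R) : measurable_fun setT c ->
  cmeasurable (fun x => (c x)%:C%C).
Proof. by move=> mc; split => //=; exact: measurable_cst. Qed.

Lemma measurable_sqnorm f : cmeasurable f ->
  measurable_fun setT (fun x => (nr (f x) ^+ 2)%:E).
Proof.
move=> [f1 f2]; under eq_fun do rewrite normc_sqr.
by apply/measurable_EFinP; apply: measurable_funD; exact: measurable_funX.
Qed.

Lemma measurable_normc f : cmeasurable f -> measurable_fun setT (fun x => nr (f x)).
Proof.
move=> mf; have mf2 := measurable_sqnorm mf.
have -> : (fun x => nr (f x)) = (fun x => Num.sqrt (nr (f x) ^+ 2)).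
  by apply/funext => x; rewrite sqrtr_sqr ger0_norm// normc_ge0.
apply: (measurableT_comp (f := Num.sqrt : measurableTypeR R -> measurableTypeR R)).
  by apply: continuous_measurable_fun; exact: sqrt_continuous.
exact/measurable_EFinP.
Qed.

Lemma sqnormL2_ge0 f : (0 <= sqnormL2 f)%E.
Proof. by apply: integral_ge0 => x _; rewrite lee_fin sqr_ge0. Qed.

Lemma sqnormL2_int f : L2 f -> mu.-integrable setT (EFin \o (fun x => nr (f x) ^+ 2)).
Proof.
move=> [mf fo]; apply/ge0_intP => //; first by apply/measurable_EFinP; exact: measurable_sqnorm.
by move=> x; rewrite sqr_ge0.
Qed.

Lemma L2_Re f : L2 f -> mu.-integrable setT (EFin \o (fun x => re (f x) ^+ 2)).
Proof.
move=> fL; apply: int_le (sqnormL2_int fL).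
  by apply: measurable_funX; exact: fL.1.1.
by move=> x; rewrite ger0_norm ?sqr_ge0// normc_sqr lerDl sqr_ge0.
Qed.

Lemma L2_Im f : L2 f -> mu.-integrable setT (EFin \o (fun x => im (f x) ^+ 2)).
Proof.
move=> fL; apply: int_le (sqnormL2_int fL).
  by apply: measurable_funX; exact: fL.1.2.
by move=> x; rewrite ger0_norm ?sqr_ge0// normc_sqr lerDr sqr_ge0.
Qed.

Lemma sqnormL2_le f g (c : R) : 0 <= c -> cmeasurable f -> cmeasurable g ->
  (forall x, nr (f x) ^+ 2 <= c * nr (g x) ^+ 2) ->
  (sqnormL2 f <= c%:E * sqnormL2 g)%E.
Proof.
move=> c0 mf mg fg; rewrite /sqnormL2.
have <- : (\int[mu]_x (c%:E * (nr (g x) ^+ 2)%:E) = c%:E * \int[mu]_x (nr (g x) ^+ 2)%:E)%E.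
  rewrite ge0_integralZl//; first exact: measurable_sqnorm.
  by move=> x _; rewrite lee_fin sqr_ge0.
apply: ge0_le_integral => //.
- by move=> x _; rewrite lee_fin sqr_ge0.
- exact: measurable_sqnorm.
- by apply: measurable_funeM; exact: measurable_sqnorm.
- by move=> x _; rewrite -EFinM lee_fin.
Qed.

(** A small t makes the weight of z close to 1, whence the continuity of the
    squared norm; t = 1 is enough to show that something tends to 0. *)
Lemma normc_sqrD_le (z w : C) (t : R) : 0 < t ->
  nr (z + w) ^+ 2 <= (1 + t) * nr z ^+ 2 + (1 + t^-1) * nr w ^+ 2.
Proof.
move=> t0; rewrite !normc_sqr ReD ImD.
have key (a b : R) : (a + b) ^+ 2 <= (1 + t) * a ^+ 2 + (1 + t^-1) * b ^+ 2.
  rewrite -subr_ge0.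
  have -> : (1 + t) * a ^+ 2 + (1 + t^-1) * b ^+ 2 - (a + b) ^+ 2 =
    t * (a - t^-1 * b) ^+ 2 by field; rewrite gt_eqF.
  by rewrite mulr_ge0 ?sqr_ge0// ltW.
have := key (re z) (re w); have := key (im z) (im w); lra.
Qed.

Lemma sqnormL2D_le f g (t : R) : 0 < t -> cmeasurable f -> cmeasurable g ->
  (sqnormL2 (fun x => f x + g x)%R <=
   (1 + t)%:E * sqnormL2 f + (1 + t^-1)%:E * sqnormL2 g)%E.
Proof.
move=> t0 mf mg.
have t1 : 0 <= 1 + t by rewrite addr_ge0// ltW.
have t2 : 0 <= 1 + t^-1 by rewrite addr_ge0// invr_ge0 ltW.
rewrite /sqnormL2.
have Z (c : R) h : 0 <= c -> cmeasurable h ->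
    (c%:E * \int[mu]_x (nr (h x) ^+ 2)%:E = \int[mu]_x (c%:E * (nr (h x) ^+ 2)%:E))%E.
  move=> c0 mh; rewrite ge0_integralZl//; first exact: measurable_sqnorm.
  by move=> x _; rewrite lee_fin sqr_ge0.
rewrite !Z//.
rewrite -ge0_integralD//; last 4 first.
- by move=> x _; rewrite mule_ge0 ?lee_fin// sqr_ge0.
- by apply: measurable_funeM; exact: measurable_sqnorm.
- by move=> x _; rewrite mule_ge0 ?lee_fin// sqr_ge0.
- by apply: measurable_funeM; exact: measurable_sqnorm.
apply: ge0_le_integral => //.
- by move=> x _; rewrite lee_fin sqr_ge0.
- by apply: measurable_sqnorm; exact: cmeasurableD.
- by apply: emeasurable_funD; apply: measurable_funeM; exact: measurable_sqnorm.
- by move=> x _; rewrite -!EFinM -EFinD lee_fin; exact: normc_sqrD_le.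
Qed.

Lemma sqnormL2_sub f g : sqnormL2 (fun x => f x - g x) = sqnormL2 (fun x => g x - f x).
Proof.
apply: eq_integral => x _; congr EFin.
by rewrite !normc_sqr !ReImE; ring.
Qed.

Lemma L2D f g : L2 f -> L2 g -> L2 (fun x => f x + g x).
Proof.
move=> [mf fo] [mg go]; split; first exact: cmeasurableD.
apply: (le_lt_trans (sqnormL2D_le ltr01 mf mg)).
by rewrite lte_add_pinfty// lte_mul_pinfty// ?lee_fin ?addr_ge0// ?invr_ge0.
Qed.

Lemma L2_mul_bounded f (c : E -> C) (M : R) : cmeasurable c -> (forall x, nr (c x) <= M) ->
  L2 f -> L2 (fun x => c x * f x).
Proof.
move=> mc cM [mf fo]; split; first exact: cmeasurableM.
have M0 : 0 <= M by rewrite (le_trans (normc_ge0 _) (cM 0)).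
apply: (@le_lt_trans _ _ ((M ^+ 2)%:E * sqnormL2 f)%E).
  apply: sqnormL2_le => //; [by rewrite sqr_ge0|exact: cmeasurableM|].
  move=> x; rewrite Normc.normcM exprMn ler_wpM2r ?sqr_ge0//.
  by rewrite ler_sqr ?nnegrE// normc_ge0.
by rewrite lte_mul_pinfty// lee_fin sqr_ge0.
Qed.

Lemma L2Z z f : L2 f -> L2 (fun x => z * f x).
Proof.
by apply: (L2_mul_bounded (M := nr z)); first exact: cmeasurable_cst.
Qed.

Lemma L2B f g : L2 f -> L2 g -> L2 (fun x => f x - g x).
Proof.
move=> fL gL; have := L2D fL (L2Z (-1) gL).
by under eq_fun do rewrite mulN1r.
Qed.

Lemma L2_0 : L2 (fun _ : E => 0 : C).
Proof.
split; first exact: cmeasurable_cst.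
rewrite /sqnormL2 (eq_integral (fun=> 0%E)) ?integral0 ?ltry// => x _.
by rewrite normc_sqr/= expr0n addr0.
Qed.

Lemma L2_sum (I : Type) (r : seq I) (F : I -> E -> C) :
  (forall i, L2 (F i)) -> L2 (fun x => \sum_(i <- r) F i x).
Proof.
move=> mF; elim: r => [|i r IH].
  by under eq_fun do rewrite big_nil; exact: L2_0.
by under eq_fun do rewrite big_cons; exact: L2D.
Qed.

(** [sqnormL2D_le] is used in both directions, with t small compared to the
    tolerance and to the norm of u. *)
Lemma sqnormL2_cvg (u_ : nat -> E -> C) u : (forall n, cmeasurable (u_ n)) -> L2 u ->
  sqnormL2 (fun x => u_ n x - u x) @[n --> \oo] --> 0%E ->
  sqnormL2 (u_ n) @[n --> \oo] --> sqnormL2 u.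
Proof.
move=> mu_ [mu_u uo] /cvge0_le-/(_ (fun n => sqnormL2_ge0 _)) h.
have ufin : sqnormL2 u \is a fin_num by rewrite ge0_fin_numE ?sqnormL2_ge0.
have mD n := cmeasurableB (mu_ n) mu_u.
have mD' n := cmeasurableB mu_u (mu_ n).
set s := fine (sqnormL2 u).
have s0 : 0 <= s by rewrite fine_ge0 ?sqnormL2_ge0.
have up n t : 0 < t -> (sqnormL2 (u_ n) <=
    (1 + t)%:E * sqnormL2 u + (1 + t^-1)%:E * sqnormL2 (fun x => u_ n x - u x)%R)%E.
  move=> t0; have := sqnormL2D_le t0 mu_u (mD n).
  by under [X in (sqnormL2 X <= _)%E -> _]eq_fun do rewrite addrC subrK.
have lo n t : 0 < t -> (sqnormL2 u <=
    (1 + t)%:E * sqnormL2 (u_ n) + (1 + t^-1)%:E * sqnormL2 (fun x => u_ n x - u x)%R)%E.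
  move=> t0; have := sqnormL2D_le t0 (mu_ n) (mD' n); rewrite (sqnormL2_sub u).
  by under [X in (sqnormL2 X <= _)%E -> _]eq_fun do rewrite addrC subrK.
rewrite -(fineK ufin); apply/fine_cvgP; split.
  have := h 1 ltr01; apply: filterS => n hn.
  rewrite ge0_fin_numE ?sqnormL2_ge0//.
  apply: (le_lt_trans (up n 1 ltr01)).
  rewrite lte_add_pinfty// lte_mul_pinfty// ?lee_fin ?addr_ge0// ?invr_ge0 ?sqnormL2_ge0//.
  exact: le_lt_trans hn (ltry _).
apply/cvgrPdist_le => e e0.
pose t := Num.min 1 (e / (4 * (s + 1))).
have s1 : 0 < 4 * (s + 1) by rewrite mulr_gt0// ltr_wpDl.
have t0 : 0 < t by rewrite lt_min ltr01 divr_gt0.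
have ts : t * (s + 1) <= e / 4.
  rewrite -ler_pdivlMr ?ltr_wpDl//.
  rewrite /t ge_min; apply/orP; right.
  by rewrite invfM mulrA.
have t1 : t <= 1 by rewrite /t ge_min lexx.
have b0 : 0 < 1 + t^-1 by rewrite ltr_wpDr// invr_ge0 ltW.
pose e' := Num.min 1 (e / 8) / (1 + t^-1).
have e'0 : 0 < e' by rewrite divr_gt0// lt_min ltr01 divr_gt0.
have := h e' e'0; apply: filterS => n hn /=.
have := up n t t0; have := lo n t t0; have rn := sqnormL2_ge0 (u_ n).
have rd := sqnormL2_ge0 (fun x => u_ n x - u x).
move: hn rn rd; rewrite -(fineK ufin) -/s.
case: (sqnormL2 (fun x => u_ n x - u x)) => [r| |]//.
rewrite !lee_fin => re' + r0.
have b1 : (1 + t^-1) * r <= Num.min 1 (e / 8).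
  by rewrite -ler_pdivlMl// mulrC.
have b2 : (1 + t^-1) * r <= e / 8 by rewrite (le_trans b1)// ge_min lexx orbT.
have b3 : (1 + t^-1) * r <= 1 by rewrite (le_trans b1)// ge_min lexx.
case: (sqnormL2 (u_ n)) => [q| |]//=.
rewrite -!EFinM -!EFinD !lee_fin => q0 l1 l2.
have tq : t * q <= t * ((1 + t) * s + 1) by rewrite ler_pM2l// (le_trans l2)// lerD2l.
have tq' : t * ((1 + t) * s + 1) <= 2 * (t * (s + 1)).
  rewrite mulrCA ler_pM2l//.
  have : t * s <= s by rewrite ler_piMl.
  lra.
have ts' : t * s <= t * (s + 1) by rewrite ler_pM2l// lerDl.
by rewrite ler_norml; apply/andP; split; lra.
Qed.

End complex_L2.

(** * Fourier multipliers *)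

Section fourier.
Context {R : realType} {d : nat}.
Local Notation E := 'rV[R]_d.
Local Notation C := R[i].
Local Notation mu := (@lebesgue_rV R d).
Local Notation re := complex.Re.
Local Notation im := complex.Im.
Local Notation nr := Normc.normc.
Implicit Types (f g h u : E -> C) (x xi : E) (z : C).
Local Notation int f := (mu.-integrable setT (EFin \o f)).

Lemma normc_Re z : `|re z| <= nr z.
Proof.
by rewrite -ler_sqr ?nnegrE ?normc_ge0// normc_sqr real_normK ?num_real// lerDl sqr_ge0.
Qed.

Lemma normc_Im z : `|im z| <= nr z.
Proof.
by rewrite -ler_sqr ?nnegrE ?normc_ge0// normc_sqr real_normK ?num_real// lerDr sqr_ge0.
Qed.

Lemma L1_normc f : L1 f -> int (fun x => nr (f x)).
Proof.
move=> [mf fo]; apply/ge0_intP => //; first exact: measurable_normc.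
by move=> x; exact: normc_ge0.
Qed.

Lemma L1_Re f : L1 f -> int (fun x => re (f x)).
Proof.
move=> fL; apply: int_le (L1_normc fL); first exact: fL.1.1.
by move=> x; exact: normc_Re.
Qed.

Lemma L1_Im f : L1 f -> int (fun x => im (f x)).
Proof.
move=> fL; apply: int_le (L1_normc fL); first exact: fL.1.2.
by move=> x; exact: normc_Im.
Qed.

Lemma L1_le f (g : E -> R) : cmeasurable f -> int g -> (forall x, nr (f x) <= g x) -> L1 f.
Proof.
move=> mf gi fg; split=> //; apply/ge0_intP.
- exact: measurable_normc.
- by move=> x; exact: normc_ge0.
- apply: int_le gi; first exact: measurable_normc.
  by move=> x; rewrite ger0_norm// normc_ge0.
Qed.

Lemma L1D f g : L1 f -> L1 g -> L1 (fun x => f x + g x).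
Proof.
move=> fL gL; apply: (L1_le _ (intD (L1_normc fL) (L1_normc gL))).
  by apply: cmeasurableD; [exact: fL.1|exact: gL.1].
by move=> x; exact: le_normcD.
Qed.

Lemma L1_mul_bounded f (c : E -> C) (M : R) : cmeasurable c -> (forall x, nr (c x) <= M) ->
  L1 f -> L1 (fun x => c x * f x).
Proof.
move=> mc cM fL; apply: (L1_le _ (intZ M (L1_normc fL))).
  by apply: cmeasurableM => //; exact: fL.1.
by move=> x; rewrite Normc.normcM ler_wpM2r// normc_ge0.
Qed.

Lemma L1Z (z : C) (f : E -> C) : L1 f -> L1 (fun x => z * f x).
Proof.
by apply: (L1_mul_bounded (c := fun=> z) (M := nr z)) => //; exact: cmeasurable_cst.
Qed.

Lemma L1B f g : L1 f -> L1 g -> L1 (fun x => f x - g x).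
Proof. by move=> fL gL; have := L1D fL (L1Z (-1) gL); under eq_fun do rewrite mulN1r. Qed.

Lemma L2_mul_L1 f g : L2 f -> L2 g -> L1 (fun x => f x * g x).
Proof.
move=> fL gL.
apply: (L1_le _ (intD (sqnormL2_int fL) (sqnormL2_int gL))).
  by apply: cmeasurableM; [exact: fL.1|exact: gL.1].
move=> x; rewrite Normc.normcM -subr_ge0.
have := sqr_ge0 (nr (f x) - nr (g x)).
by have := mulr_ge0 (normc_ge0 (f x)) (normc_ge0 (g x)); lra.
Qed.

Local Notation Tc := (transform mu (@cosd R d)).
Local Notation Ts := (transform mu (@sind R d)).

Lemma int_cosd (a : E -> R) xi : int a -> int (fun x => a x * cosd x xi).
Proof.
move=> ai; apply: (int_mulb ai (M := 1)) => [|x]; last exact: cosd_le1.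
exact: (measurable_section2 xi (@measurable_cosd R d)).
Qed.

Lemma int_sind (a : E -> R) xi : int a -> int (fun x => a x * sind x xi).
Proof.
move=> ai; apply: (int_mulb ai (M := 1)) => [|x]; last exact: sind_le1.
exact: (measurable_section2 xi (@measurable_sind R d)).
Qed.

Lemma fourierL1E f xi : L1 f -> fourierL1 f xi =
  Complex (Tc (fun x => re (f x)) xi + Ts (fun x => im (f x)) xi)
          (Tc (fun x => im (f x)) xi - Ts (fun x => re (f x)) xi).
Proof.
move=> fL; have ai := L1_Re fL; have bi := L1_Im fL.
rewrite /fourierL1 /cintegral; congr Complex.
  rewrite -RintegralD//; [|exact: int_cosd|exact: int_sind].
  apply: eq_Rintegral => x _; rewrite ReM /= cosN sinN /cosd /sind; ring.
rewrite -RintegralB//; [|exact: int_cosd|exact: int_sind].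
apply: eq_Rintegral => x _; rewrite ImM /= cosN sinN /cosd /sind; ring.
Qed.

(** The real form [plancherel_rV] of the identity, for the real and imaginary
    parts of f. *)
Lemma plancherel_fourier f : L1 f -> L2 f -> sqnormL2 (fourierL1 f) = sqnormL2 f.
Proof.
move=> fL fL2.
transitivity (\int[mu]_xi
   ((Tc (fun x => re (f x)) xi + Ts (fun x => im (f x)) xi) ^+ 2 +
    (Tc (fun x => im (f x)) xi - Ts (fun x => re (f x)) xi) ^+ 2)%:E)%E.
  by apply: eq_integral => xi _; rewrite fourierL1E// normc_sqr.
rewrite plancherel_rV; [|exact: L1_Re|exact: L1_Im|exact: L2_Re|exact: L2_Im].
by apply: eq_integral => x _; rewrite normc_sqr.
Qed.

Lemma cmeasurable_fourierL1 f : L1 f -> cmeasurable (fourierL1 f).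
Proof.
move=> fL; have ma := int_measurable (L1_Re fL); have mb := int_measurable (L1_Im fL).
have mc := measurable_cosd (R := R) (n := d); have ms := measurable_sind (R := R) (n := d).
split.
  under eq_fun do rewrite fourierL1E//=.
  by apply: measurable_funD; exact: measurable_transform.
under eq_fun do rewrite fourierL1E//=.
by apply: measurable_funB; exact: measurable_transform.
Qed.

Lemma fourierL1D (f g : E -> C) xi : L1 f -> L1 g ->
  fourierL1 (fun x => f x + g x) xi = fourierL1 f xi + fourierL1 g xi.
Proof.
move=> fL gL.
have fr := L1_Re fL; have fi := L1_Im fL; have gr := L1_Re gL; have gi := L1_Im gL.
have mc := measurable_section2 xi (@measurable_cosd R d).
have ms := measurable_section2 xi (@measurable_sind R d).
have cb x := @cosd_le1 R d x xi; have sb x := @sind_le1 R d x xi.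
rewrite !fourierL1E//; last exact: L1D.
apply: complexE; rewrite ReImE /=.
  under [X in Tc X]eq_fun do rewrite !ReImE; under [X in Ts X]eq_fun do rewrite !ReImE.
  by rewrite !transformD//; ring.
under [X in Tc X]eq_fun do rewrite !ReImE; under [X in Ts X]eq_fun do rewrite !ReImE.
by rewrite !transformD//; ring.
Qed.

Lemma fourierL1Z (z : C) (f : E -> C) xi : L1 f ->
  fourierL1 (fun x => z * f x) xi = z * fourierL1 f xi.
Proof.
move=> fL.
have fr := L1_Re fL; have fi := L1_Im fL.
have mc := measurable_section2 xi (@measurable_cosd R d).
have ms := measurable_section2 xi (@measurable_sind R d).
have cb x := @cosd_le1 R d x xi; have sb x := @sind_le1 R d x xi.
rewrite !fourierL1E//; last exact: L1Z.
have -> : (fun x => re (z * f x)) = (fun x => re z * re (f x) + - im z * im (f x)).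
  by apply/funext => x; rewrite ReM mulNr.
have -> : (fun x => im (z * f x)) = (fun x => re z * im (f x) + im z * re (f x)).
  by apply/funext => x; rewrite ImM.
have fr' r := intZ r fr; have fi' r := intZ r fi.
by rewrite !transformD ?transformZ//; apply: complexE; rewrite ?ReM ?ImM /=; ring.
Qed.

Lemma fourierL1B f g xi : L1 f -> L1 g ->
  fourierL1 (fun x => f x - g x) xi = fourierL1 f xi - fourierL1 g xi.
Proof.
move=> fL gL; have := fourierL1D xi fL (L1Z (-1) gL).
by rewrite fourierL1Z// mulN1r; under [X in fourierL1 X]eq_fun do rewrite mulN1r.
Qed.

Let normcM2 (z w : C) : nr (z * w) ^+ 2 = nr z ^+ 2 * nr w ^+ 2.
Proof. by rewrite Normc.normcM exprMn. Qed.

(* Multiplication by an unbounded symbol w is not continuous on L_2, but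
   multiplication by its truncations is. *)
Let trunc (w : E -> C) (K : nat) xi : C :=
  w xi * (\1_[set xi | nr (w xi) <= K%:R] xi : R)%:C%C.

Let mset (w : E -> C) (K : nat) : cmeasurable w ->
  measurable [set xi | nr (w xi) <= K%:R].
Proof.
move=> mw; rewrite -[X in measurable X]setTI.
apply: (@measurable_fun_le _ _ R setT (fun x => nr (w x)) (cst K%:R)) => //.
exact: measurable_normc.
Qed.

Let mtrunc w K : cmeasurable w -> cmeasurable (trunc w K).
Proof.
move=> mw; apply: cmeasurableM => //; apply: cmeasurable_real.
by apply: measurable_indic; exact: mset.
Qed.

Let nr_real (r : R) : nr r%:C%C ^+ 2 = r ^+ 2.
Proof. by rewrite normc_sqr/= expr0n addr0. Qed.

Let truncE w K xi : nr (trunc w K xi) ^+ 2 =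
  nr (w xi) ^+ 2 * \1_[set xi | nr (w xi) <= K%:R] xi.
Proof.
rewrite /trunc Normc.normcM exprMn nr_real indicE.
by case: (_ \in _); rewrite ?expr1n ?expr0n.
Qed.

Let trunc_le w K xi : nr (trunc w K xi) ^+ 2 <= nr (w xi) ^+ 2.
Proof.
rewrite truncE indicE; case: (_ \in _); rewrite ?mulr1 ?mulr0//.
by rewrite sqr_ge0.
Qed.

Let trunc_leK w K xi : nr (trunc w K xi) ^+ 2 <= K%:R ^+ 2.
Proof.
rewrite truncE indicE; case: (boolP (_ \in _)) => [|_]; last by rewrite mulr0 sqr_ge0.
by rewrite inE/= mulr1 => h; rewrite ler_sqr ?nnegrE// normc_ge0.
Qed.

Let sqnormL2_trunc w v (c : R) : cmeasurable w -> cmeasurable v ->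
  (forall K, (sqnormL2 (fun xi => trunc w K xi * v xi)%R <= c%:E)%E) ->
  (sqnormL2 (fun xi => w xi * v xi)%R <= c%:E)%E.
Proof.
move=> mw mv h; rewrite /sqnormL2.
have L : (\int[mu]_xi (nr (trunc w n xi * v xi) ^+ 2)%:E)%E @[n --> \oo] -->
    (\int[mu]_xi (nr (w xi * v xi) ^+ 2)%:E)%E.
  have -> : (\int[mu]_xi (nr (w xi * v xi) ^+ 2)%:E =
      \int[mu]_xi limn (fun n => (nr (trunc w n xi * v xi) ^+ 2)%:E))%E.
    apply: eq_integral => xi _; apply/esym/cvg_lim => //.
    apply: cvg_near_cst; near=> n.
    rewrite (normcM2 (trunc w n xi)) (normcM2 (w xi)) truncE indicE mem_set ?mulr1//=.
    by near: n; exact: nbhs_infty_ger.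
  apply: cvg_monotone_convergence => //.
  - by move=> n; apply: measurable_sqnorm; apply: cmeasurableM => //; exact: mtrunc.
  - by move=> n xi _; rewrite lee_fin sqr_ge0.
  - move=> xi _ n m nm; rewrite lee_fin (normcM2 (trunc w n xi)) (normcM2 (trunc w m xi)) ler_wpM2r ?sqr_ge0//.
    rewrite !truncE ler_wpM2l ?sqr_ge0// !indicE.
    case: (boolP (xi \in [set xi | nr (w xi) <= n%:R])) => [|_]; last by case: (_ \in _).
    rewrite inE/= => nK; rewrite mem_set//=.
    by rewrite (le_trans nK)// ler_nat.
rewrite -(cvg_lim _ L)//; apply: lime_le; first by apply/cvg_ex; eexists; exact: L.
by apply: nearW => n; exact: h.
Unshelve. all: by end_near. Qed.

(** By Plancherel's identity the functions w * fourierL1 (h_ n), being the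
    transforms of [U_ n], form a Cauchy sequence; along [h_] the transforms
    converge to [fhat]. Multiplication by [w] is a closed operator, which
    identifies the limit as w * fhat. *)
Lemma fourier_multiplier f fhat w (h_ U_ : nat -> E -> C) U :
  is_fourierL2 f fhat -> cmeasurable w -> L2 U ->
  (forall n, L1 (h_ n) /\ L2 (h_ n)) -> (forall n, L1 (U_ n) /\ L2 (U_ n)) ->
  sqnormL2 (fun x => h_ n x - f x) @[n --> \oo] --> 0%E ->
  sqnormL2 (fun x => U_ n x - U x) @[n --> \oo] --> 0%E ->
  (forall n xi, fourierL1 (U_ n) xi = w xi * fourierL1 (h_ n) xi) ->
  sqnormL2 (fun xi => w xi * fhat xi) = sqnormL2 U.
Proof.
move=> [fhL fh] mw UL hL UnL hf UU FU.
have := fh h_ hL hf.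
move=> /cvge0_le-/(_ (fun n => sqnormL2_ge0 _)) Hf.
have mH n : cmeasurable (fourierL1 (h_ n)) by exact: cmeasurable_fourierL1 (hL n).1.
have mS n : cmeasurable (fun xi => w xi * fourierL1 (h_ n) xi) by exact: cmeasurableM.
have mfh : cmeasurable fhat := fhL.1.
have SU n : sqnormL2 (fun xi => w xi * fourierL1 (h_ n) xi) = sqnormL2 (U_ n).
  rewrite -(plancherel_fourier (UnL n).1 (UnL n).2).
  by apply: eq_integral => xi _; rewrite FU.
have Sd n m : sqnormL2 (fun xi => w xi * (fourierL1 (h_ n) xi - fourierL1 (h_ m) xi)) =
    sqnormL2 (fun x => U_ n x - U_ m x).
  rewrite -(@plancherel_fourier (fun x => U_ n x - U_ m x)); last 2 first.
  - by apply: L1B; [exact: (UnL n).1|exact: (UnL m).1].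
  - by apply: L2B; [exact: (UnL n).2|exact: (UnL m).2].
  apply: eq_integral => xi _; rewrite fourierL1B; [|exact: (UnL n).1|exact: (UnL m).1].
  by rewrite !FU mulrBr.
move: (UU) => /cvge0_le-/(_ (fun n => sqnormL2_ge0 _)) Ud.
have Sf : sqnormL2 (fun xi => w xi * fourierL1 (h_ n) xi - w xi * fhat xi)
    @[n --> \oo] --> 0%E.
  apply/cvge0_le => [n|e e0]; first exact: sqnormL2_ge0.
  have e16 : 0 < e / 16 by rewrite divr_gt0.
  apply: filterS (Ud _ e16) => n Un.
  rewrite (_ : (fun _ => _) = fun xi => w xi * (fourierL1 (h_ n) xi - fhat xi)); last first.
    by apply/funext => xi; rewrite mulrBr.
  apply: sqnormL2_trunc => //; first exact: cmeasurableB.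
  move=> K.
  have K0 : 0 < e / (4 * K.+1%:R ^+ 2) by rewrite divr_gt0// mulr_gt0// exprn_gt0.
  near \oo => m.
  have Um : (sqnormL2 (fun x => U_ m x - U x)%R <= (e / 16)%:E)%E by near: m; exact: Ud.
  have Hm : (sqnormL2 (fun x => fourierL1 (h_ m) x - fhat x)%R <= (e / (4 * K.+1%:R ^+ 2))%:E)%E.
    by near: m; exact: Hf.
  have Unm : (sqnormL2 (fun x => (U_ n x - U_ m x)%R) <= (e / 4)%:E)%E.
    have := sqnormL2D_le ltr01 (L2B (UnL n).2 UL).1 (L2B UL (UnL m).2).1.
    under [X in (sqnormL2 X <= _)%E -> _]eq_fun do rewrite addrA subrK.
    move=> /le_trans; apply; rewrite (sqnormL2_sub U) invr1.
    have -> : e / 4 = (1 + 1) * (e / 16) + (1 + 1) * (e / 16) by field.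
    by rewrite (EFinD ((1 + 1) * _)) !EFinM; apply: leeD; apply: lee_wpmul2l => //; rewrite lee_fin.
  have mT : cmeasurable (fun xi => trunc w K xi) by exact: mtrunc.
  have m1 : cmeasurable (fun xi => trunc w K xi * (fourierL1 (h_ n) xi - fourierL1 (h_ m) xi)).
    by apply: cmeasurableM => //; exact: cmeasurableB.
  have m2 : cmeasurable (fun xi => trunc w K xi * (fourierL1 (h_ m) xi - fhat xi)).
    by apply: cmeasurableM => //; exact: cmeasurableB.
  have := sqnormL2D_le ltr01 m1 m2.
  under [X in (sqnormL2 X <= _)%E -> _]eq_fun do rewrite -mulrDr addrA subrK.
  move=> /le_trans; apply; rewrite invr1.
  have B1 : (sqnormL2 (fun xi => (trunc w K xi * (fourierL1 (h_ n) xi - fourierL1 (h_ m) xi))%R)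
      <= (e / 4)%:E)%E.
    apply: le_trans Unm; rewrite -Sd -[X in (_ <= X)%E]mul1e.
    apply: sqnormL2_le => //; first by apply: cmeasurableM => //; exact: cmeasurableB.
    by move=> xi; rewrite mul1r (normcM2 (trunc w K xi)) (normcM2 (w xi)) ler_wpM2r ?sqr_ge0.
  have B2 : (sqnormL2 (fun xi => (trunc w K xi * (fourierL1 (h_ m) xi - fhat xi))%R)
      <= (e / 4)%:E)%E.
    apply: (@le_trans _ _ ((K.+1%:R ^+ 2)%:E * sqnormL2 (fun xi => (fourierL1 (h_ m) xi - fhat xi)%R))%E).
      apply: sqnormL2_le => //; [exact: cmeasurableB|].
      move=> xi; rewrite normcM2 ler_wpM2r ?sqr_ge0//.
      rewrite (le_trans (trunc_leK _ _ _))// ler_sqr ?nnegrE//.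
      by rewrite ler_nat.
    apply: (@le_trans _ _ ((K.+1%:R ^+ 2)%:E * (e / (4 * K.+1%:R ^+ 2))%:E)%E).
      by apply: lee_wpmul2l => //; rewrite lee_fin sqr_ge0.
    rewrite -EFinM lee_fin le_eqVlt; apply/orP; left; apply/eqP; field.
    by rewrite nat1r pnatr_eq0.
  have -> : e = (1 + 1) * (e / 4) + (1 + 1) * (e / 4) by field.
  by rewrite (EFinD ((1 + 1) * _)) !EFinM; apply: leeD; apply: lee_wpmul2l => //; rewrite lee_fin.
have Fin : L2 (fun xi => w xi * fhat xi).
  have {}Sf := Sf; move/cvge0_le : (Sf) => /(_ (fun n => sqnormL2_ge0 _))/(_ 1 ltr01) h.
  near \oo => n.
  have hn : (sqnormL2 (fun xi => (w xi * fourierL1 (h_ n) xi - w xi * fhat xi)%R) <= 1%:E)%E.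
    by near: n; exact: h.
  have mwf : cmeasurable (fun xi => w xi * fhat xi) by exact: cmeasurableM.
  have L2a : L2 (fun xi => w xi * fourierL1 (h_ n) xi).
    by split => //; rewrite SU; exact: (UnL n).2.2.
  have L2b : L2 (fun xi => w xi * fourierL1 (h_ n) xi - w xi * fhat xi).
    split; [exact: cmeasurableB|exact: le_lt_trans hn (ltry _)].
  have := L2B L2a L2b.
  by under eq_fun do rewrite opprB addrC subrK.
have A1 := sqnormL2_cvg mS Fin Sf.
have A2 := sqnormL2_cvg (fun n => (UnL n).2.1) UL UU.
have SUE : (fun n => sqnormL2 (fun xi => w xi * fourierL1 (h_ n) xi)) =
  (fun n => sqnormL2 (U_ n)) by apply/funext => n; exact: SU.
rewrite SUE in A1.
exact: (@cvg_unique _ (@ereal_hausdorff R) _ _ _ _ A1 A2).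
Unshelve. all: by end_near. Qed.

End fourier.

(** * Smooth functions *)

Section flat.
Context {R : realType}.
Implicit Types (p : {poly R}) (x y : R).

(** The derivative of x |-> p(1/x) exp(-1/x), extended by 0 to x <= 0, is of the
    same form, with [flat_step p] in place of p. *)
Definition flat p x : R := if 0 < x then p.[x^-1] * expR (- x^-1) else 0.

Lemma exprn_mul_expRN_le n y : 0 <= y -> y ^+ n * expR (- y) <= n`!%:R.
Proof.
move=> y0; rewrite expRN ler_pdivrMr ?expR_gt0//.
case: n => [|n]; first by rewrite expr0 fact0 mul1r -expR0 ler_expR.
have := expR_ge1Dxn n y0.
have f0 : 0 < (n.+1)`!%:R :> R by rewrite ltr0n fact_gt0.
rewrite -(ler_pM2l f0) => /(le_trans _); apply.
by rewrite mulrDr mulr1 mulrCA mulfV ?gt_eqF// mulr1 lerDr ltW.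
Qed.

Lemma poly_mul_expRN_bounded p : exists2 M : R, 0 <= M &
  forall y, 0 <= y -> `|p.[y] * expR (- y)| <= M.
Proof.
exists (\sum_(i < size p) `|p`_i| * i`!%:R).
  by apply: sumr_ge0 => i _; rewrite mulr_ge0.
move=> y y0; rewrite horner_coef mulr_suml.
apply: (le_trans (ler_norm_sum _ _ _)); apply: ler_sum => i _.
rewrite -mulrA normrM ler_wpM2l// ger0_norm.
  exact: exprn_mul_expRN_le.
by rewrite mulr_ge0 ?exprn_ge0// expR_ge0.
Qed.

Lemma flat_bounded p : exists2 M : R, 0 <= M & forall x, `|flat p x| <= M.
Proof.
have [M M0 H] := poly_mul_expRN_bounded p; exists M => // x.
rewrite /flat; case: ifPn => [x0|_]; last by rewrite normr0.
by apply: H; rewrite invr_ge0 ltW.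
Qed.

(** This bound gives the derivative 0 at the origin. *)
Lemma flat_le_sqr p : exists2 M : R, 0 <= M & forall x, `|flat p x| <= M * x ^+ 2.
Proof.
have [M M0 H] := poly_mul_expRN_bounded ('X^2 * p); exists M => // x.
rewrite /flat; case: ifPn => [x0|_]; last by rewrite normr0 mulr_ge0 ?sqr_ge0.
have x1 : 0 <= x^-1 by rewrite invr_ge0 ltW.
have := H _ x1; rewrite hornerM hornerXn -mulrA normrM ger0_norm ?exprn_ge0//.
by rewrite exprVn mulrC ler_pdivrMr ?exprn_gt0.
Qed.

Definition flat_step p : {poly R} := 'X^2 * (p - p^`()).

Lemma is_derive_flat p x : is_derive x 1 (flat p) (flat (flat_step p) x).
Proof.
have [x0|x0|x0] := ltgtP x 0.
- rewrite [X in is_derive _ _ _ X]/flat ltNge (ltW x0)/=.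
  apply: (@near_eq_is_derive _ _ _ (cst 0)).
  near=> z; rewrite /flat ltNge (_ : z <= 0)//.
  by apply: ltW; near: z; exact: lt_nbhsl.
- have dV : is_derive x 1 (fun y : R => y^-1) (- x ^- 2).
    have := @is_deriveV R id x 1 1 (lt0r_neq0 x0) (is_derive_id _ _).
    by rewrite /GRing.scale/= mulr1.
  have dN : is_derive x 1 (fun y : R => - y^-1) (x ^- 2).
    by have := is_deriveN dV; rewrite opprK.
  have dp := is_derive1_comp (is_derive_poly p x^-1) dV.
  have de := @is_derive1_comp R expR (fun y => - y^-1) _ _ _
    (is_derive_expR (- x^-1)) dN.
  have := is_deriveM dp de.
  rewrite /GRing.scale/= => dM.
  rewrite [X in is_derive _ _ _ X]/flat x0.
  have -> : (flat_step p).[x^-1] * expR (- x^-1) =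
    p.[x^-1] * (expR (- x^-1) * x ^- 2) + expR (- x^-1) * (p^`().[x^-1] * - x ^- 2).
    by rewrite /flat_step hornerM hornerXn hornerD hornerN exprVn; ring.
  apply: near_eq_is_derive dM.
  near=> z; rewrite /flat (_ : 0 < z)//.
  by near: z; exact: lt_nbhsr.
rewrite x0 [X in is_derive _ _ _ X]/flat ltxx {x0 x}.
have [M M0 H] := flat_le_sqr p.
have L : h^-1 *: ((flat p \o shift 0) (h *: 1) - flat p 0) @[h --> (0 : R)^'] --> (0 : R).
  apply: (@cvg_to_0_linear _ _ M 1) => // h /andP[h0 _].
  rewrite /= addr0 {2}/flat ltxx subr0 /GRing.scale/= mulr1 normrM normfV mulrC.
  by rewrite ler_pdivrMr// -mulrA -expr2 real_normK ?num_real.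
by apply: DeriveDef; [apply/cvg_ex; exists 0|exact/cvg_lim].
Unshelve. all: by end_near. Qed.

Fixpoint flat_poly (n : nat) : {poly R} :=
  if n is m.+1 then flat_step (flat_poly m) else 1.

Definition flat_bump (n : nat) := flat (flat_poly n).

(** Each function is the derivative of the preceding one. Carrying all derivatives
    of a smooth function of one variable explicitly makes the chain rule
    [smooth_comp] an induction on the order. *)
Definition tower (F : nat -> R -> R) := forall n x, is_derive x 1 (F n) (F n.+1 x).

Lemma tower_flat : tower flat_bump.
Proof. by move=> n x; exact: is_derive_flat. Qed.

Lemma tower_cos : tower (fun n x => cos (x + (pi / 2) *+ n)).
Proof.
move=> n x; rewrite /= (mulrSr (pi / 2)) addrA cosDpihalf.
have dx : is_derive x 1 (fun x : R => x + (pi / 2) *+ n) 1.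
  by apply: is_derive_eq; rewrite addr0.
have := @is_derive1_comp R cos (fun x => x + (pi / 2) *+ n) _ _ _
  (is_derive_cos (x + (pi / 2) *+ n)) dx.
by rewrite mulr1.
Qed.

Lemma tower_continuous F n : tower F -> continuous (F n).
Proof.
move=> tF x; apply: differentiable_continuous; apply/derivable1_diffP.
exact: (@ex_derive _ _ _ _ _ _ _ (tF n x)).
Qed.

End flat.

Section smooth.
Context {R : realType} {d : nat}.
Local Notation E := 'rV[R]_d.
Implicit Types (f g : E -> R).

Lemma is_derive_lineP f x v l :
  is_derive (0 : R) 1 (fun h : R => f (h *: v + x)) l <-> is_derive x v f l.
Proof.
have EQ : (fun h : R => h^-1 *: (((fun h : R => f (h *: v + x)) \o shift 0) (h *: 1) -
     f (0 *: v + x))) = (fun h : R => h^-1 *: ((f \o shift x) (h *: v) - f x)).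
  apply/funext => h /=.
  by rewrite addr0 scale0r add0r [X in X *: v]mulr1.
split=> -[dh vh]; apply: DeriveDef.
- by move: dh; rewrite /derivable EQ.
- by move: vh; rewrite /derive EQ.
- by move: dh; rewrite /derivable EQ.
- by move: vh; rewrite /derive EQ.
Qed.

Lemma is_derive_chain (F : R -> R) f x v (a l : R) :
  is_derive (f x) 1 F a -> is_derive x v f l -> is_derive x v (F \o f) (a * l).
Proof.
move=> dF df; apply/is_derive_lineP.
have h0 : f (0 *: v + x) = f x by rewrite scale0r add0r.
apply: (is_derive1_comp (f := F) (g := fun h : R => f (h *: v + x))).
  by rewrite h0.
exact/is_derive_lineP.
Qed.

Lemma CkS n f : Ck n.+1 f -> Ck n f.
Proof.
elim: n f => [|n IH] f /=; first by case.
move=> [cf H]; split=> // k; have [df Hk] := H k; split=> //.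
exact: IH.
Qed.

Lemma Ck_cst n (c : R) : Ck n (fun _ : E => c).
Proof.
elim: n c => [|n IH] c /=; first by split=> //; exact: cst_continuous.
split=> [|k]; first exact: cst_continuous.
split=> [x|]; first exact: (@derivable_cst _ _ _ c).
rewrite (_ : 'D_(basis_vec k) _ = fun=> 0); first exact: IH.
by apply/funext => x; exact: (derive_cst c).
Qed.

Lemma CkD n f g : Ck n f -> Ck n g -> Ck n (fun x => f x + g x).
Proof.
elim: n f g => [|n IH] f g /= [cf Hf] [cg Hg].
  by split=> // x; exact: (continuousD (cf x) (cg x)).
split=> [x|k]; first exact: (continuousD (cf x) (cg x)).
have [df Df] := Hf k; have [dg Dg] := Hg k.
split=> [x|]; first exact: (derivableD (df x) (dg x)).
rewrite (_ : (fun x => _) = fun x => 'D_(basis_vec k) f x + 'D_(basis_vec k) g x).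
  exact: IH.
by apply/funext => x; exact: (deriveD (df x) (dg x)).
Qed.

Lemma CkM n f g : Ck n f -> Ck n g -> Ck n (fun x => f x * g x).
Proof.
elim: n f g => [|n IH] f g /=.
  by move=> [cf _] [cg _]; split=> // x; exact: (continuousM (cf x) (cg x)).
move=> /[dup] /CkS Cf [cf Hf] /[dup] /CkS Cg [cg Hg].
split=> [x|k]; first exact: (continuousM (cf x) (cg x)).
have [df Df] := Hf k; have [dg Dg] := Hg k.
split=> [x|]; first exact: (derivableM (df x) (dg x)).
rewrite (_ : (fun x => _) = fun x =>
  f x * 'D_(basis_vec k) g x + g x * 'D_(basis_vec k) f x).
  by apply: CkD; exact: IH.
by apply/funext => x; exact: (deriveM (df x) (dg x)).
Qed.

Definition smooth f := forall n, Ck n f.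

Lemma smooth_derivable f k x : smooth f -> derivable f x (basis_vec k).
Proof. by move=> sf; have [_ /(_ k)[+ _]] := sf 1%N; apply. Qed.

Lemma smooth_continuous f : smooth f -> continuous f.
Proof. by move=> sf; have [] := sf 0%N. Qed.

Lemma smooth_cst (c : R) : smooth (fun=> c).
Proof. by move=> n; exact: Ck_cst. Qed.

Lemma smoothD f g : smooth f -> smooth g -> smooth (fun x => f x + g x).
Proof. by move=> sf sg n; exact: CkD. Qed.

Lemma smoothM f g : smooth f -> smooth g -> smooth (fun x => f x * g x).
Proof. by move=> sf sg n; exact: CkM. Qed.

Lemma smooth_sum (I : Type) (r : seq I) (F : I -> E -> R) :
  (forall i, smooth (F i)) -> smooth (fun x => \sum_(i <- r) F i x).
Proof.
move=> sF; elim: r => [|i r IH].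
  by under eq_fun do rewrite big_nil; exact: smooth_cst.
by under eq_fun do rewrite big_cons; exact: smoothD.
Qed.

Lemma is_derive_coord (i : 'I_d) (x v : E) :
  is_derive x v (fun y : E => y 0 i) (v 0 i).
Proof.
apply/is_derive_lineP.
rewrite (_ : (fun h : R => _) = fun h : R => h * v 0 i + x 0 i).
  by apply: is_derive_eq; rewrite /GRing.scale/= mulr0 add0r mulr1 addr0.
by apply/funext => h; rewrite !mxE.
Qed.

Lemma smooth_coord (i : 'I_d) : smooth (fun x => x 0 i).
Proof.
move=> [|n] /=; first by split=> // x; exact: coord_continuous.
split=> [x|k]; first exact: coord_continuous.
split=> [x|].
  exact: (@ex_derive _ _ _ _ _ _ _ (is_derive_coord i x (basis_vec k))).
rewrite (_ : (fun x => _) = fun=> (basis_vec k : E) 0 i); first exact: Ck_cst.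
apply/funext => x.
exact: (@derive_val _ _ _ _ _ _ _ (is_derive_coord i x (basis_vec k))).
Qed.

(** The partial derivatives of F_m o f are the products of F_(m+1) o f with those
    of f, so the induction must treat all levels m at once. *)
Lemma smooth_comp (F : nat -> R -> R) f m : tower F -> smooth f ->
  smooth (fun x => F m (f x)).
Proof.
move=> tF sf n.
have cF k : continuous (fun x => F k (f x)).
  move=> x; apply: (@continuous_comp _ _ _ f (F k)); first exact: smooth_continuous.
  exact: tower_continuous.
have dF k j x : is_derive x (basis_vec j) (fun x => F k (f x))
    (F k.+1 (f x) * 'D_(basis_vec j) f x).
  apply: is_derive_chain (tF k (f x)) _.
  by apply: derivableP; exact: smooth_derivable.
elim: n m => [|n IH] m /=; first by split.
split=> // k; split=> [x|]; first exact: (@ex_derive _ _ _ _ _ _ _ (dF m k x)).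
rewrite (_ : (fun x => _) = fun x => F m.+1 (f x) * 'D_(basis_vec k) f x).
  by apply: CkM => //; have [_ /(_ k)[_]] := sf n.+1.
by apply/funext => x; exact: (@derive_val _ _ _ _ _ _ _ (dF m k x)).
Qed.

Lemma smooth_dotE (c : E) : smooth (fun x => dotE x c).
Proof. by apply: smooth_sum => i; apply: smoothM; [exact: smooth_coord|exact: smooth_cst]. Qed.

Lemma smooth_sqr : smooth (fun x => dotE x x).
Proof. by apply: smooth_sum => i; apply: smoothM; exact: smooth_coord. Qed.

Lemma dotE_linear (c : E) (a : R) (x y : E) : dotE (a *: x + y) c = a * dotE x c + dotE y c.
Proof.
rewrite /dotE mulr_sumr -big_split; apply: eq_bigr => i _ /=.
by rewrite !mxE; ring.
Qed.

Lemma dotEC (x y : E) : dotE x y = dotE y x.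
Proof. by apply: eq_bigr => i _; rewrite mulrC. Qed.

Lemma dotE_basis k (x : E) : dotE (basis_vec k) x = x 0 k.
Proof.
rewrite /dotE (bigD1 k)//= mxE !eqxx mul1r big1 ?addr0// => i ik.
by rewrite mxE (negPf ik) andbF mul0r.
Qed.

Lemma derive_dotE (c : E) k x : 'D_(basis_vec k) (fun x => dotE x c) x = c 0 k.
Proof.
apply: (@derive_val _ _ _ _ _ _ _ ((is_derive_lineP _ _ _ _).1 _)).
rewrite (_ : (fun h : R => _) = fun h : R => h * c 0 k + dotE x c).
  by apply: is_derive_eq; rewrite /GRing.scale/= mulr0 add0r mulr1 addr0.
by apply/funext => h; rewrite dotE_linear dotE_basis.
Qed.

Lemma derive_sqr k x : 'D_(basis_vec k) (fun x : E => dotE x x) x = 2 * x 0 k.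
Proof.
apply: (@derive_val _ _ _ _ _ _ _ ((is_derive_lineP _ _ _ _).1 _)).
rewrite (_ : (fun h : R => _) = fun h : R => h * h + (h * (2 * x 0 k) + dotE x x)).
  by apply: is_derive_eq; rewrite /GRing.scale/= !(mulr0, mulr1, add0r, addr0, mul0r).
apply/funext => h; rewrite dotE_linear dotE_basis dotEC dotE_linear dotE_basis !mxE !eqxx.
by rewrite /=; ring.
Qed.

Lemma test_function_box f (N : R) : smooth f ->
  (forall x, f x != 0 -> forall i, `|x 0 i| <= N) -> test_function f.
Proof.
move=> sf fN; split; first exact: sf.
pose B := [set v : E | forall i, `[(- N), N]%classic (v ord0 i)].
have cB : compact B.
  apply: (@rV_compact R d (fun=> `[(- N), N]%classic)) => i; exact: segment_compact.
apply: subclosed_compact cB _; first exact: closed_closure.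
have clB : closed B.
  rewrite (_ : B = \bigcap_(i in [set: 'I_d]) ((fun v : E => v ord0 i) @^-1` `[(- N), N]%classic)).
    apply: closed_bigI => i _; apply: preimage_closed; last exact: itv_closed.
    by move=> x _; exact: coord_continuous.
  by apply/seteqP; split=> v h i; [move=> _|]; apply: h.
rewrite (iffLR (closure_id _) clB); apply: closure_subset => x /= fx i.
by rewrite /= in_itv/= -ler_norml; exact: fN.
Qed.

End smooth.

(** * Smooth cutoffs *)

Section cutoff.
Context {R : realType} {d : nat}.
Local Notation E := 'rV[R]_d.
Local Notation C := R[i].
Local Notation mu := (@lebesgue_rV R d).
Local Notation int f := (mu.-integrable setT (EFin \o f)).

(** The profile exp (1 - 1 / (1 - s)) is 1 at s = 0 and vanishes for s >= 1; here
    s = |x|^2 / N^2. *)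
Definition cutoff (N : R) (x : E) : R :=
  expR 1 * flat_bump 0 (1 - (N ^+ 2)^-1 * dotE x x).

Definition dcutoff (N : R) (k : 'I_d) (x : E) : R := 'D_(basis_vec k) (cutoff N) x.

Let arg (N : R) (x : E) : R := 1 - (N ^+ 2)^-1 * dotE x x.

Let argE N : (fun x => 1 + - (N ^+ 2)^-1 * dotE x x) = arg N.
Proof. by apply/funext => x; rewrite /arg mulNr. Qed.

Let smooth_arg N : smooth (arg N).
Proof.
rewrite -argE; apply: smoothD; first exact: smooth_cst.
by apply: smoothM; [exact: smooth_cst | exact: smooth_sqr].
Qed.

Lemma smooth_cutoff N : smooth (cutoff N).
Proof.
apply: smoothM; first exact: smooth_cst.
exact: (smooth_comp 0 (@tower_flat R) (smooth_arg N)).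
Qed.

Lemma dcutoffE N k x : dcutoff N k x =
  expR 1 * (flat_bump 1 (1 - (N ^+ 2)^-1 * dotE x x) * (- (N ^+ 2)^-1 * (2 * x 0 k))).
Proof.
have d1 : is_derive x (basis_vec k) (arg N) (- (N ^+ 2)^-1 * (2 * x 0 k)).
  have ds := derivableP (smooth_derivable (k := k) (x := x) (@smooth_sqr R d)).
  rewrite derive_sqr in ds.
  have := is_deriveD (is_derive_cst (1 : R) x (basis_vec k))
    (is_deriveZ (- (N ^+ 2)^-1) ds).
  by rewrite add0r /GRing.scale/= -argE.
have d2 := is_derive_chain (tower_flat 0 (arg N x)) d1.
have := is_deriveZ (expR 1) d2.
by move=> d3; rewrite /dcutoff; exact: (@derive_val _ _ _ _ _ _ _ d3).
Qed.

Lemma cutoff_le N x : `|cutoff N x| <= expR 1.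
Proof.
rewrite /cutoff normrM (ger0_norm (expR_ge0 _)) ler_piMr ?expR_ge0//.
rewrite /flat_bump /flat /=; case: ifPn => [a0|_]; last by rewrite normr0.
rewrite hornerC mul1r ger0_norm ?expR_ge0// -[X in _ <= X]expR0 ler_expR oppr_le0.
by rewrite invr_ge0 ltW.
Qed.

Let arg_gt0 N x i : 0 < N -> 0 < arg N x -> `|x 0 i| <= N.
Proof.
move=> N0; rewrite /arg subr_gt0 mulrC ltr_pdivrMr ?exprn_gt0// mul1r => h.
rewrite -ler_sqr ?nnegrE ?(ltW N0)// real_normK ?num_real//.
apply: le_trans (ltW h); rewrite /dotE (bigD1 i)//= -expr2 lerDl.
by apply: sumr_ge0 => j _; rewrite -expr2 sqr_ge0.
Qed.

Lemma cutoff_support N x i : 0 < N -> cutoff N x != 0 -> `|x 0 i| <= N.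
Proof.
move=> N0 h; apply: arg_gt0 => //; rewrite ltNge; apply/negP => a0; move/negP: h; apply.
by rewrite /cutoff /flat_bump /flat ltNge a0/= mulr0.
Qed.

Lemma dcutoff_support N k x i : 0 < N -> dcutoff N k x != 0 -> `|x 0 i| <= N.
Proof.
move=> N0 h; apply: arg_gt0 => //; rewrite ltNge; apply/negP => a0; move/negP: h; apply.
by rewrite dcutoffE /flat_bump /flat ltNge a0/= mul0r mulr0.
Qed.

(** The derivative of |x|^2 / N^2 is at most 2 / N where the cutoff does not
    vanish. *)
Lemma dcutoff_le : exists2 K : R, 0 <= K &
  forall N k x, 0 < N -> `|dcutoff N k x| <= K / N.
Proof.
have [M M0 H] := flat_bounded (flat_poly 1 : {poly R}).
exists (expR 1 * (M * 2)); first by rewrite !mulr_ge0// expR_ge0.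
move=> N k x N0; rewrite dcutoffE !normrM (ger0_norm (expR_ge0 _)) -mulrA.
rewrite ler_wpM2l ?expR_ge0//.
have [a0|a0] := ltP 0 (arg N x); last first.
  rewrite [X in `|X|](_ : _ = 0) ?normr0 ?mul0r; last first.
    by rewrite /flat_bump /flat ltNge a0.
  by rewrite !mulr_ge0// invr_ge0 ltW.
rewrite -mulrA; apply: ler_pM => //; first exact: H.
rewrite normrN normfV ger0_norm ?sqr_ge0//.
rewrite (ger0_norm (sqr_ge0 N)) mulrCA ler_wpM2l//.
rewrite -ler_pdivlMl ?invr_gt0 ?exprn_gt0// invrK.
by rewrite expr2 -mulrA mulfV ?gt_eqF// mulr1; exact: arg_gt0.
Qed.

Let marg N : measurable_fun setT (arg N : E -> measurableTypeR R).
Proof.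
apply: measurable_funB => //; apply: measurable_funM => //.
by apply: measurable_sum => k; apply: measurable_funM; exact: measurable_coor.
Qed.

Let mflat n : measurable_fun setT (flat_bump n : measurableTypeR R -> measurableTypeR R).
Proof.
by apply: continuous_measurable_fun; exact: (tower_continuous (n := n) (@tower_flat R)).
Qed.

Lemma measurable_cutoff N : measurable_fun setT (cutoff N).
Proof. by apply: measurable_funM => //; exact: (measurableT_comp (mflat 0) (marg N)). Qed.

Lemma measurable_dcutoff N k : measurable_fun setT (dcutoff N k).
Proof.
rewrite (_ : dcutoff N k = fun x => expR 1 * (flat_bump 1 (arg N x) *
  (- (N ^+ 2)^-1 * (2 * x 0 k)))); last by apply/funext => x; rewrite dcutoffE.
apply: measurable_funM => //; apply: measurable_funM.
  exact: (measurableT_comp (mflat 1) (marg N)).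
apply: measurable_funM => //; apply: measurable_funM => //.
exact: measurable_coor.
Qed.

Lemma cutoff_cvg x : cutoff n.+1%:R x @[n --> \oo] --> (1 : R).
Proof.
have E1 : expR 1 * flat_bump 0 (1 - 0 * dotE x x) = 1.
  rewrite mul0r subr0 /flat_bump /flat/= ltr01 hornerC mul1r invr1.
  by rewrite -expRD subrr expR0.
suff : cutoff n.+1%:R x @[n --> \oo] --> expR 1 * flat_bump 0 (1 - 0 * dotE x x).
  by rewrite E1.
apply: cvgMl_tmp.
apply: (@cvg_comp _ _ _ (fun n => 1 - (n.+1%:R ^+ 2)^-1 * dotE x x) (flat_bump 0));
  last exact: (tower_continuous (n := 0%N) (@tower_flat R)).
apply: cvgB; first exact: cvg_cst.
apply: cvgMr_tmp.
rewrite (_ : (fun n => _) = fun n => n.+1%:R^-1 * n.+1%:R^-1 :> R).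
  rewrite -[X in _ --> X](mulr0 0); apply: cvgM; exact: cvg_harmonic.
by apply/funext => n; rewrite expr2 invfM.
Qed.

End cutoff.

Section cutoff_L2.
Context {R : realType}.
Local Notation E n := 'rV[R]_n.

Lemma measurable_box n (N : R) : measurable [set x : E n | forall i, `|x 0 i| <= N].
Proof.
rewrite (_ : [set x | _] = \bigcap_(i in [set: 'I_n]) [set x : E n | `|x 0 i| <= N]).
  apply: fin_bigcap_measurable => // i _.
  rewrite -[X in measurable X]setTI.
  apply: (@measurable_fun_le _ _ R setT (fun x : E n => `|x 0 i|) (cst N)) => //.
  apply: measurableT_comp => //; exact: measurable_coor.
by apply/seteqP; split=> x h i; [move=> _|]; apply: h.
Qed.

Lemma box_lty n (N : R) : (lebesgue_rV n [set x : E n | forall i, `|x 0%R i| <= N]%R < +oo)%E.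
Proof.
elim: n => [|n IH].
  rewrite (_ : lebesgue_rV 0 _ = 1%E) ?ltry//.
  by rewrite /= diracE mem_set//= => -[].
rewrite (lebesgue_rVS (@measurable_box n.+1 N)) /pushforward.
rewrite (_ : _ @^-1` _ = `[(- N), N]%classic `*` [set y : E n | forall i, `|y 0 i| <= N]).
  rewrite product_measure1E//; last exact: measurable_box.
  rewrite [X in (X * _)%E]lebesgue_measure_itv/=.
  rewrite lte_mul_pinfty//; [by case: ifP; rewrite ?lexx// lte_fin -EFinB lee_fin subr_ge0 => /ltW|].
  by case: ifP.
apply/seteqP; split=> [p /= h|p /= [h1 h2] i].
  split; first by have := h ord0; rewrite cons_rV_head ler_norml in_itv.
  by move=> i; have := h (lift ord0 i); rewrite cons_rV_tail.
case: (unliftP ord0 i) => [j ->|->]; first by rewrite cons_rV_tail.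
by rewrite cons_rV_head ler_norml; move: h1; rewrite in_itv.
Qed.

(** Cutoffs are square integrable, so that their products with an L_2 function are
    integrable. *)
Lemma L2_bounded_box n (c : E n -> R) (N M : R) : measurable_fun setT c ->
  (forall x, `|c x| <= M) -> (forall x, c x != 0 -> forall i, `|x 0 i| <= N) ->
  L2 (fun x : E n => (c x)%:C%C).
Proof.
move=> mc cM cN; split; first exact: cmeasurable_real.
have M0 : 0 <= M by rewrite (le_trans _ (cM 0)).
pose B := [set x : E n | forall i, `|x 0 i| <= N].
have mB : measurable B by exact: measurable_box.
apply: (@le_lt_trans _ _ ((M ^+ 2)%:E * \int[lebesgue_rV n]_x (\1_B x)%:E)%E).
  have mI : measurable_fun setT (fun x : E n => (\1_B x : R)%:E).
    by apply/measurable_EFinP; exact: measurable_indic.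
  have <- : (\int[lebesgue_rV n]_x ((M ^+ 2)%:E * (\1_B x)%:E) =
      (M ^+ 2)%:E * \int[lebesgue_rV n]_x (\1_B x)%:E)%E.
    by rewrite ge0_integralZl// lee_fin sqr_ge0.
  apply: ge0_le_integral => //.
  - by move=> x _; rewrite lee_fin sqr_ge0.
  - by apply: measurable_sqnorm; exact: cmeasurable_real.
  - exact: measurable_funeM.
  - move=> x _; rewrite -EFinM lee_fin normc_sqr/= expr0n addr0 indicE.
    case: (boolP (x \in B)) => [_|xB]; last first.
      rewrite (_ : c x = 0) ?expr0n ?mulr0//.
      by apply/eqP; apply: contraNT xB => c0; rewrite inE => i; exact: cN.
    by rewrite mulr1 -(real_normK (num_real (c x))) ler_sqr ?nnegrE.
rewrite integral_indic// setIT lte_mul_pinfty// ?lee_fin ?sqr_ge0//.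
exact: box_lty.
Qed.

Lemma L2_cutoff n (N : R) : 0 < N -> L2 (fun x : E n => (cutoff N x)%:C%C).
Proof.
move=> N0; apply: (@L2_bounded_box _ _ N (expR 1)).
- exact: measurable_cutoff.
- exact: cutoff_le.
- by move=> x c0 i; exact: cutoff_support c0.
Qed.

Lemma L2_dcutoff n (N : R) k : 0 < N -> L2 (fun x : E n => (dcutoff N k x)%:C%C).
Proof.
move=> N0; have [K K0 H] := @dcutoff_le R n.
apply: (@L2_bounded_box _ _ N (K / N)).
- exact: measurable_dcutoff.
- by move=> x; exact: H.
- by move=> x c0 i; exact: dcutoff_support c0.
Qed.

End cutoff_L2.

(** * Weak derivatives and the Fourier transform *)

Section weak.
Context {R : realType} {d : nat}.
Local Notation E := 'rV[R]_d.
Local Notation C := R[i].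
Local Notation mu := (@lebesgue_rV R d).
Local Notation re := complex.Re.
Local Notation im := complex.Im.
Local Notation nr := Normc.normc.
Local Notation int f := (mu.-integrable setT (EFin \o f)).
Local Notation Tc := (transform mu (@cosd R d)).
Local Notation Ts := (transform mu (@sind R d)).

Lemma smooth_cosd (xi : E) : smooth (fun x => cosd x xi).
Proof.
rewrite (_ : (fun x => _) = fun x => cos (2 * pi * dotE x xi + (pi / 2) *+ 0)).
  apply: (smooth_comp 0 (@tower_cos R)).
  by apply: smoothM; [exact: smooth_cst | exact: smooth_dotE].
by apply/funext => x; rewrite mulr0n addr0.
Qed.

Lemma smooth_sind (xi : E) : smooth (fun x => sind x xi).
Proof.
rewrite (_ : (fun x => _) = fun x => - 1 * cos (2 * pi * dotE x xi + (pi / 2) *+ 1)).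
  apply: smoothM; first exact: smooth_cst.
  apply: (smooth_comp 1 (@tower_cos R)).
  by apply: smoothM; [exact: smooth_cst | exact: smooth_dotE].
by apply/funext => x; rewrite mulr1n cosDpihalf mulN1r opprK.
Qed.

Let is_derive_phase (xi : E) k x :
  is_derive x (basis_vec k) (fun x => 2 * pi * dotE x xi) (2 * pi * xi 0 k).
Proof.
have dd : is_derive x (basis_vec k) (fun x => dotE x xi) (xi 0 k).
  rewrite -(derive_dotE xi k x); apply: derivableP; apply: smooth_derivable.
  exact: smooth_dotE.
exact: (is_deriveZ (2 * pi) dd).
Qed.

Lemma derive_cosd (xi : E) k x :
  'D_(basis_vec k) (fun x => cosd x xi) x = - (2 * pi * xi 0 k * sind x xi).
Proof.
have := is_derive_chain (is_derive_cos (2 * pi * dotE x xi)) (is_derive_phase xi k x).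
move=> h; rewrite (@derive_val _ _ _ _ _ _ _ h) /sind; ring.
Qed.

Lemma derive_sind (xi : E) k x :
  'D_(basis_vec k) (fun x => sind x xi) x = 2 * pi * xi 0 k * cosd x xi.
Proof.
have := is_derive_chain (is_derive_sin (2 * pi * dotE x xi)) (is_derive_phase xi k x).
move=> h; rewrite (@derive_val _ _ _ _ _ _ _ h) /cosd; ring.
Qed.

Lemma derive_mul_smooth (f g : E -> R) k x : smooth f -> smooth g ->
  'D_(basis_vec k) (fun x => f x * g x) x =
  f x * 'D_(basis_vec k) g x + g x * 'D_(basis_vec k) f x.
Proof.
by move=> sf sg; exact: (deriveM (smooth_derivable sf) (smooth_derivable sg)).
Qed.

(** The test functions are the cutoff times cosines and sines. Their derivatives
    produce the frequency as a factor and the term with the derivative of the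
    cutoff. *)
Lemma weak_transform (a p : E -> R) k (N : R) (xi : E) : 0 < N ->
  (forall phi, test_function phi ->
     Rintegral mu setT (fun x => a x * 'D_(basis_vec k) phi x) =
     - Rintegral mu setT (fun x => p x * phi x)) ->
  int (fun x => a x * cutoff N x) -> int (fun x => p x * cutoff N x) ->
  int (fun x => a x * dcutoff N k x) ->
  Tc (fun x => p x * cutoff N x + a x * dcutoff N k x) xi =
    2 * pi * xi 0 k * Ts (fun x => a x * cutoff N x) xi /\
  Ts (fun x => p x * cutoff N x + a x * dcutoff N k x) xi =
    - (2 * pi * xi 0 k * Tc (fun x => a x * cutoff N x) xi).
Proof.
move=> N0 W iac ipc iad.
have test (g : E -> R) : smooth g -> test_function (fun x => cutoff N x * g x).
  move=> sg; apply: (@test_function_box _ _ _ N).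
    by apply: smoothM => //; exact: smooth_cutoff.
  move=> x h i; apply: (cutoff_support (N := N)) => //.
  by apply: contraNneq h => ->; rewrite mul0r.
have test2 (g k' : E -> R) (c : R) : smooth g -> (forall x, 'D_(basis_vec k) g x = c * k' x) ->
    (forall a, int a -> int (fun x => a x * g x)) ->
    (forall a, int a -> int (fun x => a x * k' x)) ->
    Rintegral mu setT (fun x => (p x * cutoff N x + a x * dcutoff N k x) * g x) =
    - (c * Rintegral mu setT (fun x => a x * cutoff N x * k' x)).
  move=> sg dg ig ik; have := W _ (test _ sg).
  rewrite [X in X = _ -> _](_ : _ = Rintegral mu setT (fun x => a x * dcutoff N k x * g x) +
      c * Rintegral mu setT (fun x => a x * cutoff N x * k' x)); last first.
    rewrite -RintegralZl//; last exact: ik.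
    rewrite -RintegralD//; [|exact: ig|exact: (intZ _ (ik _ iac))].
    by apply: eq_Rintegral => x _; rewrite derive_mul_smooth ?dg// /dcutoff; [ring|exact: smooth_cutoff].
  rewrite [X in _ = - X -> _](_ : _ = Rintegral mu setT (fun x => p x * cutoff N x * g x)); last first.
    by apply: eq_Rintegral => x _; rewrite mulrA.
  move=> h; under eq_Rintegral do rewrite mulrDl.
  by rewrite RintegralD//; [move: h; lra|exact: ig|exact: ig].
have ic a' := @int_cosd R d a' xi; have isn a' := @int_sind R d a' xi.
split; rewrite /transform.
  rewrite (test2 _ (fun x => sind x xi) (- (2 * pi * xi 0 k)) (smooth_cosd xi))// => [|x].
    by rewrite mulNr opprK.
  by rewrite derive_cosd mulNr.
rewrite (test2 _ (fun x => cosd x xi) (2 * pi * xi 0 k) (smooth_sind xi))// => x.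
exact: derive_sind.
Qed.

Let realC (r : R) (z : C) : re (z * r%:C%C) = re z * r /\ im (z * r%:C%C) = im z * r.
Proof. by case: z => a b /=; split; ring. Qed.

Let cutC (N : R) (x : E) : C := (cutoff N x)%:C%C.
Let dcutC (N : R) k (x : E) : C := (dcutoff N k x)%:C%C.

Lemma L1_cut (N : R) (f : E -> C) : 0 < N -> L2 f -> L1 (fun x => f x * cutC N x).
Proof. by move=> N0 fL; apply: L2_mul_L1 => //; exact: L2_cutoff. Qed.

Lemma normc_real (r : R) : nr r%:C%C = `|r|.
Proof. by rewrite /= expr0n addr0 sqrtr_sqr. Qed.

Lemma L2_mul_real (c : E -> R) (M : R) (f : E -> C) : measurable_fun setT c ->
  (forall x, `|c x| <= M) -> L2 f -> L2 (fun x => f x * (c x)%:C%C).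
Proof.
move=> mc cM fL; under eq_fun do rewrite mulrC.
apply: (@L2_mul_bounded _ _ f (fun x => (c x)%:C%C) M) => //.
by move=> x; rewrite normc_real.
Qed.

Lemma L2_cut (N : R) (f : E -> C) : L2 f -> L2 (fun x => f x * cutC N x).
Proof.
by apply: (L2_mul_real (M := expR 1)); [exact: measurable_cutoff|exact: cutoff_le].
Qed.

Lemma L1_dcut (N : R) k (f : E -> C) : 0 < N -> L2 f -> L1 (fun x => f x * dcutC N k x).
Proof. by move=> N0 fL; apply: L2_mul_L1 => //; exact: L2_dcutoff. Qed.

Lemma fourierL1_weak_partial (f g : E -> C) k (N : R) xi : 0 < N ->
  L2 f -> L2 g -> is_weak_partial k f g ->
  fourierL1 (fun x => g x * cutC N x + f x * dcutC N k x) xi =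
  Complex 0 (2 * pi * xi 0 k) * fourierL1 (fun x => f x * cutC N x) xi.
Proof.
move=> N0 fL gL W.
have fc := L1_cut N0 fL; have gc := L1_cut N0 gL; have fd := L1_dcut k N0 fL.
have eR (c : E -> R) (u : E -> C) : (fun x => re (u x * (c x)%:C%C)) = (fun x => re (u x) * c x).
  by apply/funext => x; rewrite (realC _ _).1.
have eI (c : E -> R) (u : E -> C) : (fun x => im (u x * (c x)%:C%C)) = (fun x => im (u x) * c x).
  by apply/funext => x; rewrite (realC _ _).2.
have Wr phi : test_function phi ->
    Rintegral mu setT (fun x => re (f x) * 'D_(basis_vec k) phi x) =
    - Rintegral mu setT (fun x => re (g x) * phi x) /\
    Rintegral mu setT (fun x => im (f x) * 'D_(basis_vec k) phi x) =
    - Rintegral mu setT (fun x => im (g x) * phi x).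
  move=> tphi; have := W phi tphi; rewrite /cintegral => -[].
  by rewrite !eR !eI => h1 h2; split.
have iR (c : E -> R) (u : E -> C) : L1 (fun x => u x * (c x)%:C%C) ->
  int (fun x => re (u x) * c x) by move=> /L1_Re; rewrite eR.
have iI (c : E -> R) (u : E -> C) : L1 (fun x => u x * (c x)%:C%C) ->
  int (fun x => im (u x) * c x) by move=> /L1_Im; rewrite eI.
have [r1 r2] := weak_transform xi N0 (fun phi t => (Wr phi t).1)
  (iR _ _ fc) (iR _ _ gc) (iR _ _ fd).
have [i1 i2] := weak_transform xi N0 (fun phi t => (Wr phi t).2)
  (iI _ _ fc) (iI _ _ gc) (iI _ _ fd).
rewrite !fourierL1E//; last exact: L1D.
have -> : (fun x => re (g x * cutC N x + f x * dcutC N k x)) =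
    (fun x => re (g x) * cutoff N x + re (f x) * dcutoff N k x).
  by apply/funext => x; rewrite ReD !(realC _ _).1.
have -> : (fun x => im (g x * cutC N x + f x * dcutC N k x)) =
    (fun x => im (g x) * cutoff N x + im (f x) * dcutoff N k x).
  by apply/funext => x; rewrite ImD !(realC _ _).2.
rewrite /cutC eR eI r1 r2 i1 i2.
by apply: complexE; rewrite ?ReM ?ImM /=; ring.
Qed.

Lemma sqnormL2_mul_cvg0 (f : E -> C) (c_ : nat -> E -> R) (M : R) : L2 f ->
  (forall n, measurable_fun setT (c_ n)) -> (forall n x, `|c_ n x| <= M) ->
  (forall x, c_ n x @[n --> \oo] --> (0 : R)) ->
  sqnormL2 (fun x => f x * (c_ n x)%:C%C) @[n --> \oo] --> 0%E.
Proof.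
move=> fL mc cM c0.
have M0 : 0 <= M by rewrite (le_trans _ (cM 0%N 0)).
have -> : 0%E = (\int[mu]_x (cst 0%E x) : \bar R)%E by rewrite integral0.
have EE n x : nr (f x * (c_ n x)%:C%C) ^+ 2 = nr (f x) ^+ 2 * c_ n x ^+ 2.
  by rewrite Normc.normcM exprMn normc_real real_normK// num_real.
apply: (@dominated_cvg _ _ _ mu setT measurableT _ _
  (fun x => (M ^+ 2 * nr (f x) ^+ 2)%:E)) => //.
- move=> n; apply: measurable_sqnorm; apply: cmeasurableM; first exact: fL.1.
  exact: cmeasurable_real.
- move=> x _; rewrite /cst; apply: cvg_EFin; first exact: nearW.
  rewrite (_ : _ \o _ = fun n => nr (f x) ^+ 2 * c_ n x ^+ 2); last first.
    by apply/funext => n /=; rewrite EE.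
  have h := @cvg_comp _ _ _ _ (fun x : R => x ^+ 2) _ _ _ (c0 x) (@exprn_continuous R 2 0).
  have : nr (f x) ^+ 2 * c_ n x ^+ 2 @[n --> \oo] --> nr (f x) ^+ 2 * 0 ^+ 2.
    by apply: cvgMl_tmp.
  by rewrite expr0n/= mulr0.
- exact: (intZ (M ^+ 2) (sqnormL2_int fL)).
- move=> n x _ /=; rewrite lee_fin ger0_norm ?sqr_ge0// EE mulrC ler_wpM2r ?sqr_ge0//.
  by rewrite -(real_normK (num_real (c_ n x))) ler_sqr ?nnegrE.
Qed.

Lemma weak_partialP (k : 'I_d) (f : E -> C) : H1 f -> L2 (weak_partial k f) /\
  is_weak_partial k f (weak_partial k f).
Proof.
move=> [fL /(_ k)[g gP]]; rewrite /weak_partial.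
by case: xgetP => [h _ //|/(_ g)].
Qed.

(** With chi_n the cutoff of radius n + 1, the function
    U_n = chi_n (df/dL + z f) + f (d chi_n/dL) has as its transform the symbol times
    the transform of chi_n f, and it tends to df/dL + z f in L_2 since the
    derivatives of chi_n are of order 1 / n. *)
Lemma plancherel_H1 (f fhat : E -> C) (L : E) (z : C) : H1 f -> is_fourierL2 f fhat ->
  sqnormL2 (fun xi => Complex (re z) (2 * pi * dotE L xi + im z) * fhat xi) =
  sqnormL2 (fun x => dir_deriv L f x + z * f x).
Proof.
move=> fH fF; have fL := fH.1.
pose N n : R := n.+1%:R.
have N0 n : 0 < N n by rewrite ltr0n.
pose G := dir_deriv L f.
have GL : L2 G.
  by apply: L2_sum => k; apply: L2Z; exact: (weak_partialP k fH).1.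
pose h_ n x := f x * cutC (N n) x.
pose dL n x : R := \sum_(k < d) L 0 k * dcutoff (N n) k x.
pose P_ n x := \sum_(k < d) (L 0 k)%:C%C *
  (weak_partial k f x * cutC (N n) x + f x * dcutC (N n) k x).
pose U_ n x := P_ n x + z * h_ n x.
have UE n : U_ n = (fun x => (G x + z * f x) * cutC (N n) x + f x * (dL n x)%:C%C).
  apply/funext => x; rewrite /U_ /h_ mulrDl mulrA addrAC; congr (_ + _).
  rewrite /P_ /G /dir_deriv /dL mulr_suml.
  rewrite (raddf_sum (real_complex R)) mulr_sumr -big_split.
  apply: eq_bigr => k _ /=; rewrite mulrDr mulrA; congr (_ + _).
  by rewrite [in RHS]rmorphM/= mulrCA.
have pL n k : L1 (fun x => weak_partial k f x * cutC (N n) x + f x * dcutC (N n) k x).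
  apply: L1D; [exact: L1_cut (weak_partialP k fH).1|exact: L1_dcut].
have P1 n (r : seq 'I_d) : L1 (fun x => \sum_(k <- r) (L 0 k)%:C%C *
    (weak_partial k f x * cutC (N n) x + f x * dcutC (N n) k x)).
  elim: r => [|k r IH].
    under eq_fun do rewrite big_nil.
    apply: (L1_le _ (intZ 0 (sqnormL2_int fL))); first exact: cmeasurable_cst.
    by move=> x; rewrite mul0r Normc.normc0.
  by under eq_fun do rewrite big_cons; apply: L1D => //; apply: L1Z.
have Four n xi (r : seq 'I_d) : fourierL1 (fun x => \sum_(k <- r) (L 0 k)%:C%C *
    (weak_partial k f x * cutC (N n) x + f x * dcutC (N n) k x)) xi =
    (\sum_(k <- r) (L 0 k)%:C%C * Complex 0 (2 * pi * xi 0 k)) * fourierL1 (h_ n) xi.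
  elim: r => [|k r IH].
    under [X in fourierL1 X]eq_fun do rewrite big_nil.
    rewrite big_nil mul0r.
    have := fourierL1Z 0 xi (L1_cut (N0 n) fL : L1 (h_ n)).
    by under [X in fourierL1 X]eq_fun do rewrite mul0r; rewrite mul0r.
  under [X in fourierL1 X]eq_fun do rewrite big_cons.
  rewrite fourierL1D//; last by apply: L1Z.
  have [gL gW] := weak_partialP k fH.
  rewrite IH big_cons fourierL1Z//.
  rewrite (fourierL1_weak_partial xi (N0 n) fL gL gW).
  by rewrite [RHS]mulrDl -[in RHS]mulrA.
have [K K0 HK] := @dcutoff_le R d.
have dLle n x : `|dL n x| <= (\sum_(k < d) `|L 0 k| * K) / N n.
  rewrite /dL (le_trans (ler_norm_sum _ _ _))// mulr_suml; apply: ler_sum => k _.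
  by rewrite normrM -mulrA ler_wpM2l//; exact: HK.
have S0 : 0 <= \sum_(k < d) `|L 0 k| * K by apply: sumr_ge0 => k _; rewrite mulr_ge0.
have dLM n x : `|dL n x| <= \sum_(k < d) `|L 0 k| * K.
  by rewrite (le_trans (dLle n x))// ler_piMr// invf_le1// ler1n.
have mdL n : measurable_fun setT (dL n).
  by apply: measurable_sum => k; apply: measurable_funM => //; exact: measurable_dcutoff.
have dL0 x : dL n x @[n --> \oo] --> (0 : R).
  apply: norm_cvg0; apply: (@squeeze_cvgr _ _ _ _ (fun=> 0)
    (fun n => (\sum_(k < d) `|L 0 k| * K) / N n)).
  - by apply: nearW => n; rewrite normr_ge0 dLle.
  - exact: cvg_cst.
  - by rewrite -[X in _ --> X](mulr0 (\sum_(k < d) `|L 0 k| * K)); apply: cvgMl_tmp; exact: cvg_harmonic.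
have cm1 (u : E -> C) : L2 u -> sqnormL2 (fun x => u x * cutC (N n) x - u x) @[n --> \oo] --> 0%E.
  move=> uL.
  rewrite (_ : (fun n => _) = fun n => sqnormL2 (fun x => u x * (cutoff (N n) x - 1)%:C%C)); last first.
    apply/funext => n; congr sqnormL2; apply/funext => x.
    by rewrite rmorphB/= mulrBr mulr1.
  apply: (@sqnormL2_mul_cvg0 _ _ (expR 1 + 1)) => //.
  - by move=> n; apply: measurable_funB => //; exact: measurable_cutoff.
  - by move=> n x; rewrite (le_trans (ler_normB _ _))// normr1 lerD2r cutoff_le.
  - by move=> x; rewrite -(subrr 1); apply: cvgB; [exact: cutoff_cvg|exact: cvg_cst].
have VL : L2 (fun x => G x + z * f x) by apply: L2D => //; exact: L2Z.
have UL n : L1 (U_ n) /\ L2 (U_ n).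
  split; first by apply: L1D; [exact: P1|apply: L1Z; exact: L1_cut].
  rewrite UE; apply: L2D; first exact: L2_cut.
  exact: (L2_mul_real (M := \sum_(k < d) `|L 0 k| * K)).
apply: (fourier_multiplier (h_ := h_) (U_ := U_) fF) => //.
- split => /=; first exact: measurable_cst.
  apply: measurable_funD => //; apply: measurable_funM => //.
  exact: (measurable_section1 L (@measurable_dotE R d)).
- by move=> n; split; [exact: L1_cut|exact: L2_cut].
- exact: cm1.
- have h1 := cm1 _ VL.
  have h2 := sqnormL2_mul_cvg0 fL mdL dLM dL0.
  apply/cvge0_le => [n|e e0]; first exact: sqnormL2_ge0.
  have e4 : 0 < e / 4 by rewrite divr_gt0.
  move/cvge0_le : h1 => /(_ (fun n => sqnormL2_ge0 _))/(_ _ e4) h1.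
  move/cvge0_le : h2 => /(_ (fun n => sqnormL2_ge0 _))/(_ _ e4) h2.
  apply: filterS2 h1 h2 => n h1 h2.
  have m1 : cmeasurable (fun x => (G x + z * f x) * cutC (N n) x - (G x + z * f x)).
    by apply: cmeasurableB; [exact: (L2_cut (N n) VL).1|exact: VL.1].
  have m2 : cmeasurable (fun x => f x * (dL n x)%:C%C).
    by apply: cmeasurableM; [exact: fL.1|exact: cmeasurable_real].
  have := sqnormL2D_le ltr01 m1 m2.
  rewrite UE; under [X in (sqnormL2 X <= _)%E -> _]eq_fun do rewrite addrAC.
  move=> /le_trans; apply; rewrite invr1.
  have -> : e = (1 + 1) * (e / 4) + (1 + 1) * (e / 4) by field.
  by rewrite (EFinD ((1 + 1) * _)) !EFinM; apply: leeD; apply: lee_wpmul2l => //; rewrite lee_fin.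
- move=> n xi; rewrite /U_ fourierL1D; [|exact: P1|by apply: L1Z; exact: L1_cut].
  rewrite Four fourierL1Z; last exact: L1_cut.
  rewrite -mulrDl; congr (_ * _); apply: complexE.
    rewrite ReD (big_morph (@complex.Re R) (@ReD R) (erefl _)).
    rewrite big1 ?add0r// => k _; rewrite ReM/=; ring.
  rewrite ImD (big_morph (@complex.Im R) (@ImD R) (erefl _)) /dotE mulr_sumr.
  congr (_ + _).
  by apply: eq_bigr => k _; rewrite ImM/=; ring.
Qed.

End weak.

(** * Moments of an even density *)

Section even_density.
Context {R : realType} {d : nat}.
Local Notation E := 'rV[R]_d.
Local Notation mu := (@lebesgue_rV R d).
Local Notation int f := (mu.-integrable setT (EFin \o f)).
Local Notation "\int x , f" := (Rintegral mu setT (fun x : E => f))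
  (at level 36, x name, f at level 36).

Lemma measurable_coord (k : 'I_d) : measurable_fun setT (fun x : E => x 0 k).
Proof. exact: measurable_coor. Qed.

Lemma int_sum (I : Type) (r : seq I) (F : I -> E -> R) : (forall i, int (F i)) ->
  int (fun x => \sum_(i <- r) F i x).
Proof.
move=> Fi; elim: r => [|i r IH]; last first.
  by under eq_fun do rewrite big_cons; exact: intD.
rewrite (_ : EFin \o _ = cst 0%E); first exact: integrable0.
by apply/funext => x /=; rewrite big_nil.
Qed.

Lemma Rintegral_sum (I : Type) (r : seq I) (F : I -> E -> R) : (forall i, int (F i)) ->
  \int x, (\sum_(i <- r) F i x) = \sum_(i <- r) \int x, F i x.
Proof.
move=> Fi; elim: r => [|i r IH].
  rewrite big_nil (eq_Rintegral mu (g := fun=> 0)) => [|x _]; last by rewrite big_nil.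
  by rewrite /Rintegral integral0.
rewrite big_cons -IH -RintegralD//; last exact: int_sum.
by apply: eq_Rintegral => x _; rewrite big_cons.
Qed.

(** The reflection exchanges the nonnegative functions |h| + h and |h| - h, which
    therefore have the same integral. *)
Lemma Rintegral_odd (k : 'I_d) (h : E -> R) : int h ->
  {ae mu, forall x, h (reflect_coord k x) = - h x} -> \int x, h x = 0.
Proof.
move=> hi hodd; have mh := int_measurable hi; have ai := int_abs hi.
have mR := @measurable_reflect R d k.
have pos (g : E -> R) : int g -> (forall x, 0 <= g x) ->
    \int x, g (reflect_coord k x) = \int x, g x.
  move=> gi g0; rewrite /Rintegral; congr fine.
  apply: (@ge0_integral_reflect _ _ k (EFin \o g)) => [|x]; last by rewrite lee_fin.
  by apply/measurable_EFinP; exact: (int_measurable gi).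
have := pos _ (intD ai hi) _.
have -> : \int x, (`|h (reflect_coord k x)| + h (reflect_coord k x)) =
    \int x, (`|h x| - h x).
  rewrite /Rintegral; congr fine; apply: ae_eq_integral => //.
  - apply/measurable_EFinP; apply: (measurableT_comp _ mR (f := fun x => `|h x| + h x)).
    exact: (int_measurable (intD ai hi)).
  - by apply/measurable_EFinP; exact: (int_measurable (intB ai hi)).
  - by apply: filterS hodd => x hx _; rewrite hx normrN.
rewrite RintegralB// RintegralD// => H.
have : forall x, 0 <= `|h x| + h x.
  by move=> x; rewrite -lerBlDr sub0r -normrN ler_norm.
by move/H; lra.
Qed.

Variable w : E -> R.
Hypothesis w0 : forall x, 0 <= w x.
Hypothesis wi : int w.
Hypothesis w2 : forall k : 'I_d, int (fun x : E => x 0 k ^+ 2 * w x).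
Hypothesis w_even : forall k, {ae mu, forall x, w x = w (reflect_coord k x)}.

Let mw := int_measurable wi.

Let int_coord (k : 'I_d) : int (fun x : E => x 0 k * w x).
Proof.
apply: int_le (intD wi (w2 k)).
  by apply: measurable_funM => //; exact: measurable_coord.
move=> x; rewrite normrM (ger0_norm (w0 x)) -[X in _ <= X + _]mul1r -mulrDl ler_wpM2r//.
by rewrite -(real_normK (num_real (x 0 k))); nra.
Qed.

Let int_coord2 (j k : 'I_d) : int (fun x : E => x 0 j * x 0 k * w x).
Proof.
apply: int_le (intD (w2 j) (w2 k)).
  apply: measurable_funM => //; apply: measurable_funM; exact: measurable_coord.
move=> x; rewrite normrM (ger0_norm (w0 x)) -mulrDl ler_wpM2r// normrM.
rewrite -(real_normK (num_real (x 0 k))) -(real_normK (num_real (x 0 j))).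
by have := normr_ge0 (x 0 j); have := normr_ge0 (x 0 k); nra.
Qed.

Lemma int_dot (L : E) : int (fun x => dotE L x * w x).
Proof.
have := int_sum (index_enum 'I_d) (fun k => intZ (L 0 k) (int_coord k)).
congr (integrable _ _ _); apply/funext => x /=; congr EFin.
by rewrite /dotE mulr_suml; apply: eq_bigr => k _; rewrite mulrA.
Qed.

Lemma Rintegral_dot (L : E) : \int x, (dotE L x * w x) = 0.
Proof.
rewrite (eq_Rintegral mu (g := fun x => \sum_(k < d) L 0 k * (x 0 k * w x))); last first.
  by move=> x _; rewrite /dotE mulr_suml; apply: eq_bigr => k _; rewrite mulrA.
rewrite Rintegral_sum => [|k]; last exact: intZ.
apply: big1 => k _; rewrite RintegralZl// (@Rintegral_odd k) ?mulr0//.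
by apply: filterS (w_even k) => x <-; rewrite mxE eqxx mulNr.
Qed.

Let dot2E (L : E) : (fun x => dotE L x ^+ 2 * w x) =
  (fun x => \sum_(j < d) \sum_(k < d) (L 0 j * L 0 k) * (x 0 j * x 0 k * w x)).
Proof.
apply/funext => x; rewrite expr2 /dotE big_distrlr/= mulr_suml.
by apply: eq_bigr => j _; rewrite mulr_suml; apply: eq_bigr => k _; ring.
Qed.

Lemma int_dot2 (L : E) : int (fun x => dotE L x ^+ 2 * w x).
Proof.
rewrite dot2E; apply: int_sum => j.
by apply: int_sum => k; exact: (intZ _ (int_coord2 j k)).
Qed.

Lemma Rintegral_dot2 (L : E) :
  \int x, (dotE L x ^+ 2 * w x) = \sum_(k < d) L 0 k ^+ 2 * \int x, (x 0 k ^+ 2 * w x).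
Proof.
rewrite dot2E Rintegral_sum => [|j]; last first.
  by apply: int_sum => k; exact: (intZ _ (int_coord2 j k)).
apply: eq_bigr => j _; rewrite Rintegral_sum => [|k]; last first.
  exact: (intZ _ (int_coord2 j k)).
rewrite (bigD1 j)//= big1 ?addr0 => [|k kj].
  by rewrite RintegralZl ?expr2//; exact: int_coord2.
rewrite (RintegralZl (L 0 j * L 0 k) measurableT (int_coord2 j k)).
rewrite (@Rintegral_odd k) ?mulr0//.
by apply: filterS (w_even k) => x <-; rewrite !mxE eqxx eq_sym (negPf kj) mulrN mulNr.
Qed.

(** The coordinate hyperplane is a null set. *)
Lemma moment_gt0 (k : 'I_d) : 0 < \int x, w x -> 0 < \int x, (x 0 k ^+ 2 * w x).
Proof.
have p0 (x : E) : 0 <= x 0 k ^+ 2 * w x by rewrite mulr_ge0// sqr_ge0.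
move=> wp; rewrite lt_def Rintegral_ge0 ?andbT//; apply: contraTneq wp => m0.
have mp : measurable_fun setT (fun x : E => (x 0 k ^+ 2 * w x)%:E).
  by apply/measurable_EFinP; exact: (int_measurable (w2 k)).
have : (\int[mu]_x `|(x 0 k ^+ 2 * w x)%:E|)%E = 0%E.
  rewrite -[RHS](congr1 EFin m0) EFin_Rintegral//; apply: eq_integral => x _.
  by rewrite gee0_abs// lee_fin.
move/(ae_eq_integral_abs mu measurableT mp) => w20.
have xn0 : {ae mu, forall x : E, x 0 k != 0}.
  exists [set x : E | x 0 k = 0]; split; last by move=> x /= /negP; rewrite negbK => /eqP.
    rewrite -[X in measurable X]setTI.
    exact: (measurable_coor k _ (@measurable_set1 R 0)).
  exact: hyperplane_null.
rewrite /Rintegral (_ : (\int[mu]_x (w x)%:E)%E = 0%E) ?ltxx//.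
rewrite -(integral0 mu setT); apply: ae_eq_integral => //; first exact/measurable_EFinP.
apply: filterS2 w20 xn0 => x /(_ I) [] /eqP; rewrite mulf_eq0 sqrf_eq0.
by move=> /orP[->//|/eqP ->].
Qed.

End even_density.

(** * The uncertainty product in terms of moments *)

Section UP_formula.
Context {R : realType} {d : nat}.
Local Notation E := 'rV[R]_d.
Local Notation C := R[i].
Local Notation mu := (@lebesgue_rV R d).
Local Notation re := complex.Re.
Local Notation im := complex.Im.
Local Notation nr := Normc.normc.
Local Notation int f := (mu.-integrable setT (EFin \o f)).
Local Notation "\int x , f" := (Rintegral mu setT (fun x : E => f))
  (at level 36, x name, f at level 36).
Implicit Types (f g : E -> C) (L : E).

Lemma normL2_sqr f : normL2 f ^+ 2 = \int x, (nr (f x) ^+ 2).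
Proof. by rewrite /normL2 sqr_sqrtr// fine_ge0// sqnormL2_ge0. Qed.

Lemma normL2_eq f g : sqnormL2 f = sqnormL2 g -> normL2 f = normL2 g.
Proof. by rewrite /normL2 => ->. Qed.

Lemma even_density f k : modulus_even f k ->
  {ae mu, forall x, nr (f x) ^+ 2 = nr (f (reflect_coord k x)) ^+ 2}.
Proof. by apply: filterS => x ->. Qed.

Lemma Delta_orthogonal (T : (E -> C) -> E -> C) f : innerL2 (T f) f = 0 ->
  Delta T f = normL2 (T f) ^+ 2.
Proof. by rewrite /Delta => ->; rewrite Normc.normc0 expr0n mul0r subr0. Qed.

Lemma normE_sqr (x : E) : normE x ^+ 2 = \sum_(k < d) x 0 k ^+ 2.
Proof.
have -> : \sum_(k < d) x 0 k ^+ 2 = dotE x x by apply: eq_bigr => k _; rewrite expr2.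
by rewrite /normE sqr_sqrtr// sumr_ge0// => k _; rewrite -expr2 sqr_ge0.
Qed.

Lemma measurable_density f : cmeasurable f -> measurable_fun setT (fun x => nr (f x) ^+ 2).
Proof. by move=> mf; apply/measurable_EFinP; exact: measurable_sqnorm. Qed.

Section position.
Variable f : E -> C.
Hypothesis fA : domA f.
Hypothesis f_even : forall k, modulus_even f k.
Let w (x : E) := nr (f x) ^+ 2.

Let w0 x : 0 <= w x. Proof. exact: sqr_ge0. Qed.
Let wi : int w. Proof. exact: sqnormL2_int fA.1. Qed.
Let w_even k : {ae mu, forall x, w x = w (reflect_coord k x)}.
Proof. exact: even_density. Qed.

Lemma int_moment_domA (k : 'I_d) : int (fun x : E => x 0 k ^+ 2 * w x).
Proof.
have mw : measurable_fun setT w := measurable_density fA.1.1.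
have mc (j : 'I_d) : measurable_fun setT (fun x : E => x 0 j ^+ 2).
  by apply: measurable_funX; exact: measurable_coord.
apply: (@int_le _ _ _ _ _ (fun x : E => normE x ^+ 2 * w x)).
- by apply: measurable_funM.
- move=> x; rewrite (ger0_norm (mulr_ge0 (sqr_ge0 _) (w0 x))) ler_wpM2r// normE_sqr (bigD1 k)//= lerDl.
  by apply: sumr_ge0 => j _; exact: sqr_ge0.
- apply/ge0_intP; [|by move=> x; rewrite mulr_ge0// sqr_ge0|exact: fA.2].
  apply: measurable_funM => //; under eq_fun do rewrite normE_sqr.
  exact: measurable_sum.
Qed.

Lemma normL2_opA L :
  normL2 (opA L f) ^+ 2 = \sum_(k < d) L 0 k ^+ 2 * ((2 * pi) ^+ 2 * moment2 f k).
Proof.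
rewrite normL2_sqr (eq_Rintegral mu (g := fun x => (2 * pi) ^+ 2 * (dotE L x ^+ 2 * w x))).
  rewrite RintegralZl//; last exact: (int_dot2 w0 wi int_moment_domA).
  rewrite (Rintegral_dot2 w0 wi int_moment_domA w_even) mulr_sumr.
  by apply: eq_bigr => k _; rewrite mulrCA.
move=> x _; rewrite /opA Normc.normcM exprMn normc_real real_normK ?num_real//.
by rewrite exprMn mulrA.
Qed.

Lemma innerL2_opA L : innerL2 (opA L f) f = 0.
Proof.
have E0 x : opA L f x * (f x)^*%C = (2 * pi * (dotE L x * w x))%:C%C.
  rewrite /opA -mulrA /w normc_sqr; case: (f x) => a b.
  by apply: complexE => /=; ring.
rewrite /innerL2 /cintegral.
under eq_Rintegral do rewrite E0/=.
under [X in Complex _ X]eq_Rintegral do rewrite E0/=.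
rewrite RintegralZl//; last exact: (int_dot w0 wi int_moment_domA).
rewrite (Rintegral_dot w0 wi int_moment_domA w_even) mulr0.
by rewrite /Rintegral integral0.
Qed.

Lemma moment_domA_gt0 k : normL2 f = 1 -> 0 < moment2 f k.
Proof.
move=> f1; apply: (moment_gt0 w0 wi int_moment_domA).
by rewrite -normL2_sqr f1 expr1n.
Qed.

End position.

Section frequency.
Variables f fhat : E -> C.
Hypothesis fH : H1 f.
Hypothesis fF : is_fourierL2 f fhat.
Hypothesis fhat_even : forall k, modulus_even fhat k.
Let w (x : E) := nr (fhat x) ^+ 2.

Let w0 x : 0 <= w x. Proof. exact: sqr_ge0. Qed.
Let wi : int w. Proof. exact: sqnormL2_int fF.1. Qed.
Let w_even k : {ae mu, forall x, w x = w (reflect_coord k x)}.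
Proof. exact: even_density. Qed.

Lemma L2_dir_deriv L : L2 (dir_deriv L f).
Proof. by apply: L2_sum => k; apply: L2Z; exact: (weak_partialP k fH).1. Qed.

Let symbol_sqr L (z : C) (xi : E) :
  nr (Complex (re z) (2 * pi * dotE L xi + im z) * fhat xi) ^+ 2 =
  (re z ^+ 2 + (2 * pi * dotE L xi + im z) ^+ 2) * w xi.
Proof. by rewrite Normc.normcM exprMn normc_sqr. Qed.

Lemma Rintegral_symbol L (z : C) :
  \int xi, ((re z ^+ 2 + (2 * pi * dotE L xi + im z) ^+ 2) * w xi) =
  \int x, (nr (dir_deriv L f x + z * f x) ^+ 2).
Proof.
rewrite -[RHS]normL2_sqr -(normL2_eq (plancherel_H1 L z fH fF)) normL2_sqr.
by apply: eq_Rintegral => xi _; rewrite symbol_sqr.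
Qed.

Lemma int_moment_H1 (k : 'I_d) : int (fun x : E => x 0 k ^+ 2 * w x).
Proof.
have pi0 : (2 * pi : R) ^+ 2 != 0 by rewrite expf_neq0// mulf_neq0// lt0r_neq0// pi_gt0.
have : int (fun xi : E => (2 * pi) ^+ 2 * (xi 0 k ^+ 2 * w xi)).
  apply/ge0_intP.
  - apply: measurable_funM => //; apply: measurable_funM; last exact: measurable_density fF.1.1.
    by apply: measurable_funX; exact: measurable_coord.
  - by move=> x; rewrite mulr_ge0 ?sqr_ge0// mulr_ge0 ?sqr_ge0.
  - rewrite [X in (X < _)%E](_ : _ = sqnormL2 (fun xi =>
        Complex (re 0) (2 * pi * dotE (basis_vec k) xi + im 0) * fhat xi)).
      rewrite (plancherel_H1 _ _ fH fF).
      exact: (L2D (L2_dir_deriv _) (L2Z 0 fH.1)).2.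
    apply: eq_integral => xi _; rewrite symbol_sqr dotE_basis /=; congr EFin.
    by move: (2 * pi : R) => p; ring.
move=> /(intZ ((2 * pi) ^+ 2)^-1); congr (integrable _ _ _).
by apply/funext => xi /=; rewrite mulKf.
Qed.

Lemma normL2_dir_deriv L :
  normL2 (dir_deriv L f) ^+ 2 = (2 * pi) ^+ 2 * \sum_(k < d) L 0 k ^+ 2 * moment2 fhat k.
Proof.
have := Rintegral_symbol L 0.
rewrite normL2_sqr; under [in X in _ = X -> _]eq_Rintegral do rewrite mul0r addr0.
move=> <-; rewrite -(Rintegral_dot2 w0 wi int_moment_H1 w_even).
rewrite -RintegralZl//; last exact: (int_dot2 w0 wi int_moment_H1).
by apply: eq_Rintegral => xi _ /=; ring.
Qed.

Lemma normL2_fourier : normL2 fhat ^+ 2 = normL2 f ^+ 2.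
Proof.
have := Rintegral_symbol 0 1; rewrite !normL2_sqr.
have d0 (x : E) : dotE 0 x = 0 by apply: big1 => k _; rewrite mxE mul0r.
have D0 x : dir_deriv 0 f x = 0 by apply: big1 => k _; rewrite mxE mul0r.
rewrite (eq_Rintegral mu (g := w)) => [->|xi _]; last first.
  by rewrite d0/=; ring.
by apply: eq_Rintegral => x _; rewrite D0 add0r mul1r.
Qed.

(* The mixed term in the expansion of |df/dL + z f|^2, for |z| = 1. *)
Let cross L (z : C) (x : E) :=
  nr (dir_deriv L f x + z * f x) ^+ 2 - nr (dir_deriv L f x) ^+ 2 - nr (f x) ^+ 2.

Let int_cross L z : int (cross L z).
Proof.
apply: intB; last exact: sqnormL2_int fH.1.
apply: intB; last exact: sqnormL2_int (L2_dir_deriv L).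
exact: (sqnormL2_int (L2D (L2_dir_deriv L) (L2Z z fH.1))).
Qed.

(* On the Fourier side the mixed term is 4 pi Im z <L, xi> |fhat|^2, which
   integrates to 0 by symmetry. *)
Let Rintegral_cross L z : nr z ^+ 2 = 1 -> \int x, cross L z x = 0.
Proof.
move=> z1; have DL := L2_dir_deriv L; have zL := L2D DL (L2Z z fH.1).
have iz := sqnormL2_int zL; have iD := sqnormL2_int DL; have iF := sqnormL2_int fH.1.
rewrite /cross RintegralB//; last exact: intB.
rewrite RintegralB// -!normL2_sqr -normL2_fourier normL2_dir_deriv.
rewrite normL2_sqr -Rintegral_symbol normL2_sqr.
rewrite -(Rintegral_dot2 w0 wi int_moment_H1 w_even).
have i1 := int_dot w0 wi int_moment_H1 L; have i2 := int_dot2 w0 wi int_moment_H1 L.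
rewrite (eq_Rintegral mu (g := fun xi =>
  (w xi + (2 * pi) ^+ 2 * (dotE L xi ^+ 2 * w xi)) + 4 * pi * im z * (dotE L xi * w xi))).
  have i3 := intZ ((2 * pi) ^+ 2) i2; have i4 := intZ (4 * pi * im z) i1.
  rewrite RintegralD//; last exact: intD.
  rewrite RintegralD// !RintegralZl//.
  rewrite (Rintegral_dot w0 wi int_moment_H1 w_even) mulr0 addr0 /w.
  by ring.
move=> xi _; rewrite normc_sqr in z1.
rewrite (_ : re z ^+ 2 = 1 - im z ^+ 2); last by rewrite -z1 addrK.
by move: (pi : R) => p; ring.
Qed.

(** Polarisation: twice the real and imaginary part of df/dL times the conjugate
    of f are the mixed terms for z = 1 and z = i. *)
Lemma innerL2_opB L : innerL2 (opB L f) f = 0.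
Proof.
have c1 x : re (opB L f x * (f x)^*%C) = - (2 * pi)^-1 / 2 * cross L (Complex 0 1) x.
  rewrite /opB /cross !normc_sqr !ReImE; case: (f x) => a b /=.
  by move: ((2 * pi)^-1 : R) => p; field.
have ci x : im (opB L f x * (f x)^*%C) = (2 * pi)^-1 / 2 * cross L 1 x.
  rewrite /opB /cross mul1r !normc_sqr !ReImE; case: (f x) => a b /=.
  by move: ((2 * pi)^-1 : R) => p; field.
rewrite /innerL2 /cintegral.
under eq_Rintegral do rewrite c1.
under [X in Complex _ X]eq_Rintegral do rewrite ci.
by rewrite !RintegralZl// !Rintegral_cross ?mulr0// normc_sqr/= expr0n expr1n ?addr0 ?add0r.
Qed.

Lemma normL2_opB L :
  normL2 (opB L f) ^+ 2 = \sum_(k < d) L 0 k ^+ 2 * moment2 fhat k.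
Proof.
have pi0 : (2 * pi : R) != 0 by rewrite mulf_neq0// lt0r_neq0// pi_gt0.
rewrite normL2_sqr (eq_Rintegral mu (g := fun x => (2 * pi) ^- 2 * nr (dir_deriv L f x) ^+ 2)).
  rewrite RintegralZl//; last exact: sqnormL2_int (L2_dir_deriv L).
  by rewrite -normL2_sqr normL2_dir_deriv mulKf// expf_neq0.
move=> x _; rewrite /opB Normc.normcM exprMn; congr (_ * _).
by rewrite normc_sqr/= expr0n/= add0r exprVn.
Qed.

Lemma moment_H1_gt0 k : normL2 f = 1 -> 0 < moment2 fhat k.
Proof.
move=> f1; apply: (moment_gt0 w0 wi int_moment_H1).
by rewrite -normL2_sqr normL2_fourier f1 expr1n.
Qed.

End frequency.

(** Both means <A f, f> and <B f, f> vanish, so that the variances are the squared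
    norms. *)
Lemma UP_moments f fhat : domA f -> domB f -> normL2 f = 1 -> is_fourierL2 f fhat ->
  (forall k, modulus_even f k) -> (forall k, modulus_even fhat k) ->
  forall L, normE L = 1 ->
  UP L f = (\sum_(k < d) L 0 k ^+ 2 * ((2 * pi) ^+ 2 * moment2 f k)) *
           (\sum_(k < d) L 0 k ^+ 2 * moment2 fhat k).
Proof.
move=> fA fB f1 fF fe fhe L L1.
rewrite /UP L1 f1 !expr1n mulr1 divr1 !Delta_orthogonal.
- by rewrite (normL2_opA fA fe) (normL2_opB fB fF fhe).
- exact: (innerL2_opB fB fF fhe).
- exact: innerL2_opA.
Qed.

End UP_formula.

(** * Products of two linear forms on the simplex *)

Section candidate_of_critical_point.
Context {R : realType} {d : nat}.
Implicit Types (A : 'M[R]_d) (K : {set 'I_d}) (v : 'I_d -> R).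

Definition simplex v := (forall k, 0 <= v k) /\ \sum_k v k = 1.

Definition sqrt_rV v : 'rV[R]_d := \row_k Num.sqrt (v k).

Lemma sqrt_rV_sqr v k : simplex v -> sqrt_rV v 0 k ^+ 2 = v k.
Proof. by move=> [v0 _]; rewrite mxE sqr_sqrtr. Qed.

Lemma normE_sqrt_rV v : simplex v -> normE (sqrt_rV v) = 1.
Proof.
move=> vS; rewrite /normE /dotE.
under eq_bigr do rewrite -expr2 sqrt_rV_sqr//.
by rewrite vS.2 sqrtr1.
Qed.

Lemma simplex_sqr (L : 'rV[R]_d) : normE L = 1 -> simplex (fun k => L 0 k ^+ 2).
Proof.
by move=> L1; split=> [k|]; [exact: sqr_ge0|rewrite -normE_sqr L1 expr1n].
Qed.

(** The restriction of v / lam to K solves B y = E for the principal submatrix B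
    on K, and its l_1 norm is 1 / lam because v is in the simplex. Nondegeneracy
    is asked of functions on all indices instead of vectors indexed by K. *)
Lemma candidate_critical A K v (lam : R) : simplex v ->
  (forall k, k \notin K -> v k = 0) -> 0 < lam ->
  (forall i, i \in K -> \sum_(k in K) A i k * v k = lam) ->
  (forall u : 'I_d -> R, (forall i, i \in K -> \sum_(k in K) u k * A k i = 0) ->
     forall k, k \in K -> u k = 0) ->
  candidates A (sqrt_rV v).
Proof.
move=> vS vK lam0 crit nondeg; split; first exact: normE_sqrt_rV.
have sumK (F : 'I_d -> R) : \sum_(k in K) F k = \sum_(i < #|~: ~: K|) F (enum_val i).
  by rewrite -{1}(finset.setCK K) big_enum_val.
have inK (i : 'I_#|~: ~: K|) : enum_val i \in K by have := enum_valP i; rewrite !inE negbK.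
have [k0 k0K] : exists k, k \in ~: ~: K.
  apply/set0Pn; apply: contra_neq (oner_neq0 R) => K0.
  rewrite -vS.2; apply: big1 => k _; apply: vK; apply/negP => kK.
  by have := finset.in_set0 k; rewrite -K0 finset.setCK kK.
have det0 : \det (remove_rc A (~: K)) != 0.
  apply/det0P => -[x x0 xA]; move/eqP: x0; apply; apply/rowP => i; rewrite mxE.
  pose u k := x 0 (enum_rank_in k0K k).
  have uE j : u (enum_val j) = x 0 j by rewrite /u enum_valK_in.
  rewrite -uE; apply: nondeg => // l lK.
  move/rowP/(_ (enum_rank_in k0K l)): xA; rewrite !mxE => xAl; rewrite sumK -[RHS]xAl.
  apply: eq_bigr => j _; rewrite uE mxE enum_rankK_in// finset.setCK.
  by [].
pose y : 'cV[R]_#|~: ~: K| := \col_i (v (enum_val i) / lam).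
have invy : invE (remove_rc A (~: K)) = y.
  have By : remove_rc A (~: K) *m y = const_mx 1.
    apply/colP => i; rewrite !mxE.
    under eq_bigr do rewrite !mxE mulrA.
    by rewrite -mulr_suml -(sumK (fun k => A (enum_val i) k * v k)) crit// divff// lt0r_neq0.
  by rewrite /invE -By mulKmx// unitmxE unitfE.
have normy : norm_l1 y = lam^-1.
  rewrite /norm_l1; under eq_bigr do rewrite mxE ger0_norm ?divr_ge0 ?vS.1 ?ltW//.
  rewrite -mulr_suml -(sumK v) -[RHS]mul1r -vS.2; congr (_ * _).
  rewrite big_mkcond/=; apply: eq_bigr => k _.
  by case: ifPn => // /vK ->.
exists (~: K); split.
- split=> //.
    by rewrite -[X in (_ < X)%N]card_ord -(cardsC K) -[X in (X < _)%N]add0n ltn_add2r -(finset.setCK K) card_gt0; apply/set0Pn; exists k0.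
  by move=> i; rewrite invy mxE divr_ge0 ?vS.1// ltW.
- by move=> j; rewrite inE => /vK vj; rewrite sqrt_rV_sqr.
- move=> i; rewrite sqrt_rV_sqr// invy normy mxE invrK divfK// lt0r_neq0//.
Qed.

End candidate_of_critical_point.

Section product_of_linear_forms.
Context {R : realType} {d : nat}.
Variables p q : 'I_d -> R.
Hypothesis p0 : forall k, 0 < p k.
Hypothesis q0 : forall k, 0 < q k.
Implicit Types (v w : 'I_d -> R).

Let A : 'M[R]_d := \matrix_(j < d, k < d) ((p k * q j + p j * q k) / 2).

Definition product_form v := (\sum_k v k * p k) * (\sum_k v k * q k).
Local Notation F := product_form.

Definition supp v : {set 'I_d} := [set k | v k != 0]%SET.

Definition vertex j : 'I_d -> R := fun k => (k == j)%:R.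

Let sum_vertex j (g : 'I_d -> R) : \sum_k vertex j k * g k = g j.
Proof.
rewrite (bigD1 j)//= /vertex eqxx mul1r big1 ?addr0// => k /negPf ->.
by rewrite mul0r.
Qed.

Lemma simplex_vertex j : simplex (vertex j).
Proof.
split=> [k|]; first exact: ler0n.
by under eq_bigr do rewrite -[vertex _ _]mulr1; rewrite (sum_vertex j (fun=> 1)).
Qed.

Lemma product_form_vertex j : F (vertex j) = p j * q j.
Proof. by rewrite /F !sum_vertex. Qed.

Lemma candidate_vertex j : candidates A (sqrt_rV (vertex j)).
Proof.
have Ajj : A j j = p j * q j by rewrite mxE; field.
apply: (@candidate_critical _ _ _ [set j]%SET _ (p j * q j)).
- exact: simplex_vertex.
- by move=> k; rewrite inE /vertex => /negPf ->.
- exact: mulr_gt0.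
- by move=> i; rewrite inE => /eqP ->; rewrite big_set1 Ajj /vertex eqxx mulr1.
- move=> u /(_ j); rewrite inE eqxx big_set1 => /(_ isT)/eqP.
  rewrite mulf_eq0 Ajj mulf_eq0 !(gt_eqF (p0 _)) !(gt_eqF (q0 _)) !orbF => /eqP u0.
  by move=> k; rewrite inE => /eqP ->.
Qed.

Definition edge j k (t : R) : 'I_d -> R := fun i => t * vertex j i + (1 - t) * vertex k i.

Let sum_edge j k t (g : 'I_d -> R) : \sum_i edge j k t i * g i = t * g j + (1 - t) * g k.
Proof.
under eq_bigr do rewrite mulrDl -!mulrA.
by rewrite big_split/= -!mulr_sumr !sum_vertex.
Qed.

Lemma product_form_edge j k t : F (edge j k t) =
  t ^+ 2 * (p j * q j) + 2 * t * (1 - t) * ((p j * q k + p k * q j) / 2) +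
  (1 - t) ^+ 2 * (p k * q k).
Proof. by rewrite /F !sum_edge; field. Qed.

Lemma simplex_edge j k t : 0 <= t <= 1 -> simplex (edge j k t).
Proof.
move=> /andP[t0 t1]; split=> [i|].
  by rewrite addr_ge0// mulr_ge0// ?subr_ge0// ler0n.
under eq_bigr do rewrite -[edge _ _ _ _]mulr1.
by rewrite (sum_edge j k t (fun=> 1)) !mulr1 addrC subrK.
Qed.

(** On the edge the restricted matrix has rows (a, b) and (b, c), with determinant
    ac - b^2 < 0. *)
Lemma candidate_edge j k (a := p j * q j) (c := p k * q k)
    (b := (p j * q k + p k * q j) / 2) : a < b -> c < b ->
  candidates A (sqrt_rV (edge j k ((b - c) / (2 * b - a - c)))).
Proof.
move=> ab cb; have jk : j != k.
  by apply/eqP => jk; move: ab; rewrite /a /b jk; lra.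
have D0 : 0 < 2 * b - a - c by lra.
have a0 : 0 < a by exact: mulr_gt0.
have c0 : 0 < c by exact: mulr_gt0.
have det0 : 0 < b ^+ 2 - a * c by nra.
set t := (b - c) / _.
have Ajj : A j j = a by rewrite mxE /a; field.
have Akk : A k k = c by rewrite mxE /c; field.
have Ajk : A j k = b by rewrite mxE /b; field.
have Akj : A k j = b by rewrite mxE /b; field.
have ej : edge j k t j = t by rewrite /edge /vertex eqxx (negPf jk) mulr1 mulr0 addr0.
have ek : edge j k t k = 1 - t.
  by rewrite /edge /vertex eqxx eq_sym (negPf jk) mulr1 mulr0 add0r.
have tE : t * (2 * b - a - c) = b - c by rewrite /t divfK// lt0r_neq0.
have sum2 (G : 'I_d -> R) : \sum_(i in [set j; k]%SET) G i = G j + G k.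
  by rewrite big_setU1 ?inE//= big_set1.
apply: (@candidate_critical _ _ _ [set j; k]%SET _ ((b ^+ 2 - a * c) / (2 * b - a - c))).
- apply: simplex_edge; rewrite divr_ge0 ?ler_pdivrMr//=; lra.
- by move=> i; rewrite !inE negb_or /edge /vertex => /andP[/negPf -> /negPf ->]; rewrite !mulr0 addr0.
- exact: divr_gt0.
- move=> i; rewrite !inE => /orP[]/eqP ->; rewrite sum2 ej ek.
    by rewrite Ajj Ajk /t; field; rewrite lt0r_neq0.
  by rewrite Akj Akk /t; field; rewrite lt0r_neq0.
- move=> u h; have := h j; have := h k; rewrite !inE !eqxx orbT !sum2 Ajj Akk Ajk Akj.
  move=> /(_ isT) h1 /(_ isT) h2.
  have uj : u j = 0.
    apply: (mulIf (lt0r_neq0 det0)); rewrite mul0r.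
    transitivity (b * (u j * b + u k * c) - c * (u j * a + u k * b)); first by ring.
    by rewrite h1 h2 !mulr0 subrr.
  have uk : u k = 0.
    apply: (mulIf (lt0r_neq0 det0)); rewrite mul0r.
    transitivity (b * (u j * a + u k * b) - a * (u j * b + u k * c)); first by ring.
    by rewrite h1 h2 !mulr0 subrr.
  by move=> i; rewrite !inE => /orP[]/eqP ->.
Qed.

(** The product is the quadratic form a t^2 + 2 b t (1 - t) + c (1 - t)^2. If b
    exceeds a and c it is concave with its maximum inside the edge; otherwise it
    is at most the larger of a and c. *)
Lemma edge_max j k : exists v, [/\ simplex v, candidates A (sqrt_rV v) &
  forall t, 0 <= t <= 1 -> F (edge j k t) <= F v].
Proof.
pose a := p j * q j; pose c := p k * q k; pose b := (p j * q k + p k * q j) / 2.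
have [/andP[ab cb]|nab] := boolP ((a < b) && (c < b)).
  have D0 : 0 < 2 * b - a - c by lra.
  exists (edge j k ((b - c) / (2 * b - a - c))); split.
  - by apply: simplex_edge; rewrite divr_ge0 ?ler_pdivrMr//=; lra.
  - exact: candidate_edge.
  - move=> t _; rewrite !product_form_edge -/a -/c -/b -subr_ge0.
    rewrite [X in 0 <= X](_ : _ = (t * (2 * b - a - c) - (b - c)) ^+ 2 / (2 * b - a - c)).
      by rewrite divr_ge0 ?sqr_ge0// ltW.
    by field; rewrite lt0r_neq0.
have vert i : (forall t, 0 <= t <= 1 -> F (edge j k t) <= p i * q i) ->
    exists v, [/\ simplex v, candidates A (sqrt_rV v) &
      forall t, 0 <= t <= 1 -> F (edge j k t) <= F v].
  move=> H; exists (vertex i); split; [exact: simplex_vertex|exact: candidate_vertex|].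
  by move=> t /H; rewrite product_form_vertex.
have bm : b <= Num.max a c by rewrite le_max !leNgt -negb_and.
have edge_le m : a <= m -> b <= m -> c <= m -> forall t, 0 <= t <= 1 -> F (edge j k t) <= m.
  move=> am {}bm cm t /andP[t0 t1]; rewrite product_form_edge -/a -/b -/c.
  rewrite (_ : m = t ^+ 2 * m + 2 * t * (1 - t) * m + (1 - t) ^+ 2 * m); last by ring.
  have t1' : 0 <= 1 - t by rewrite subr_ge0.
  apply: lerD; first apply: lerD; rewrite ler_wpM2l// ?sqr_ge0//.
  by rewrite mulr_ge0// mulr_ge0.
have [ac|ca] := leP a c.
  by apply: (vert k); apply: edge_le => //; rewrite (le_trans bm)// ge_max ac lexx.
by apply: (vert j); apply: edge_le; rewrite ?(ltW ca)// (le_trans bm)// ge_max lexx ltW.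
Qed.

(** The point leaves the simplex at the smallest ratio v_k / (- w_k) with
    w_k < 0, where the k-th coordinate vanishes. *)
Lemma simplex_exit v w : simplex v -> (forall k, v k = 0 -> w k = 0) ->
  \sum_k w k = 0 -> (exists k, w k < 0) ->
  exists t, [/\ 0 <= t, simplex (fun k => v k + t * w k) &
                (#|supp (fun k => v k + t * w k)%R| < #|supp v|)%N].
Proof.
move=> [v0 v1] vw w0 [k0 wk0].
pose r k := v k / - w k.
have [k /= wk km] := @arg_minP _ _ _ k0 (fun k => w k < 0) r wk0.
have t0 : 0 <= r k by rewrite divr_ge0// oppr_ge0 ltW.
have vk : v k + r k * w k = 0.
  by rewrite /r invrN mulrN mulNr divfK ?subrr// ltr0_neq0.
exists (r k); split=> //.
  split=> [i|]; last by rewrite big_split/= -mulr_sumr v1 w0 mulr0 addr0.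
  have [wi|wi] := ltP (w i) 0; last by rewrite addr_ge0// mulr_ge0.
  have := km i wi; rewrite {2}/r ler_pdivlMr ?oppr_gt0// mulrN.
  by rewrite -subr_ge0 opprK.
apply: proper_card; apply/properP; split.
  apply/fintype.subsetP => i; rewrite !inE; apply: contraNneq => vi.
  by rewrite vi (vw i vi) mulr0 addr0.
exists k; rewrite !inE ?vk ?eqxx//.
by apply: contraTneq wk => /vw ->; rewrite ltxx.
Qed.

(** Among three points there are nonzero weights of sum 0 that are orthogonal to
    the first form: the minors p_j - p_k, p_k - p_i, p_i - p_j or 1, -1, 0
    if these vanish. Their sign is chosen so that the second form does not decrease. *)
Lemma product_form_reduce v : simplex v -> (2 < #|supp v|)%N ->
  exists v', [/\ simplex v', (#|supp v'| < #|supp v|)%N & F v <= F v'].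
Proof.
move=> vS; have [v0 v1] := vS.
case/card_gt2P => i [j [k [[]]]]; rewrite !inE => vi vj vk [ij jk ki].
(* a direction in the affine hull of the support that fixes the first form *)
have [w [wn0 w0 wv wp]] : exists w, [/\ exists l, w l != 0, \sum_l w l = 0,
    forall l, v l = 0 -> w l = 0 & \sum_l w l * p l = 0].
  pose comb (x y z : R) l := x * vertex i l + y * vertex j l + z * vertex k l.
  have sumc x y z g : \sum_l comb x y z l * g l = x * g i + y * g j + z * g k.
    under eq_bigr do rewrite 2!mulrDl -!mulrA.
    by rewrite 2!big_split/= -!mulr_sumr !sum_vertex.
  have supc x y z l : v l = 0 -> comb x y z l = 0.
    move=> vl; rewrite /comb /vertex.
    have ne m : v m != 0 -> (l == m) = false by apply: contraNF => /eqP <-; rewrite vl.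
    by rewrite !ne// !mulr0 !addr0.
  have sum1 x y z : \sum_l comb x y z l = x + y + z.
    under eq_bigr do rewrite -[comb _ _ _ _]mulr1.
    by rewrite (sumc x y z (fun=> 1)) !mulr1.
  have ci x y z : comb x y z i = x.
    by rewrite /comb /vertex eqxx (negPf ij) eq_sym (negPf ki) mulr1 !mulr0 !addr0.
  have [pjk|pjk] := eqVneq (p j) (p k); last first.
    exists (comb (p j - p k) (p k - p i) (p i - p j)); split.
    - by exists i; rewrite ci subr_eq0.
    - by rewrite sum1; ring.
    - exact: supc.
    - by rewrite sumc; ring.
  have [pij|pij] := eqVneq (p i) (p j); last first.
    exists (comb (p j - p k) (p k - p i) (p i - p j)); split.
    - exists j; rewrite /comb /vertex eqxx (eq_sym j i) (negPf ij) (negPf jk).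
      by rewrite !mulr0 mulr1 add0r addr0 -pjk subr_eq0 eq_sym.
    - by rewrite sum1; ring.
    - exact: supc.
    - by rewrite sumc; ring.
  exists (comb 1 (- 1) 0); split.
  - by exists i; rewrite ci oner_neq0.
  - by rewrite sum1; ring.
  - exact: supc.
  - by rewrite sumc pij; ring.
wlog wq : w wn0 w0 wv wp / 0 <= \sum_l w l * q l.
  move=> H; have [|/ltW wq] := leP 0 (\sum_l w l * q l); first exact: H.
  apply: (H (fun l => - w l)).
  - by case: wn0 => l wl; exists l; rewrite oppr_eq0.
  - by rewrite sumrN w0 oppr0.
  - by move=> l /wv ->; rewrite oppr0.
  - by under eq_bigr do rewrite mulNr; rewrite sumrN wp oppr0.
  - by under eq_bigr do rewrite mulNr; rewrite sumrN oppr_ge0.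
have [t [t0 tS tc]] : exists t, [/\ 0 <= t, simplex (fun k => v k + t * w k) &
                (#|supp (fun k => v k + t * w k)%R| < #|supp v|)%N].
  apply: simplex_exit => //; case: wn0 => l wl.
  apply/existsP; apply: contraNT wl; rewrite negb_exists => /forallP wge.
  have wge0 m : true -> 0 <= w m by rewrite leNgt wge.
  by have /eqP := w0; rewrite psumr_eq0// => /allP/(_ l (mem_index_enum _)).
exists (fun k => v k + t * w k); split=> //.
have lin g : \sum_l (v l + t * w l) * g l = \sum_l v l * g l + t * \sum_l w l * g l.
  by under eq_bigr do rewrite mulrDl -mulrA; rewrite big_split/= -mulr_sumr.
rewrite /F !lin wp mulr0 addr0 ler_wpM2l//.
  by apply: sumr_ge0 => l _; rewrite mulr_ge0// ltW.
by rewrite lerDl mulr_ge0.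
Qed.

Lemma product_form_le_edge v : simplex v ->
  exists j k t, 0 <= t <= 1 /\ F v <= F (edge j k t).
Proof.
have [n] := ubnP #|supp v|; elim: n v => // n IH v vn vS.
have [s2|s2] := ltnP 2 #|supp v|.
  have [v' [vS' lt le]] := product_form_reduce vS s2.
  have [|j [k [t [t01 h]]]] := IH v' _ vS'; first exact: leq_trans lt vn.
  by exists j, k, t; split=> //; exact: le_trans h.
have [v0 v1] := vS.
have [j jv] : exists j, j \in supp v.
  apply/set0Pn; apply: contra_neq (oner_neq0 R) => s0.
  rewrite -v1; apply: big1 => k _; apply/eqP/negPn/negP => vk.
  by have := finset.in_set0 k; rewrite -s0 inE vk.
have [k jk] : exists k, forall i, i != j -> i != k -> v i = 0.
  have [s0|/set0Pn[k]] := eqVneq (supp v :\ j)%SET finset.set0.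
    exists j => i ij _; apply/eqP/negPn/negP => vi.
    by have := finset.in_set0 i; rewrite -s0 !inE ij vi.
  move=> kS; exists k => i ij ik; apply/eqP/negPn/negP => vi.
  have : (#|[set j; k; i]%SET| <= 2)%N.
    apply: leq_trans s2; apply: subset_leq_card; apply/fintype.subsetP => l.
    move: jv kS; rewrite !inE => jv /andP[kj kv].
    by move=> /orP[/orP[]|] /eqP ->.
  move: kS; rewrite !inE => /andP[kj _].
  by rewrite -finset.setUA cardsU1 cards2 !inE negb_or !(eq_sym _ i) ij ik eq_sym kj.
exists j, k, (v j); have vj1 : v j <= 1.
  by rewrite -v1 (bigD1 j)//= lerDl sumr_ge0.
split; first by rewrite v0.
have [kj|kj] := eqVneq k j.
  have vj : v j = 1.
    by rewrite -v1 (bigD1 j)//= big1 ?addr0// => i ij; apply: jk => //; rewrite kj.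
  suff vE : v = edge j k (v j) by rewrite -vE.
  apply/funext => i; rewrite /edge /vertex vj subrr mul0r addr0 mul1r.
  by have [->//|ij] := eqVneq i j; apply: jk => //; rewrite kj.
suff vE : v = edge j k (v j) by rewrite -vE.
have vk : v k = 1 - v j.
  rewrite -v1 (bigD1 j)//= (bigD1 k)//= big1 ?addr0 => [|i /andP[]]; last exact: jk.
  by rewrite addrC addrK.
apply/funext => i; rewrite /edge /vertex.
have [->|ij] := eqVneq i j.
  by rewrite eq_sym (negPf kj) mulr1 mulr0 addr0.
have [->|ik] := eqVneq i k; first by rewrite mulr0 add0r mulr1.
by rewrite !mulr0 addr0 jk.
Qed.

Lemma product_form_max (j0 : 'I_d) : exists v, [/\ simplex v, candidates A (sqrt_rV v) &
  forall u, simplex u -> F u <= F v].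
Proof.
have [g gP] := fin_all_exists (fun jk : 'I_d * 'I_d => edge_max jk.1 jk.2).
have [m _ mP] := @arg_maxP _ _ _ (j0, j0) xpredT (fun jk => F (g jk)) isT.
have [gS gC _] := gP m.
exists (g m); split=> // u /product_form_le_edge[j [k [t [t01 uF]]]].
have [_ _ gF] := gP (j, k).
by rewrite (le_trans uF)// (le_trans (gF t t01))//; exact: mP.
Qed.

(** The product is the average of (p_i q_k + p_k q_i) / 2 with weights u_i u_k,
    and (p_i q_k) (p_k q_i) = (p_i q_i) (p_k q_k) >= m^2 for m the smallest
    p_j q_j. *)
Lemma product_form_min (j0 : 'I_d) : exists v, [/\ simplex v, candidates A (sqrt_rV v) &
  forall u, simplex u -> F v <= F u].
Proof.
have [j _ jm] := @arg_minP _ _ _ j0 xpredT (fun k => p k * q k) isT.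
exists (vertex j); split; [exact: simplex_vertex|exact: candidate_vertex|].
move=> u [u0 u1]; rewrite product_form_vertex.
set m := p j * q j.
have m0 : 0 < m by exact: mulr_gt0.
have F2 : F u + F u = \sum_i \sum_k u i * u k * (p i * q k + p k * q i).
  rewrite {1}/F {1}[(_ * _)]mulrC /F !big_distrlr/= -big_split/=; apply: eq_bigr => i _.
  by rewrite -big_split/=; apply: eq_bigr => k _; ring.
have m2 : m + m = \sum_i \sum_k u i * u k * (m + m).
  transitivity ((m + m) * ((\sum_i u i) * (\sum_k u k))); first by rewrite u1 !mulr1.
  rewrite big_distrlr/= mulr_sumr; apply: eq_bigr => i _.
  by rewrite mulr_sumr; apply: eq_bigr => k _; rewrite mulrC.
suff : m + m <= F u + F u by lra.
rewrite F2 m2; apply: ler_sum => i _; apply: ler_sum => k _.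
rewrite ler_wpM2l ?mulr_ge0//.
have := jm i isT; have := jm k isT; rewrite -/m => hk hi.
have x0 : 0 < p i * q k by exact: mulr_gt0.
have y0 : 0 < p k * q i by exact: mulr_gt0.
have xy : m * m <= (p i * q k) * (p k * q i).
  rewrite [leRHS](_ : _ = (p i * q i) * (p k * q k)); last by ring.
  by apply: ler_pM => //; exact: ltW.
move: x0 y0 xy; move: (p i * q k) (p k * q i) => x y x0 y0 xy.
have s0 : 0 <= x + y by rewrite addr_ge0 ?ltW.
have m00 : 0 <= m + m by rewrite addr_ge0 ?ltW.
rewrite -ler_sqr ?nnegrE//; apply: (@le_trans _ _ (4 * (x * y))); first by nra.
by have := sqr_ge0 (x - y); nra.
Qed.

End product_of_linear_forms.

(** * Extremal directions of the uncertainty product *)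

Theorem theorem7 (R : realType) (d : nat) (d_gt0 : (0 < d)%N)
    (f fhat : 'rV[R]_d -> R[i])
    (fA : domA f) (fB : domB f) (f_unit : normL2 f = 1)
    (fhatE : is_fourierL2 f fhat)
    (f_even : forall k : 'I_d, modulus_even f k)
    (fhat_even : forall k : 'I_d, modulus_even fhat k) :
  let M := fun k : 'I_d => (2 * pi) ^+ 2 * moment2 f k in
  let Mhat := fun k : 'I_d => moment2 fhat k in
  let A : 'M[R]_d :=
    \matrix_(j < d, k < d) ((M k * Mhat j + M j * Mhat k) / 2) in
  let sphere := [set L : 'rV[R]_d | normE L = 1] in
  (exists m : R, is_min [set UP L f | L in sphere] m /\
                 is_min [set UP L f | L in candidates A] m) /\
  (exists m : R, is_max [set UP L f | L in sphere] m /\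
                 is_max [set UP L f | L in candidates A] m).
Proof.
move=> M Mhat A sphere.
have M0 k : 0 < M k.
  by rewrite mulr_gt0 ?moment_domA_gt0// exprn_gt0// mulr_gt0// pi_gt0.
have Mhat0 k : 0 < Mhat k by exact: (moment_H1_gt0 fB fhatE).
have UPE L : normE L = 1 -> UP L f = product_form M Mhat (fun k => L 0 k ^+ 2).
  exact: UP_moments.
have UPv v : simplex v -> UP (sqrt_rV v) f = product_form M Mhat v.
  move=> vS; rewrite UPE ?normE_sqrt_rV//; congr (product_form M Mhat _).
  by apply/funext => k; rewrite sqrt_rV_sqr.
have j0 : 'I_d := Ordinal d_gt0.
split.
  have [v [vS vC vmin]] := product_form_min M0 Mhat0 j0.
  have lb L : normE L = 1 -> UP (sqrt_rV v) f <= UP L f.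
    by move=> L1; rewrite UPv// UPE// vmin//; exact: simplex_sqr.
  exists (UP (sqrt_rV v) f); split; split.
  - by exists (sqrt_rV v) => //; exact: normE_sqrt_rV.
  - by move=> _ [L L1 <-]; exact: lb.
  - by exists (sqrt_rV v).
  - by move=> _ [L [L1 _] <-]; exact: lb.
have [v [vS vC vmax]] := product_form_max M0 Mhat0 j0.
have ub L : normE L = 1 -> UP L f <= UP (sqrt_rV v) f.
  by move=> L1; rewrite UPv// UPE// vmax//; exact: simplex_sqr.
exists (UP (sqrt_rV v) f); split; split.
- by exists (sqrt_rV v) => //; exact: normE_sqrt_rV.
- by move=> _ [L L1 <-]; exact: ub.
- by exists (sqrt_rV v).
- by move=> _ [L [L1 _] <-]; exact: ub.
Qed.
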